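(* Consider the linear regression model with random design and known noise variance $\sigma^2=1$ described in the context. Assume that the random variables $X_{ij}$, $1\le j\le p$, $1\le i\le n$, are independent and that $\max_{1\le j<l\le p}E((U_jU_l)^4)=O(1)$. Let $$t_1=N^{-1/2}\sum_{1\le i<s\le n}p^{-1/2}\,Y_iY_s\sum_{j=1}^pX_{ij}X_{sj},\qquad N=\frac{n(n-1)}2,$$ and $\psi^1_\alpha=\mathbf{1}_{\{t_1>u_\alpha\}}$, where $u_\alpha$ is the $(1-\alpha)$-quantile of the standard Gaussian distribution. For all $\alpha\in(0,1)$: (i) The type I error satisfies $\alpha(\psi^1_\alpha)=\alpha+o(1)$. (ii) If $p=o(n^2)$ and $r_{np}>0$ is such that $nr_{np}^2/\sqrt p\to\infty$, then $\beta(\psi^1_\alpha,\Theta_p(r_{np}))\to 0$.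
   Context: All limits and $o,O$ symbols are taken as $n\to\infty$ and $p\to\infty$ jointly. Model: one observes $Z=(X,Y)$ with $X=(X_{ij})_{1\le i\le n,1\le j\le p}$, $Y=(Y_1,\dots,Y_n)$ and $Y_i=\sum_{j=1}^p\theta_jX_{ij}+\xi_i$, where $\theta\in\mathbb{R}^p$ is unknown, the $\xi_i$ are i.i.d. $\mathcal{N}(0,1)$, the $X_{ij}$ are identically distributed with $EX_{ij}=0$, $EX_{ij}^2=1$, and the family $(X_{ij})$ is independent of $(\xi_i)$. $U_1,\dots,U_p$ are random variables such that, for all $1\le j<l\le p$ (and all $i$), $(U_j,U_l)$ has the same distribution as $(X_{ij},X_{il})$. $P_\theta$, $E_\theta$ denote the law of $Z$ and its expectation. $\|\cdot\|$ is the Euclidean norm and $\Theta_p(r)=\{\theta\in\mathbb{R}^p:\|\theta\|\ge r\}$. For a test $\psi$ (a measurable function of $Z$ with values in $[0,1]$), $\alpha(\psi)=E_0(\psi)$ and $\beta(\psi,\Theta)=\sup_{\theta\in\Theta}E_\theta(1-\psi)$. *)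

(* Defs.v *)
From HB Require Import structures.
From mathcomp Require Import all_boot all_order all_algebra.
From mathcomp Require Import all_classical all_reals all_analysis.
From mathcomp Require Import measurable_realfun.

Set Implicit Arguments.
Unset Strict Implicit.
Unset Printing Implicit Defensive.

Import Order.TTheory GRing.Theory Num.Theory.
Import numFieldNormedType.Exports.

Local Open Scope classical_set_scope.
Local Open Scope ring_scope.

Section independence.
Context d (T : measurableType d) (R : realType) (P : probability T R).

Definition mutually_independent (I : finType) d' (T' : measurableType d')
    (V : I -> T -> T') : Prop :=
  forall (J : {set I}) (B : I -> set T'),
    (forall i, i \in J -> measurable (B i)) ->
    P (\bigcap_(i in [set` J]) (V i @^-1` B i)) =
    (\prod_(i in J) P (V i @^-1` B i))%E.

Definition independent_pair d1 (T1 : measurableType d1)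
    d2 (T2 : measurableType d2) (V : T -> T1) (W : T -> T2) : Prop :=
  forall (A : set T1) (B : set T2), measurable A -> measurable B ->
    P (V @^-1` A `&` W @^-1` B) = (P (V @^-1` A) * P (W @^-1` B))%E.

End independence.

(* The observations Z = (X, Y).  Tuples, unlike matrices, carry the product
   sigma-algebra in the library. *)
Notation design R n p := (n.-tuple (p.-tuple R)).
Notation response R n := (n.-tuple R).
Notation sample R n p := (design R n p * response R n)%type.

Section model.
Context (R : realType) d (T : measurableType d) (P : probability T R).
Variables (n p : nat).
Variables (X : 'I_n -> 'I_p -> {RV P >-> R}) (xi : 'I_n -> {RV P >-> R}).

Definition design_of (w : T) : design R n p :=
  [tuple [tuple X i j w | j < p] | i < n].

Definition noise_of (w : T) : response R n := [tuple xi i w | i < n].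

Definition response_of (theta : 'rV[R]_p) (w : T) : response R n :=
  [tuple \sum_(j < p) theta 0 j * X i j w + xi i w | i < n].

Definition sample_of (theta : 'rV[R]_p) (w : T) : sample R n p :=
  (design_of w, response_of theta w).

Lemma measurable_sample_of theta : measurable_fun [set: T] (sample_of theta).
Proof.
apply/measurable_fun_pairP; split.
  apply/measurable_fun_tnthP => i.
  apply/measurable_fun_tnthP => j.
  rewrite (_ : _ \o _ = X i j) //.
  by apply/funext => w; rewrite /= !tnth_mktuple.
apply/measurable_fun_tnthP => i.
rewrite (_ : _ \o _ = fun w => \sum_(j < p) theta 0 j * X i j w + xi i w).
  apply: measurable_funD => //; apply: measurable_sum => j.
  exact: measurable_funM.
by apply/funext => w; rewrite /= tnth_mktuple.
Qed.

HB.instance Definition _ theta :=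
  isMeasurableFun.Build _ _ _ _ (sample_of theta) (measurable_sample_of theta).

(* P_theta *)
Definition law (theta : 'rV[R]_p) : probability (sample R n p) R :=
  distribution P (sample_of theta).

Record regression_model : Prop := {
  design_ident : forall i j i' j' (A : set R), measurable A ->
    distribution P (X i j) A = distribution P (X i' j') A;
  design_mean0 : forall i j, ('E_P[X i j] = 0)%E;
  design_var1 : forall i j, ('E_P[fun w => (X i j w ^+ 2)%R] = 1)%E;
  noise_indep : mutually_independent P xi;
  noise_normal : forall i (A : set R), measurable A ->
    distribution P (xi i) A = normal_prob 0 1 A;
  design_noise_indep : independent_pair P design_of noise_of }.

Definition independent_design : Prop :=
  mutually_independent P (fun ij : 'I_n * 'I_p => X ij.1 ij.2).

Definition same_pair_law d' (T' : measurableType d') (Q : probability T' R)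
    (U : 'I_p -> {RV Q >-> R}) : Prop :=
  forall (i : 'I_n) (j l : 'I_p), (j < l)%N ->
  forall A : set (R * R), measurable A ->
    Q ((fun w => (U j w, U l w)) @^-1` A) =
    P ((fun w => (X i j w, X i l w)) @^-1` A).

Definition type1_error (psi : sample R n p -> R) : \bar R := ('E_(law 0)[psi])%E.

Definition type2_error (psi : sample R n p -> R) (Theta : set 'rV[R]_p) :
    \bar R :=
  ereal_sup [set ('E_(law theta)[fun z => (1 - psi z)%R])%E | theta in Theta].

End model.

(* max_(j < l) E((U_j U_l)^4); the default 0 is harmless since the moments are
   nonnegative *)
Definition max_pair_moment4 (R : realType) d (T : measurableType d)
    (Q : probability T R) (p : nat) (U : 'I_p -> {RV Q >-> R}) : \bar R :=
  \big[maxe/0%E]_(jl : 'I_p * 'I_p | (jl.1 < jl.2)%N)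
    ('E_Q[fun w => ((U jl.1 w * U jl.2 w) ^+ 4)%R])%E.

(* the library norm on 'rV[R]_p is the sup norm *)
Definition euclid_norm (R : realType) (p : nat) (theta : 'rV[R]_p) : R :=
  Num.sqrt (\sum_(j < p) theta 0 j ^+ 2).

Definition Theta (R : realType) (p : nat) (r : R) : set 'rV[R]_p :=
  [set theta | r <= euclid_norm theta].

Definition gauss_quantile (R : realType) (q : R) : R :=
  inf [set x : R | (q%:E <= normal_prob 0 1 `]-oo, x])%E].

Definition t1 (R : realType) (n p : nat) (z : sample R n p) : R :=
  let N : R := n%:R * (n%:R - 1) / 2 in
  (Num.sqrt N)^-1 *
  \sum_(i < n) \sum_(s < n | (i < s)%N)
    (Num.sqrt p%:R)^-1 * (tnth z.2 i * tnth z.2 s) *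
    \sum_(j < p) tnth (tnth z.1 i) j * tnth (tnth z.1 s) j.

Definition psi1 (R : realType) (n p : nat) (alpha : R) : sample R n p -> R :=
  \1_[set z | gauss_quantile (1 - alpha) < t1 z].

(* Main.v *)
(* Under the null hypothesis Y = xi, and t_1 is a sum over the columns j of
   statistics w_j which, given the noise, are independent and centred with
   common variance s(xi) / p, where s(xi) is the mean over the pairs i < s of
   xi_i^2 xi_s^2.  Replacing the w_j one at a time by Gaussian variables of
   variance 1 / p (Lindeberg) against a smoothed indicator costs the sum of the
   third absolute moments, which is O(p^(-1/2)), plus a multiple of
   E|s(xi) - 1| = O(n^(-1/2)).  Conditioning is expressed by testing against
   bounded functions of the earlier columns and the noise.

   For the power, write Y_i X_ij = theta_j + D_ij.  Then the centred statistic
   splits into a linear part and a degenerate quadratic part in the independent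
   centred rows D_i, orthogonal to each other, and their second moments give
   the bound by Chebyshev's inequality. *)

Require Import Defs.
From mathcomp Require Import all_boot all_order all_algebra.
From mathcomp Require Import all_classical all_reals all_analysis.
From mathcomp Require Import ring lra measurable_realfun.

Set Implicit Arguments.
Unset Strict Implicit.
Unset Printing Implicit Defensive.

Import Order.TTheory GRing.Theory Num.Theory.
Import numFieldNormedType.Exports.

Local Open Scope classical_set_scope.
Local Open Scope ring_scope.

(** The Gaussian replacements are never realised as random variables: those still present after [m]
    swaps have total variance (p - m)/p and are integrated out by convolving the test function with
    that normal law, so the swap takes place on the given probability space. The third moments come
    from fourth moments: a column statistic is a normalised quadratic form in the variables xi_i
    X_ij, whose fourth moment is bounded by induction on the sample size. The assumption on U_j U_l
    acts through independence, which turns it into a bound on (E X^4)^2; from then on one constant M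
    bounds all fourth moments, and every estimate is an explicit inequality in n, p and M, limits
    being taken only at the end. For the power, the variance bound divided by the squared mean
    contains only nonnegative powers of 1/||theta||^2, hence is worst at ||theta|| = r, which gives
    uniformity over the alternative; p = o(n^2) removes the part of the degenerate term that does
    not decrease with the signal. *)

Section real_expectation.
Context d (T : measurableType d) (R : realType) (P : probability T R).
Implicit Types f g : T -> R.

(** * Integrability, expectation and orthogonality of real random variables *)

Definition L1 f := P.-integrable [set: T] (EFin \o f).
Definition mean f : R := \int[P]_w f w.

Lemma L1_measurable f : L1 f -> measurable_fun [set: T] f.
Proof. by move=> /integrableP[/measurable_EFinP]. Qed.

Lemma L1_le g f : measurable_fun [set: T] f -> L1 g ->
  (forall w, `|f w| <= g w) -> L1 f.
Proof.
move=> mf ig fg; apply: le_integrable ig => //; first exact/measurable_EFinP.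
by move=> w _ /=; rewrite lee_fin (le_trans (fg w))// ler_norm.
Qed.

Lemma L1_cst c : L1 (fun=> c).
Proof. exact: finite_measure_integrable_cst. Qed.

Lemma L1_bounded f c : measurable_fun [set: T] f -> (forall w, `|f w| <= c) ->
  L1 f.
Proof. by move=> mf fc; apply: L1_le (L1_cst c) fc. Qed.

Lemma L1D f g : L1 f -> L1 g -> L1 (fun w => f w + g w).
Proof. exact: integrableD. Qed.

Lemma L1Z c f : L1 f -> L1 (fun w => c * f w).
Proof. exact: integrableZl. Qed.

Lemma L1B f g : L1 f -> L1 g -> L1 (fun w => f w - g w).
Proof. exact: integrableB. Qed.

Lemma L1_sum (I : Type) (s : seq I) (Q : pred I) (F : I -> T -> R) :
  (forall i, Q i -> L1 (F i)) -> L1 (fun w => \sum_(i <- s | Q i) F i w).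
Proof.
move=> iF; rewrite /L1 (_ : _ \o _ =
    fun w => (\sum_(i <- s | Q i) (F i w)%:E)%E); last first.
  by apply/funext => w /=; rewrite sumEFin.
exact: integrable_sum.
Qed.

Lemma L1_norm f : L1 f -> L1 (fun w => `|f w|).
Proof. exact: integrable_norm. Qed.

Lemma L1_boundedM g f c : measurable_fun [set: T] g -> (forall w, `|g w| <= c) ->
  L1 f -> L1 (fun w => g w * f w).
Proof.
move=> mg gc if_; apply: (@L1_le (fun w => c * `|f w|)).
- by apply: measurable_funM => //; exact: L1_measurable.
- exact/L1Z/L1_norm.
- by move=> w; rewrite normrM ler_wpM2r.
Qed.

Lemma eq_mean f g : f =1 g -> mean f = mean g.
Proof. by move=> fg; congr mean; apply/funext. Qed.

Lemma mean_cst c : mean (fun=> c) = c.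
Proof. by rewrite /mean Rintegral_cst//= probability_setT mulr1. Qed.

Lemma meanD f g : L1 f -> L1 g -> mean (fun w => f w + g w) = mean f + mean g.
Proof. exact: RintegralD. Qed.

Lemma meanB f g : L1 f -> L1 g -> mean (fun w => f w - g w) = mean f - mean g.
Proof. exact: RintegralB. Qed.

Lemma meanZ c f : L1 f -> mean (fun w => c * f w) = c * mean f.
Proof. exact: RintegralZl. Qed.

Lemma mean_sum (I : Type) (s : seq I) (Q : pred I) (F : I -> T -> R) :
  (forall i, Q i -> L1 (F i)) ->
  mean (fun w => \sum_(i <- s | Q i) F i w) = \sum_(i <- s | Q i) mean (F i).
Proof.
move=> iF; elim: s => [|i s ih].
  by under eq_mean do rewrite big_nil; rewrite mean_cst big_nil.
under eq_mean do rewrite big_cons; rewrite big_cons; case: ifPn => // Qi.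
by rewrite meanD ?ih//; [exact: iF|exact: L1_sum].
Qed.

Lemma le_mean f g : L1 f -> L1 g -> (forall w, f w <= g w) -> mean f <= mean g.
Proof. by move=> *; exact: le_Rintegral. Qed.

Lemma mean_ge0 f : (forall w, 0 <= f w) -> 0 <= mean f.
Proof. by move=> f0; exact: Rintegral_ge0. Qed.

Lemma le_norm_mean f g : L1 f -> L1 g -> (forall w, `|f w| <= g w) ->
  `|mean f| <= mean g.
Proof.
move=> if_ ig fg; apply: le_trans (le_normr_Rintegral _ _) _ => //.
by apply: le_mean => //; exact: L1_norm.
Qed.

Lemma mean_EFin f : L1 f -> (mean f)%:E = (\int[P]_w (f w)%:E)%E.
Proof. by move=> if_; rewrite fineK//; exact: integrable_fin_num. Qed.

Lemma L1_ge0 f : measurable_fun [set: T] f -> (forall w, 0 <= f w) ->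
  (\int[P]_w (f w)%:E < +oo)%E -> L1 f.
Proof.
move=> mf f0 foo; apply/integrableP; split; first exact/measurable_EFinP.
rewrite (eq_integral (fun w => (f w)%:E))// => w _.
by rewrite /= ger0_norm.
Qed.

(** Nonnegativity of the variance. *)
Lemma sqr_mean_le f : L1 f -> L1 (fun w => f w ^+ 2) ->
  mean f ^+ 2 <= mean (fun w => f w ^+ 2).
Proof.
move=> if_ if2; set c := mean f.
have : 0 <= mean (fun w => (f w - c) ^+ 2) by apply: mean_ge0 => w; exact: sqr_ge0.
have -> : mean (fun w => (f w - c) ^+ 2) =
    mean (fun w => f w ^+ 2 - (2 * c) * f w + c ^+ 2).
  by apply: eq_mean => w; ring.
have icf : L1 (fun w => 2 * c * f w) by exact: L1Z.
rewrite meanD; [|exact: L1B|exact: L1_cst].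
by rewrite meanB// meanZ// mean_cst -/c => h; lra.
Qed.

Definition L2 f := measurable_fun [set: T] f /\ L1 (fun w => f w ^+ 2).

Lemma L2_L1 f : L2 f -> L1 f.
Proof.
move=> [mf if2]; apply: (@L1_le (fun w => 1 + f w ^+ 2)) => //.
  by apply: L1D => //; exact: L1_cst.
by move=> w; rewrite ler_norml; nra.
Qed.

Lemma L2M f g : L2 f -> L2 g -> L1 (fun w => f w * g w).
Proof.
move=> [mf if2] [mg ig2]; apply: (@L1_le (fun w => f w ^+ 2 + g w ^+ 2)).
- exact: measurable_funM.
- exact: L1D.
- move=> w; rewrite ler_norml; nra.
Qed.

Lemma L2_cst c : L2 (fun=> c).
Proof. by split => //; exact: L1_cst. Qed.

Lemma L2D f g : L2 f -> L2 g -> L2 (fun w => f w + g w).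
Proof.
move=> [mf if2] [mg ig2]; split; first exact: measurable_funD.
apply: (@L1_le (fun w => 2 * (f w ^+ 2 + g w ^+ 2))).
- by apply: measurable_funX; exact: measurable_funD.
- by apply: L1Z; exact: L1D.
- by move=> w; rewrite ger0_norm ?sqr_ge0//; have := sqr_ge0 (f w - g w); nra.
Qed.

Lemma L2Z c f : L2 f -> L2 (fun w => c * f w).
Proof.
move=> [mf if2]; split; first exact: measurable_funM.
rewrite (_ : (fun w => _) = fun w => c ^+ 2 * f w ^+ 2); first exact: L1Z.
by apply/funext => w; rewrite exprMn.
Qed.

Lemma L2_sum (I : Type) (s : seq I) (Q : pred I) (F : I -> T -> R) :
  (forall i, Q i -> L2 (F i)) -> L2 (fun w => \sum_(i <- s | Q i) F i w).
Proof.
move=> iF; elim: s => [|i s ih].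
  by under eq_fun do rewrite big_nil; exact: L2_cst.
case Qi : (Q i); under eq_fun do rewrite big_cons Qi; last exact: ih.
by apply: L2D => //; exact: iF.
Qed.

Lemma mean_sqr_sum_orthogonal (I : finType) (Q : pred I) (F : I -> T -> R) :
  (forall i, Q i -> L2 (F i)) ->
  (forall i j, Q i -> Q j -> i != j -> mean (fun w => F i w * F j w) = 0) ->
  mean (fun w => (\sum_(i | Q i) F i w) ^+ 2) =
  \sum_(i | Q i) mean (fun w => F i w ^+ 2).
Proof.
move=> iF orthF.
transitivity (mean (fun w => \sum_(i | Q i) \sum_(j | Q j) F i w * F j w)).
  by apply: eq_mean => w; rewrite expr2 big_distrlr.
rewrite mean_sum; last by move=> i Qi; apply: L1_sum => j Qj; apply: L2M; exact: iF.
apply: eq_bigr => i Qi.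
rewrite mean_sum; last by move=> j Qj; apply: L2M; exact: iF.
rewrite (bigD1 i)//= big1 ?addr0// => j /andP[Qj ji].
by apply: orthF => //; rewrite eq_sym.
Qed.

End real_expectation.

(** * Independence of generated sigma-algebras *)

Section independent_systems.
Context d (T : measurableType d) (R : realType) (P : probability T R).

(** As functions of [A] both sides are finite measures, the restriction of [P] to [B] and the
    multiple [P B] of [P]; they agree on the pi-system [G], hence on the sigma-algebra it
    generates. *)
Lemma independent_sigma_algebra_l (G : set (set T)) (B : set T) :
  measurable B -> G `<=` measurable -> setI_closed G -> G setT ->
  (forall A, G A -> P (A `&` B) = (P A * P B)%E) ->
  forall A, <<s G >> A -> P (A `&` B) = (P A * P B)%E.
Proof.
move=> mB Gm GI GT PG A sA.
have PB : P B = (fine (P B))%:E by rewrite fineK// fin_num_measure.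
have PB0 : 0 <= fine (P B) by exact: fine_ge0.
rewrite PB muleC; pose b := NngNum PB0.
rewrite -[LHS]/(mrestr P mB A) -[RHS]/(mscale b P A).
apply: (@g_sigma_algebra_measure_unique _ _ _ G Gm (fun=> setT)) => //.
- by rewrite bigcup_const.
- by move=> C GC; rewrite [LHS]PG// [RHS]/= /mscale /= -PB muleC.
- move=> k; change (P (setT `&` B) < +oo)%E.
  by rewrite ltey_eq fin_num_measure//; exact: measurableI.
Qed.

(** One generating system is enlarged at a time: the outer use of the one-sided lemma fixes an event
    generated by [H], the inner one an event of [G]. *)
Lemma independent_sigma_algebra (G H : set (set T)) :
  G `<=` measurable -> setI_closed G -> G setT ->
  H `<=` measurable -> setI_closed H -> H setT ->
  (forall A B, G A -> H B -> P (A `&` B) = (P A * P B)%E) ->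
  forall A B, <<s G >> A -> <<s H >> B -> P (A `&` B) = (P A * P B)%E.
Proof.
move=> Gm GI GT Hm HI HT PGH A B sA sB.
apply: (independent_sigma_algebra_l _ Gm) => //.
  exact: (smallest_sub (@sigma_algebra_measurable _ T) Hm).
move=> C GC; rewrite setIC muleC.
apply: (independent_sigma_algebra_l _ Hm) => //; first exact: Gm.
by move=> D HD; rewrite setIC muleC PGH.
Qed.

End independent_systems.

(** * Product formulas for two independent variables *)

Section independent_functions.
Context d (T : measurableType d) (R : realType) (P : probability T R).
Variables f g : T -> R.
Hypotheses (mf : measurable_fun [set: T] f) (mg : measurable_fun [set: T] g).
Hypothesis fg_indep : independent_pair P f g.

Let F : {mfun T >-> R} := mfun_Sub (mem_set mf).
Let G : {mfun T >-> R} := mfun_Sub (mem_set mg).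
Let mFG : measurable_fun [set: T] (fun w => (f w, g w)).
Proof. exact/measurable_fun_pairP. Qed.
Let FG : {mfun T >-> (R * R)%type} := mfun_Sub (mem_set mFG).

(** Independence on rectangles is what uniqueness of the product measure asks for; the product
    formulas below are Fubini under this law. *)
Let lawE A : measurable A ->
  (distribution P F \x distribution P G)%E A = distribution P FG A.
Proof.
apply: (@product_measure_unique _ _ _ _ _ _ _ (distribution P FG)) => B C mB mC.
exact: fg_indep.
Qed.

(** The extended-real version comes first because it supplies the integrability of products, from
    which the signed version starts. *)
Lemma ge0_integral_indep (a b : R -> \bar R) :
  measurable_fun [set: R] a -> measurable_fun [set: R] b ->
  (forall x, 0 <= a x)%E -> (forall x, 0 <= b x)%E ->
  (\int[P]_w (a (f w) * b (g w)) = \int[P]_w a (f w) * \int[P]_w b (g w))%E.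
Proof.
move=> ma mb a0 b0.
have mab : measurable_fun [set: R * R] (fun z : R * R => (a z.1 * b z.2)%E).
  by apply: emeasurable_funM; apply: measurableT_comp.
transitivity (\int[distribution P FG]_z (a z.1 * b z.2))%E.
  by rewrite ge0_integral_distribution// => z; rewrite mule_ge0.
transitivity (\int[(distribution P F \x distribution P G)%E]_z (a z.1 * b z.2))%E.
  by apply: eq_measure_integral => A mA _; exact/esym/lawE.
rewrite fubini_tonelli1//=; last by move=> z; rewrite mule_ge0.
rewrite /fubini_F /=.
under eq_integral do rewrite ge0_integralZl//.
rewrite ge0_integralZr//; last by apply: integral_ge0.
by rewrite !ge0_integral_distribution.
Qed.

Lemma L1M_indep : L1 P f -> L1 P g -> L1 P (fun w => f w * g w).
Proof.
move=> /integrableP[_ foo] /integrableP[_ goo].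
apply/integrableP; split; first exact/measurable_EFinP/measurable_funM.
under eq_integral do rewrite /= normrM EFinM.
rewrite (@ge0_integral_indep (fun x => `|x|%:E) (fun x => `|x|%:E))//.
  by rewrite lte_mul_pinfty ?integral_ge0// ge0_fin_numE ?integral_ge0.
- by apply/measurable_EFinP; exact: normr_measurable.
- by apply/measurable_EFinP; exact: normr_measurable.
Qed.

Lemma meanM_indep : L1 P f -> L1 P g ->
  mean P (fun w => f w * g w) = mean P f * mean P g.
Proof.
move=> if_ ig; have ifg := L1M_indep if_ ig.
have m12 : measurable_fun [set: R * R] (fun z : R * R => (z.1 * z.2)%:E).
  by apply/measurable_EFinP/measurable_funM.
have ilaw : (distribution P F \x distribution P G)%E.-integrable setT
    (fun z : R * R => (z.1 * z.2)%:E).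
  apply/integrableP; split => //.
  rewrite (@eq_measure_integral _ _ _ _ (distribution P FG)); last first.
    by move=> A mA _; exact/lawE.
  rewrite ge0_integral_distribution//; last exact: measurableT_comp.
  by case/integrableP: ifg.
apply: EFin_inj; rewrite mean_EFin// EFinM !mean_EFin//.
transitivity (\int[distribution P FG]_z (z.1 * z.2)%:E)%E.
  by rewrite integral_distribution.
transitivity (\int[(distribution P F \x distribution P G)%E]_z (z.1 * z.2)%:E)%E.
  by apply: eq_measure_integral => A mA _; exact/esym/lawE.
rewrite -integral12_prod_meas1// /fubini_F /=.
have iF : (distribution P F).-integrable setT (@EFin R).
  exact: integrable_pushforward.
have iG : (distribution P G).-integrable setT (@EFin R).
  exact: integrable_pushforward.
under eq_integral do rewrite (eq_integral _ _ (fun y _ => EFinM _ _)) integralZl//.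
have -> : (\int[distribution P G]_y y%:E = (mean P g)%:E)%E.
  by rewrite integral_distribution// mean_EFin.
rewrite integralZr// mean_EFin//.
by rewrite integral_distribution.
Qed.

End independent_functions.

(** * Functions of disjoint blocks of an independent family *)

Section independent_family.
Context d (T : measurableType d) (R : realType) (P : probability T R).
Variables (K : finType) (V : K -> T -> R).
Hypothesis mV : forall i, measurable_fun [set: T] (V i).
Implicit Types (A B : {set K}) (f g : T -> R).

(** A pi-system generating the sigma-algebra of the [V i] with [i] in [A]. Below, [depends_on A] is
    measurability with respect to that sigma-algebra, so blocks of variables are handled without
    product spaces. *)
Definition cylinders A : set (set T) :=
  [set E | exists B : K -> set R, (forall i, measurable (B i)) /\
    E = \bigcap_(i in [set` A]) (V i @^-1` B i)].

Definition depends_on A f :=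
  measurable_fun [set: g_sigma_algebraType (cylinders A)] f.

Lemma cylinders_measurable A : cylinders A `<=` measurable.
Proof.
move=> _ [B [mB ->]]; apply: fin_bigcap_measurable => // i _.
by rewrite -[_ @^-1` _]setTI; exact: mV.
Qed.

Lemma cylinders_setI A : setI_closed (cylinders A).
Proof.
move=> _ _ [B [mB ->]] [C [mC ->]]; exists (fun i => B i `&` C i).
split; first by move=> i; exact: measurableI.
by rewrite -bigcapI.
Qed.

Lemma cylindersT A : cylinders A setT.
Proof. by exists (fun=> setT); split => //; apply/seteqP; split. Qed.

Lemma cylinders_sub A B : A \subset B -> cylinders A `<=` cylinders B.
Proof.
move=> AB _ [C [mC ->]]; exists (fun i => if i \in A then C i else setT).
split=> [i|]; first by case: ifP.
apply/seteqP; split=> w /= AC i /= iAB.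
  by case: ifPn => // iA; exact: AC.
by have := AC i (fintype.subsetP AB _ iAB); rewrite /= iAB.
Qed.

Lemma depends_on_sub A B f : A \subset B -> depends_on A f -> depends_on B f.
Proof.
move=> AB fA _ C mC; have := fA measurableT C mC.
apply: sub_smallest2r; [exact: smallest_sigma_algebra|exact: cylinders_sub].
Qed.

Lemma depends_on_measurable A f : depends_on A f -> measurable_fun [set: T] f.
Proof.
move=> fA _ C mC; have := fA measurableT C mC.
by apply: smallest_sub; [exact: sigma_algebra_measurable|exact: cylinders_measurable].
Qed.

Lemma depends_on_var A i : i \in A -> depends_on A (V i).
Proof.
move=> iA _ C mC; apply: sub_gen_smallest; rewrite setTI.
exists (fun j => if j == i then C else setT); split=> [j|]; first by case: ifP.
apply/seteqP; split=> w /=; last by move=> /(_ i iA) /=; rewrite eqxx.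
by move=> Cw j _ /=; case: ifP => // /eqP ->.
Qed.

Lemma depends_on_cst A c : depends_on A (fun=> c).
Proof. exact: measurable_cst. Qed.

Lemma depends_onD A f g : depends_on A f -> depends_on A g ->
  depends_on A (fun w => f w + g w).
Proof. exact: measurable_funD. Qed.

Lemma depends_onM A f g : depends_on A f -> depends_on A g ->
  depends_on A (fun w => f w * g w).
Proof. exact: measurable_funM. Qed.

Lemma depends_onB A f g : depends_on A f -> depends_on A g ->
  depends_on A (fun w => f w - g w).
Proof. exact: measurable_funB. Qed.

Lemma depends_onX A f m : depends_on A f -> depends_on A (fun w => f w ^+ m).
Proof. exact: measurable_funX. Qed.

Lemma depends_on_sum A (J : Type) (s : seq J) (Q : pred J) (F : J -> T -> R) :
  (forall j, Q j -> depends_on A (F j)) ->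
  depends_on A (fun w => \sum_(j <- s | Q j) F j w).
Proof.
move=> FA; elim: s => [|j s ih].
  by under eq_fun do rewrite big_nil; exact: depends_on_cst.
case Qj : (Q j); under eq_fun do rewrite big_cons Qj; last exact: ih.
by apply: depends_onD => //; exact: FA.
Qed.

Lemma depends_on_comp A f (h : R -> R) : measurable_fun [set: R] h ->
  depends_on A f -> depends_on A (fun w => h (f w)).
Proof. by move=> mh fA; exact: (measurableT_comp mh fA). Qed.

Hypothesis V_indep : mutually_independent P V.

Lemma depends_on_indep A B f g : [disjoint A & B]%B ->
  depends_on A f -> depends_on B g -> independent_pair P f g.
Proof.
move=> AB fA gB C D mC mD.
apply: (@independent_sigma_algebra _ _ _ P (cylinders A) (cylinders B)).
- exact: cylinders_measurable.
- exact: cylinders_setI.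
- exact: cylindersT.
- exact: cylinders_measurable.
- exact: cylinders_setI.
- exact: cylindersT.
- move=> _ _ [E [mE ->]] [F [mF ->]].
  (* The two families of sets are glued: since [A] and [B] are disjoint, an intersection of two
     cylinders is one cylinder over the union, to which mutual independence applies. *)
  pose H i := if i \in A then E i else F i.
  have -> : \bigcap_(i in [set` A]) (V i @^-1` E i) `&`
      \bigcap_(i in [set` B]) (V i @^-1` F i) =
      \bigcap_(i in [set` A :|: B]) (V i @^-1` H i).
    apply/seteqP; split=> w /=.
      move=> [EA FB] i /=; rewrite inE /H => /orP[iA|iB].
        by rewrite iA; exact: EA.
      by rewrite (disjointFl AB iB); exact: FB.
    move=> HAB; split=> i /= iAB; have /= := HAB i.
      by rewrite !inE /H iAB; apply.
    by rewrite !inE /H iAB orbT (disjointFl AB iAB); apply.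
  rewrite !V_indep//; last by move=> i _; rewrite /H; case: ifP.
  rewrite (eq_bigl [predU A & B]); last by move=> i; rewrite !inE.
  rewrite bigU//=; congr (_ * _)%E; apply: eq_bigr => i iAB; rewrite /H.
    by rewrite iAB.
  by rewrite (disjointFl AB iAB).
- by rewrite -[_ @^-1` _]setTI; exact: fA.
- by rewrite -[_ @^-1` _]setTI; exact: gB.
Qed.

Lemma L1M_depends A B f g : [disjoint A & B]%B -> depends_on A f -> depends_on B g ->
  L1 P f -> L1 P g -> L1 P (fun w => f w * g w).
Proof.
move=> AB fA gB; apply: L1M_indep; [exact: depends_on_measurable fA|
  exact: depends_on_measurable gB|exact: depends_on_indep AB fA gB].
Qed.

Lemma meanM_depends A B f g : [disjoint A & B]%B ->
  depends_on A f -> depends_on B g -> L1 P f -> L1 P g ->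
  mean P (fun w => f w * g w) = mean P f * mean P g.
Proof.
move=> AB fA gB; apply: meanM_indep; [exact: depends_on_measurable fA|
  exact: depends_on_measurable gB|exact: depends_on_indep AB fA gB].
Qed.

Lemma L2M_depends A B f g : [disjoint A & B]%B -> depends_on A f -> depends_on B g ->
  L2 P f -> L2 P g -> L2 P (fun w => f w * g w).
Proof.
move=> AB fA gB [mf f2] [mg g2]; split; first exact: measurable_funM.
under eq_fun do rewrite exprMn.
by apply: (L1M_depends AB) => //; exact: depends_onX.
Qed.

End independent_family.

(** * The standard normal law: density and moments *)

Section normal.
Context (R : realType).
Local Notation mu := (@lebesgue_measure R).
Local Notation N := (normal_prob (0 : R) 1).
Local Notation phi := (normal_pdf (0 : R) 1).

(** The change of variables is available for the Radon-Nikodym derivative, which equals the density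
    almost everywhere because both have the same integral over every measurable set. *)
Lemma ge0_integral_normal_prob (m s : R) (f : R -> \bar R) :
  measurable_fun [set: R] f -> (forall x, 0 <= f x)%E ->
  (\int[normal_prob m s]_x f x = \int[mu]_x (f x * (normal_pdf m s x)%:E))%E.
Proof.
move=> mf f0.
have Nmu := @normal_prob_dominates R m s.
rewrite -(Radon_Nikodym_SigmaFinite.change_of_variables Nmu f0)//.
have mpdf : measurable_fun [set: R] (EFin \o normal_pdf m s).
  by apply/measurable_EFinP; exact: measurable_normal_pdf.
have fint := Radon_Nikodym_SigmaFinite.f_integrable Nmu.
apply: ae_eq_integral => //.
- by apply: emeasurable_funM => //; exact: measurable_int fint.
- exact: emeasurable_funM.
- apply: ae_eqe_mul2l; apply: integral_ae_eq => // A _ mA.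
  by rewrite -Radon_Nikodym_SigmaFinite.f_integral.
Qed.

Lemma ge0_integral_affine (k e : R) (G : R -> R) : 0 < k -> continuous G ->
  (forall x, 0 <= G x) ->
  (\int[mu]_x (G x)%:E = \int[mu]_x (G ((x + e) * k) * k)%:E)%E.
Proof.
move=> k0 cG G0; pose F (x : R^o) : R^o := (x + e) * k.
have F'E : F^`()%classic = cst k.
  apply/funext => x; rewrite /F derive1E deriveM// deriveD// !derive_cst derive_id.
  by rewrite scaler0 addr0 add0r /GRing.scale /= mulr1.
rewrite (@increasing_ge0_integration_by_substitutionT _ F)//.
- by apply: eq_integral => x _; rewrite F'E.
- by move=> x y xy; rewrite /F ltr_pM2r// ltrD2r.
- by rewrite F'E => ?; exact: cvg_cst.
- by rewrite F'E; exact: is_cvg_cst.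
- by rewrite F'E; exact: is_cvg_cst.
- by apply/gt0_cvgMlNy => //; exact: cvg_addrr_Ny.
- by apply/gt0_cvgMly => //; exact: cvg_addrr.
Qed.

Lemma normal_pdf_shift (m x : R) :
  normal_pdf m 1 x = expR (m * x - m ^+ 2 / 2) * phi x.
Proof.
rewrite !normal_pdfE// mulrCA; congr (_ * _).
by rewrite /normal_fun -expRD; congr expR; rewrite expr1n; field.
Qed.

Lemma normal_pdf_scale (s x : R) : 0 < s ->
  normal_pdf 0 s x = s^-1 * expR ((1 - s ^- 2) / 2 * x ^+ 2) * phi x.
Proof.
move=> s0; rewrite !normal_pdfE ?gt_eqF//.
have -> : normal_peak s = s^-1 * normal_peak 1.
  rewrite /normal_peak -!mulrnAr sqrtrM ?sqr_ge0// sqrtr_sqr gtr0_norm//.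
  by rewrite expr1n mul1r invfM.
rewrite -[LHS]mulrA -[RHS]mulrA; congr (_ * _); rewrite mulrCA; congr (_ * _).
rewrite /normal_fun -expRD; congr expR; rewrite expr1n; field.
by rewrite gt_eqF.
Qed.

(** Tilting by the exponential of a square turns the standard density into [s] times that of N(0,
    s^2). The second and fourth Gaussian moments are extracted from this identity by means of 1 + x
    <= exp x. *)
Lemma integral_normal_expR_sqr (s : R) : 0 < s ->
  (\int[N]_x (expR ((1 - s ^- 2) / 2 * x ^+ 2))%:E = s%:E)%E.
Proof.
move=> s0; rewrite ge0_integral_normal_prob; last 2 first.
- apply/measurable_EFinP; apply: measurableT_comp => //.
  by apply: measurable_funM => //; exact: measurable_funX.
- by move=> x; rewrite lee_fin expR_ge0.
transitivity (\int[mu]_x (s%:E * (normal_pdf 0 s x)%:E))%E.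
  apply: eq_integral => x _; rewrite (normal_pdf_scale x s0) -!EFinM; congr EFin.
  by rewrite -[X in s * X]mulrA mulVKf// gt_eqF.
rewrite integralZl//; last exact: integrable_normal_pdf.
by rewrite integral_normal_pdf mule1.
Qed.

Lemma integral_normal_expR (m : R) :
  (\int[N]_x (expR (m * x))%:E = (expR (m ^+ 2 / 2))%:E)%E.
Proof.
rewrite ge0_integral_normal_prob; last 2 first.
- by apply/measurable_EFinP; apply: measurableT_comp => //; exact: measurable_funM.
- by move=> x; rewrite lee_fin expR_ge0.
transitivity (\int[mu]_x ((expR (m ^+ 2 / 2))%:E * (normal_pdf m 1 x)%:E))%E.
  apply: eq_integral => x _; rewrite (normal_pdf_shift m x) -!EFinM mulrA -expRD.
  by congr (expR _ * _)%:E; field.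
rewrite integralZl//; last exact: integrable_normal_pdf.
by rewrite integral_normal_pdf mule1.
Qed.

Lemma L1_normal_expR_sqr (s : R) : 0 < s ->
  L1 N (fun x => expR ((1 - s ^- 2) / 2 * x ^+ 2)).
Proof.
move=> s0; apply: L1_ge0 => [|x|]; last by rewrite integral_normal_expR_sqr// ltry.
- apply: measurableT_comp => //.
  by apply: measurable_funM => //; exact: measurable_funX.
- exact: expR_ge0.
Qed.

Lemma mean_normal_expR_sqr (s : R) : 0 < s ->
  mean N (fun x => expR ((1 - s ^- 2) / 2 * x ^+ 2)) = s.
Proof. by move=> s0; rewrite /mean /Rintegral integral_normal_expR_sqr. Qed.

Lemma L1_normal_expR (m : R) : L1 N (fun x => expR (m * x)).
Proof.
apply: L1_ge0 => [|x|]; last by rewrite integral_normal_expR// ltry.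
- by apply: measurableT_comp => //; exact: measurable_funM.
- exact: expR_ge0.
Qed.

Lemma L1_normal4 : L1 N (fun x => x ^+ 4).
Proof.
(* The tilting identity at s = 2: with y = 3 x^2 / 8 one has x^4 = 64 y^2 / 9, and (1 + y/2)^2 <=
   exp y gives y^2 <= 4 exp y. *)
apply: (@L1_le _ _ _ N (fun x => 256 / 9 * expR ((1 - 2 ^- 2) / 2 * x ^+ 2))).
- exact: measurable_funX.
- exact/L1Z/L1_normal_expR_sqr.
move=> x; rewrite ger0_norm ?exprn_even_ge0//.
set y := _ * x ^+ 2; have yE : x ^+ 2 = 8 / 3 * y by rewrite /y; field.
have y0 : 0 <= y by rewrite mulr_ge0 ?sqr_ge0//; lra.
rewrite [x ^+ 4](exprM x 2 2) yE.
have := expR_ge1Dx (y / 2); rewrite [in expR y](splitr y) expRD; nra.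
Qed.

Lemma L1_normal2 : L1 N (fun x => x ^+ 2).
Proof.
apply: (@L1_le _ _ _ N (fun x => 1 + x ^+ 4)); first exact: measurable_funX.
  by apply: L1D; [exact: L1_cst|exact: L1_normal4].
by move=> x; rewrite ger0_norm ?sqr_ge0//; have := sqr_ge0 (x ^+ 2 - 1); nra.
Qed.

Lemma L1_normal1 : L1 N (fun x => x).
Proof. by apply: L2_L1; split => //; exact: L1_normal2. Qed.

(** From 1 + t x <= exp (t x) one gets t E X <= exp (t^2 / 2) - 1 <= t^2 for |t| <= 1; small [t] of
    both signs force the mean to vanish. *)
Lemma mean_normal1 : mean N (fun x => x) = 0.
Proof.
have ineq (t : R) : `|t| <= 1 -> t * mean N (fun x => x) <= t ^+ 2.
  move=> t1.
  have : mean N (fun x => 1 + t * x) <= mean N (fun x => expR (t * x)).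
    apply: le_mean => [||x]; last exact: expR_ge1Dx.
      by apply: L1D; [exact: L1_cst|exact/L1Z/L1_normal1].
    exact: L1_normal_expR.
  rewrite meanD; [|exact: L1_cst|exact/L1Z/L1_normal1].
  rewrite meanZ ?mean_cst; last exact: L1_normal1.
  rewrite {2}/mean /Rintegral integral_normal_expR /= => le1.
  have := expR_ge1Dx (- (t ^+ 2 / 2)); have := expRxMexpNx_1 (t ^+ 2 / 2).
  have : t ^+ 2 <= 1 by rewrite -[leLHS]real_normK ?num_real// expr_le1.
  have := expR_gt0 (t ^+ 2 / 2); have := expR_gt0 (- (t ^+ 2 / 2)).
  have := sqr_ge0 t.
  set e := expR (t ^+ 2 / 2) in le1 *; set e' := expR (- _).
  set u := t ^+ 2 => *.
  suff : e <= 1 + u by lra.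
  nra.
apply/eqP; rewrite -normr_eq0 eq_le normr_ge0 andbT; apply/ler_addgt0Pr => e e0.
rewrite add0r; pose t := Num.min e 1.
have t0 : 0 < t by rewrite lt_min e0/=.
have t1 : `|t| <= 1 by rewrite gtr0_norm// ge_min lexx orbT.
apply: (@le_trans _ _ t); last by rewrite ge_min lexx.
have := ineq t t1; have := ineq (- t); rewrite normrN => /(_ t1) *.
by rewrite ler_norml; apply/andP; split; rewrite -(ler_pM2l t0); nra.
Qed.

(** Applying 1 + x <= exp x to the tilting identity gives E X^2 <= 2 s^2 / (s + 1) for s > 1 and the
    reverse for s < 1; both bounds tend to 1 with [s]. *)
Lemma mean_normal2 : mean N (fun x => x ^+ 2) = 1.
Proof.
set m2 := mean _ _.
have ineq (s : R) : 0 < s -> s ^+ 2 + m2 / 2 * (s ^+ 2 - 1) <= s ^+ 3.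
  move=> s0.
  have : mean N (fun x => 1 + (1 - s ^- 2) / 2 * x ^+ 2) <= s.
    rewrite -[leRHS]mean_normal_expR_sqr//.
    apply: le_mean => [||x]; last exact: expR_ge1Dx.
      by apply: L1D; [exact: L1_cst|exact/L1Z/L1_normal2].
    exact: L1_normal_expR_sqr.
  rewrite meanD; [|exact: L1_cst|exact/L1Z/L1_normal2].
  rewrite meanZ ?mean_cst; last exact: L1_normal2.
  rewrite -/m2 -(@ler_pM2l _ (s ^+ 2)) ?exprn_gt0// => h.
  suff -> : s ^+ 2 + m2 / 2 * (s ^+ 2 - 1) =
      s ^+ 2 * (1 + (1 - s ^- 2) / 2 * m2) by rewrite (le_trans h)// -exprSr.
  by field; rewrite gt_eqF.
apply/eqP; rewrite eq_le; apply/andP; split; apply/ler_addgt0Pr => e e0.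
  rewrite leNgt; apply/negP => h.
  have := mulr_gt0 (mulr_gt0 e0 (ltac:(lra) : 0 < 4 + e)) (ltac:(lra) : 0 < m2 - (1 + e)).
  by have := ineq (1 + e / 2) ltac:(lra); have := mulr_gt0 e0 e0; nra.
have [e1|e1] := leP 1 e.
  have := ineq (1 / 2) ltac:(lra).
  have : 0 <= m2 by apply: mean_ge0 => x; exact: sqr_ge0.
  nra.
rewrite leNgt; apply/negP => h.
have := mulr_gt0 (mulr_gt0 e0 (ltac:(lra) : 0 < 4 - e)) (ltac:(lra) : 0 < 1 - (m2 + e)).
by have := ineq (1 - e / 2) ltac:(lra); have := mulr_gt0 e0 e0; nra.
Qed.

End normal.

(** * Convolution of centred normal laws *)

Section normal_convolution.
Context (R : realType).
Local Notation mu := (@lebesgue_measure R).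
Local Notation N := (normal_prob (0 : R) 1).
Local Notation phi := (normal_pdf (0 : R) 1).

(** Rotation invariance of a standard Gaussian pair (z, w): if c y = a z + b w, then z^2 + w^2 = c^2
    (y^2 + w^2) / a^2 - 2 b c y w / a^2, which is symmetric in [y] and [w]. *)
Lemma normal_pdf_rotation (a b c w y : R) : 0 < a -> 0 < c ->
  c ^+ 2 = a ^+ 2 + b ^+ 2 ->
  phi ((y - b * w / c) * (c / a)) * phi w = phi y * phi ((w - b * y / c) * (c / a)).
Proof.
move=> a0 c0 cE; rewrite !normal_pdfE//.
suff E : normal_fun 0 1 ((y - b * w / c) * (c / a)) * normal_fun 0 1 w =
    normal_fun 0 1 y * normal_fun 0 1 ((w - b * y / c) * (c / a)).
  by rewrite mulrACA E [RHS]mulrACA.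
rewrite /normal_fun -!expRD; congr expR; rewrite !subr0 expr1n.
have uE (u v : R) : (u - b * v / c) * (c / a) = (c * u - b * v) * a^-1.
  by field; rewrite !gt_eqF.
have sqE (t : R) : t ^+ 2 = t ^+ 2 * (c ^+ 2 - b ^+ 2) * a^-1 ^+ 2.
  by rewrite cE addrK exprVn mulfK// expf_neq0// gt_eqF.
by rewrite !uE (sqE w) (sqE y); ring.
Qed.

(** For fixed [w] substitute c y = a z + b w, exchange the integrals and rotate: what remains in [w]
    is a Gaussian density of total mass 1. *)
Lemma integral_normal_convolution (a b c : R) (h : R -> R) :
  0 < a -> 0 < c -> c ^+ 2 = a ^+ 2 + b ^+ 2 ->
  continuous h -> (forall x, 0 <= h x) ->
  (\int[N]_w \int[N]_z (h (a * z + b * w))%:E = \int[N]_y (h (c * y))%:E)%E.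
Proof.
move=> a0 c0 cE ch h0.
have mh : measurable_fun [set: R] h by exact: continuous_measurable_fun.
have mphi : measurable_fun [set: R] phi by exact: measurable_normal_pdf.
have cphi : continuous phi by exact: continuous_normal_pdf.
have k0 : 0 < c / a by rewrite divr_gt0.
have k0' := ltW k0.
have phi0 x : 0 <= phi x by exact: normal_pdf_ge0.
have inner w : (\int[N]_z (h (a * z + b * w))%:E =
    \int[mu]_y (h (c * y) * phi ((y - b * w / c) * (c / a)) * (c / a))%:E)%E.
  rewrite ge0_integral_normal_prob; last 2 first.
  - apply/measurable_EFinP; apply: measurableT_comp => //.
    by apply: measurable_funD => //; exact: measurable_funM.
  - by move=> x; rewrite lee_fin.
  rewrite (@ge0_integral_affine _ (c / a) (- (b * w / c))
    (fun z => h (a * z + b * w) * phi z))//; last 2 first.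
  - move=> x; apply: cvgM; last exact: cphi.
    apply: continuous_comp; last exact: ch.
    by apply: cvgD; [apply: cvgM; [exact: cvg_cst|exact: cvg_id]|exact: cvg_cst].
  - by move=> x; rewrite mulr_ge0.
  apply: eq_integral => y _; congr (_ * _ * _)%:E; congr h.
  by field; rewrite !gt_eqF.
have mint : measurable_fun [set: R * R] (fun z : R * R =>
    (h (c * z.2) * (phi ((z.2 - b * z.1 / c) * (c / a)) * phi z.1) * (c / a))%:E).
  apply/measurable_EFinP; apply: measurable_funM => //; apply: measurable_funM.
    by apply: measurableT_comp => //; exact: measurable_funM.
  apply: measurable_funM; last exact: measurableT_comp.
  apply: measurableT_comp => //; apply: measurable_funM => //.
  apply: measurable_funB => //; apply: measurable_funM => //.
  exact: measurable_funM.
transitivity (\int[mu]_w \int[mu]_y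
   (h (c * y) * (phi ((y - b * w / c) * (c / a)) * phi w) * (c / a))%:E)%E.
  rewrite ge0_integral_normal_prob; last 2 first.
  - apply: (@measurable_fun_fubini_tonelli_F _ _ _ _ _ N
      (fun z : R * R => (h (a * z.2 + b * z.1))%:E)) => //.
    + apply/measurable_EFinP; apply: measurableT_comp => //.
      by apply: measurable_funD => //; exact: measurable_funM.
    + by move=> z; rewrite lee_fin.
  - by move=> x; apply: integral_ge0 => z _; rewrite lee_fin.
  apply: eq_integral => w _; rewrite inner -ge0_integralZr//; last 3 first.
  - apply/measurable_EFinP; apply: measurable_funM => //; apply: measurable_funM.
      by apply: measurableT_comp => //; exact: measurable_funM.
    apply: measurableT_comp => //; apply: measurable_funM => //.
    exact: measurable_funB.
  - by move=> y _; rewrite lee_fin (mulr_ge0 _ k0')// mulr_ge0.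
  - by rewrite lee_fin.
  by apply: eq_integral => y _; rewrite -EFinM; congr EFin; ring.
rewrite (@fubini_tonelli _ _ _ _ _ mu mu _ mint)/=; last first.
  by move=> z; rewrite lee_fin (mulr_ge0 _ k0')// mulr_ge0// mulr_ge0.
rewrite [RHS]ge0_integral_normal_prob; last 2 first.
- by apply/measurable_EFinP; apply: measurableT_comp => //; exact: measurable_funM.
- by move=> x; rewrite lee_fin.
apply: eq_integral => y _.
transitivity (\int[mu]_w ((h (c * y) * phi y)%:E *
    (phi ((w - b * y / c) * (c / a)) * (c / a))%:E))%E.
  apply: eq_integral => w _; rewrite -EFinM normal_pdf_rotation//.
  by congr EFin; ring.
rewrite ge0_integralZl//; last 3 first.
- apply/measurable_EFinP; apply: measurable_funM => //.
  apply: measurableT_comp => //; apply: measurable_funM => //.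
  exact: measurable_funB.
- by move=> w _; rewrite lee_fin (mulr_ge0 _ k0').
- by rewrite lee_fin mulr_ge0.
rewrite -(@ge0_integral_affine _ (c / a) (- (b * y / c)) phi)//.
by rewrite integral_normal_pdf mule1.
Qed.

(** The value a = 0 is included because after the last replacement no Gaussian is left to average
    over; then c = b. *)
Lemma mean_normal_convolution (a b c M : R) (h : R -> R) :
  0 <= a -> 0 < b -> 0 < c -> c ^+ 2 = a ^+ 2 + b ^+ 2 ->
  continuous h -> (forall x, 0 <= h x <= M) ->
  mean N (fun w => mean N (fun z => h (b * w + a * z))) =
  mean N (fun y => h (c * y)).
Proof.
rewrite le_eqVlt => /predU1P[<- b0 c0 cE ch hM|a0 b0 c0 cE ch hM].
  have -> : c = b by apply/eqP; rewrite -(@eqrXn2 _ 2) ?ltW// cE expr0n add0r.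
  by apply: eq_mean => w; under eq_mean do rewrite mul0r addr0; rewrite mean_cst.
have h0 x : 0 <= h x by have /andP[] := hM x.
have mh : measurable_fun [set: R] h by exact: continuous_measurable_fun.
have ih w : L1 N (fun z => h (b * w + a * z)).
  apply: (@L1_bounded _ _ _ N _ M).
    apply: measurableT_comp => //.
    by apply: measurable_funD => //; exact: measurable_funM.
  by move=> z; rewrite ger0_norm//; have /andP[] := hM (b * w + a * z).
congr fine; rewrite -(@integral_normal_convolution a b c)//.
apply: eq_integral => w _; rewrite mean_EFin//.
by apply: eq_integral => z _; rewrite addrC.
Qed.

End normal_convolution.

(** * The normal distribution function and its quantiles *)

Section normal_quantile.
Context (R : realType).
Local Notation mu := (@lebesgue_measure R).
Local Notation N := (normal_prob (0 : R) 1).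

Let idRV : {RV N >-> R} := 
  @mfun_Sub _ _ (measurableTypeR R) R id (mem_set (@measurable_id _ R setT)).

Definition normal_cdf (x : R) : R := fine (N `]-oo, x]).

Lemma normal_cdfE x : N `]-oo, x] = (normal_cdf x)%:E.
Proof. by rewrite fineK// fin_num_measure. Qed.

(** The density is at most its peak. This gives both the continuity behind the quantile and the
    anti-concentration that pays for smoothing the indicator. *)
Lemma normal_cdf_lipschitz (x y : R) : x <= y ->
  normal_cdf x <= normal_cdf y <= normal_cdf x + normal_peak 1 * (y - x).
Proof.
move=> xy; have xyE : `]-oo, y]%classic = `]-oo, x] `|` `]x, y]%classic :> set R.
  by rewrite -itv_bndbnd_setU// bnd_simp.
have yE : N `]-oo, y] = (N `]-oo, x] + N `]x, y]%classic)%E.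
  rewrite xyE measureU//; apply/seteqP; split => // z /=; rewrite !in_itv/=.
  by move=> [zx] /andP[xz _]; move: (lt_le_trans xz zx); rewrite ltxx.
have ub : (N `]x, y]%classic <= (normal_peak 1 * (y - x))%:E)%E.
  rewrite /normal_prob.
  apply: (@le_trans _ _ (\int[mu]_(z in `]x, y]) (normal_peak (1 : R))%:E)%E).
    apply: ge0_le_integral => //=.
    - by move=> z _; rewrite lee_fin normal_pdf_ge0.
    - by apply/measurable_EFinP/measurable_funTS; exact: measurable_normal_pdf.
    - by move=> z _; rewrite lee_fin normal_pdf_ub.
  rewrite integral_cst//= lebesgue_measure_itv/= lte_fin.
  by case: ifPn => [_|]; rewrite ?mule0 ?lee_fin ?mulr_ge0 ?subr_ge0 ?normal_peak_ge0// -EFinD.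
move: yE; rewrite !normal_cdfE => yE.
have nn : (0 <= N `]x, y]%classic)%E by exact: measure_ge0.
move: yE ub nn; case: (N `]x, y]%classic) => // r [->].
by rewrite !lee_fin lerD2l lerDl => -> ->.
Qed.

Lemma normal_cdf_near1 (q : R) : q < 1 -> exists x, q <= normal_cdf x.
Proof.
move=> q1; have /fine_cvgP[_ /cvgrPdist_lt/(_ (1 - q))] := cvg_cdfy1 idRV.
rewrite subr_gt0 => /(_ q1) [M [_ HM]].
exists (M + 1); have := HM (M + 1); rewrite ltrDl ltr01 => /(_ isT) /=.
rewrite /cdf /distribution /pushforward /= preimage_id -/(normal_cdf _).
by rewrite ltr_norml => /andP[_ ?]; lra.
Qed.

Lemma normal_cdf_near0 (q : R) : 0 < q -> exists x, normal_cdf x < q.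
Proof.
move=> q0; have /fine_cvgP[_ /cvgrPdist_lt/(_ q q0)] := cvg_cdfNy0 idRV.
move=> [M [_ HM]]; exists (M - 1); have := HM (M - 1).
rewrite gtrDl ltrN10 => /(_ isT) /=.
rewrite /cdf /distribution /pushforward /= preimage_id -/(normal_cdf _).
by rewrite ltr_norml => /andP[? _]; lra.
Qed.

(** The distribution function has no jump: just left of the infimum it is below [q], points of the
    set just right of it have value at least [q], and the Lipschitz bound closes the gap. *)
Lemma normal_cdf_quantile (q : R) : 0 < q -> q < 1 ->
  normal_cdf (gauss_quantile q) = q.
Proof.
move=> q0 q1; rewrite /gauss_quantile; set S := [set x | _].
have SE x : S x = (q <= normal_cdf x) by rewrite /S /= normal_cdfE lee_fin.
have [x0 x0q] := normal_cdf_near1 q1.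
have [x1 x1q] := normal_cdf_near0 q0.
have S0 : S !=set0 by exists x0; rewrite SE.
have lbS : has_inf S.
  split => //; exists x1 => x; rewrite SE => qx.
  rewrite leNgt; apply/negP => xx1.
  have /andP[+ _] := normal_cdf_lipschitz (ltW xx1).
  by move=> /(le_trans qx); rewrite leNgt x1q.
set u := inf S; set c := normal_peak (1 : R).
have c0 : 0 < c by apply: normal_peak_gt0; exact: oner_neq0.
apply/eqP; rewrite eq_le; apply/andP; split; apply/ler_addgt0Pr => e e0.
  have d0 : 0 < e / c by rewrite divr_gt0.
  have : ~ S (u - e / c).
    by move=> /(ge_inf lbS.2); rewrite -/u lerBrDr gerDl leNgt d0.
  rewrite SE => /negP; rewrite -ltNge => uq.
  have uec : u - e / c <= u by rewrite gerBl ltW.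
  have /andP[_ /le_trans -> //] := normal_cdf_lipschitz uec.
  by rewrite subKr -/c (mulrC c) divfK ?gt_eqF// lerD2r ltW.
have d0 : 0 < e / c by rewrite divr_gt0.
have [x Sx xu] := inf_adherent d0 lbS; move: Sx; rewrite SE => qx.
have ux : u <= x by apply: ge_inf lbS.2 _ _; rewrite SE.
have /andP[_ h] := normal_cdf_lipschitz ux.
rewrite (le_trans qx)// (le_trans h)// lerD2l -/c.
rewrite -[leRHS](divfK (lt0r_neq0 c0)) mulrC ler_pM2r// lerBlDl; exact: ltW.
Qed.

Lemma normal_prob_gtE (x : R) : N `]x, +oo[%classic = (1 - normal_cdf x)%:E.
Proof.
by rewrite EFinB -normal_cdfE -setCitvl probability_setC.
Qed.

End normal_quantile.

(** * A smooth step function with explicit Taylor remainder *)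

Section smooth_step.
Context (R : realType).
Implicit Types x y : R.

Definition pospart x : R := Num.max x 0.

Lemma pospartP x : (0 <= x /\ pospart x = x) \/ (x <= 0 /\ pospart x = 0).
Proof. by rewrite /pospart; case: (lerP x 0) => hx; [right|left; split => //; exact: ltW]. Qed.

Lemma continuous_pospart : continuous pospart.
Proof. by move=> x; apply: continuous_max; [exact: cvg_id|exact: cvg_cst]. Qed.

(* The coefficients 1, -3, 3, -1 make the third difference of the truncated
   cubes constant to the right of 3. *)
Definition third_diff (f : R -> R) x : R :=
  f x - 3 * f (x - 1) + 3 * f (x - 2) - f (x - 3).

(** The distribution function of a sum of three independent uniform variables on [0, 1]; [step1] is
    its density and [step2] the derivative of that density. The second derivative is Lipschitz,
    which is what a cubic Taylor remainder requires. *)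
Definition step x : R := third_diff (fun y => pospart y ^+ 3) x / 6.
Definition step1 x : R := third_diff (fun y => pospart y ^+ 2) x / 2.
Definition step2 x : R := third_diff pospart x.

(** The cube of the positive part has second derivative 6 x_+, which is 6-Lipschitz, so the
    remainder is at most 6 |y|^3 / 6. *)
Lemma pospart_cube_taylor x y :
  `|pospart (x + y) ^+ 3 - pospart x ^+ 3 - 3 * pospart x ^+ 2 * y
    - 3 * pospart x * y ^+ 2| <= `|y| ^+ 3.
Proof.
have [[xy ->]|[xy ->]] := pospartP (x + y); have [[x0 ->]|[x0 ->]] := pospartP x.
- rewrite [X in `|X| <= _](_ : _ = y ^+ 3); last by ring.
  by rewrite normrX.
- have y0 : 0 <= y by lra.
  rewrite (ger0_norm y0) [X in `|X| <= _](_ : _ = (x + y) ^+ 3); last by ring.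
  rewrite ger0_norm ?exprn_ge0// lerXn2r// ?nnegrE//; lra.
- have y0 : y <= 0 by lra.
  rewrite (ler0_norm y0) [X in `|X| <= _](_ : _ = (- (x + y)) ^+ 3 - (- y) ^+ 3); last by ring.
  have le3 : (- (x + y)) ^+ 3 <= (- y) ^+ 3 by rewrite lerXn2r ?nnegrE//; lra.
  rewrite distrC ger0_norm ?subr_ge0// gerBl exprn_ge0//; lra.
- by rewrite !expr0n /= !(mulr0, mul0r, subr0) normr0 exprn_ge0.
Qed.

(** The constant is (1 + 3 + 3 + 1) / 6: the weights of the third difference over the
    normalisation. *)
Lemma step_taylor x y :
  `|step (x + y) - step x - step1 x * y - step2 x * y ^+ 2 / 2| <= 4 / 3 * `|y| ^+ 3.
Proof.
have h0 := pospart_cube_taylor x y.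
have h1 := pospart_cube_taylor (x - 1) y.
have h2 := pospart_cube_taylor (x - 2) y.
have h3 := pospart_cube_taylor (x - 3) y.
rewrite /step /step1 /step2 /third_diff.
rewrite (_ : x + y - 1 = x - 1 + y); last by ring.
rewrite (_ : x + y - 2 = x - 2 + y); last by ring.
rewrite (_ : x + y - 3 = x - 3 + y); last by ring.
move: h0 h1 h2 h3; rewrite !ler_norml => /andP[? ?] /andP[? ?] /andP[? ?] /andP[? ?].
by apply/andP; split; lra.
Qed.

Lemma step_bounds x : [/\ 0 <= step x <= 1, `|step1 x| <= 1 & `|step2 x| <= 1].
Proof.
rewrite /step /step1 /step2 /third_diff !ler_norml.
(* Polynomial inequalities on [0, 1] that reduce each nonconstant piece to linear arithmetic; [t] is
   a local coordinate on the piece. *)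
have unit (t : R) : 0 <= t -> t <= 1 -> [/\ 0 <= t ^+ 2, t ^+ 2 <= t,
    0 <= t ^+ 3, t ^+ 3 <= t ^+ 2 & 0 <= t ^+ 3 - 3 * t + 2 /\ 0 <= (1 - 2 * t) ^+ 2].
  move=> t0 t1; have t2 : t ^+ 2 <= t by rewrite expr2 ler_piMr.
  split; [exact: sqr_ge0|exact: t2|exact: exprn_ge0| |].
    by rewrite (exprS t 2) ler_piMl ?sqr_ge0.
  split; last exact: sqr_ge0.
  rewrite (_ : _ + _ = (1 - t) ^+ 2 * (t + 2)); last by ring.
  by rewrite mulr_ge0 ?sqr_ge0//; lra.
(* Of the sixteen sign patterns, those of the intervals [2, 3], [1, 2] and [0, 1], in this order,
   are left by the linear solver. *)
have [[? ->]|[? ->]] := pospartP x; have [[? ->]|[? ->]] := pospartP (x - 1);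
have [[? ->]|[? ->]] := pospartP (x - 2); have [[? ->]|[? ->]] := pospartP (x - 3);
  try (by split; apply/andP; split; lra).
- have [] := unit (3 - x) ltac:(lra) ltac:(lra) => ? ? ? ? [? ?].
  by split; apply/andP; split; lra.
- have [] := unit (x - 1) ltac:(lra) ltac:(lra) => ? ? ? ? [? ?].
  by split; apply/andP; split; lra.
- have [] := unit x ltac:(lra) ltac:(lra) => ? ? ? ? [? ?].
  by split; apply/andP; split; lra.
Qed.

Lemma step_le0 x : x <= 0 -> step x = 0.
Proof.
move=> x0; rewrite /step /third_diff.
have -> : pospart x = 0 by rewrite /pospart max_r.
have -> : pospart (x - 1) = 0 by rewrite /pospart max_r//; lra.
have -> : pospart (x - 2) = 0 by rewrite /pospart max_r//; lra.
have -> : pospart (x - 3) = 0 by rewrite /pospart max_r//; lra.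
by field.
Qed.

Lemma step_ge3 x : 3 <= x -> step x = 1.
Proof.
move=> x3; rewrite /step /third_diff.
have -> : pospart x = x by rewrite /pospart max_l//; lra.
have -> : pospart (x - 1) = x - 1 by rewrite /pospart max_l//; lra.
have -> : pospart (x - 2) = x - 2 by rewrite /pospart max_l//; lra.
have -> : pospart (x - 3) = x - 3 by rewrite /pospart max_l//; lra.
by field.
Qed.

Lemma continuous_step : continuous step.
Proof.
have c k : continuous (fun x : R => pospart (x - k) ^+ 3).
  move=> x; apply: (@continuous_comp _ _ _ (fun z => pospart (z - k)) (fun z => z ^+ 3));
    last exact: exprn_continuous.
  apply: (@continuous_comp _ _ _ (fun z => z - k) pospart);
    last exact: continuous_pospart.
  by apply: cvgB; [exact: cvg_id|exact: cvg_cst].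
have c0 : continuous (fun x : R => pospart x ^+ 3).
  by move=> x; have := c 0 x; rewrite /continuous_at subr0;
    under [X in X @ _ --> _]eq_fun do rewrite subr0.
move=> x; apply: cvgM; last exact: cvg_cst.
apply: cvgB; last exact: c; apply: cvgD; last first.
  by apply: cvgM; [exact: cvg_cst|exact: c].
by apply: cvgB; [exact: c0|apply: cvgM; [exact: cvg_cst|exact: c]].
Qed.

Lemma measurable_pospart : measurable_fun [set: R] pospart.
Proof. by apply: continuous_measurable_fun; exact: continuous_pospart. Qed.

Lemma measurable_third_diff f : measurable_fun [set: R] f ->
  measurable_fun [set: R] (third_diff f).
Proof.
move=> mf; have mfB (k : R) : measurable_fun [set: R] (fun x => f (x - k)).
  by apply: measurableT_comp => //; exact: measurable_funB.
apply: measurable_funB => //; apply: measurable_funD.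
  by apply: measurable_funB => //; exact: measurable_funM.
exact: measurable_funM.
Qed.

Lemma measurable_step1 : measurable_fun [set: R] step1.
Proof.
apply: measurable_funM => //; apply: measurable_third_diff.
by apply: measurable_funX; exact: measurable_pospart.
Qed.

Lemma measurable_step2 : measurable_fun [set: R] step2.
Proof. by apply: measurable_third_diff; exact: measurable_pospart. Qed.

End smooth_step.

(** * Second-order expansions that are stable under Gaussian averaging *)

Section taylor_class.
Context (R : realType).
Local Notation N := (normal_prob (0 : R) 1).
Implicit Types (u : R -> R).

Definition bounded_by (M : R) u :=
  measurable_fun [set: R] u /\ forall x, `|u x| <= M.

(** Derivatives are replaced by functions that act as Taylor coefficients. The inequality can then
    be averaged directly, and no derivative is exchanged with an integral. *)
Definition taylor2 (K M : R) u u1 u2 :=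
  [/\ bounded_by M u, bounded_by M u1, bounded_by M u2 &
   forall x y, `|u (x + y) - u x - u1 x * y - u2 x * y ^+ 2 / 2| <= K * `|y| ^+ 3].

Definition normal_smooth (a : R) u (x : R) : R := mean N (fun z => u (x + a * z)).

Lemma L1_normal_smooth (M a x : R) u : bounded_by M u ->
  L1 N (fun z => u (x + a * z)).
Proof.
move=> [mu uM]; apply: (@L1_bounded _ _ _ N _ M) => //.
by apply: measurableT_comp => //; apply: measurable_funD.
Qed.

Lemma bounded_by_smooth (M a : R) u : bounded_by M u ->
  bounded_by M (normal_smooth a u).
Proof.
move=> uM; split=> [|x]; last first.
  rewrite -(mean_cst N M); apply: le_norm_mean => [||z].
  - exact: L1_normal_smooth uM.
  - exact: L1_cst.
  - by case: uM.
(* Adding [M] makes the integrand nonnegative, so Tonelli yields measurability of the average. *)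
have M0 x : 0 <= u x + M.
  by case: uM => _ /(_ x); rewrite ler_norml => /andP[]; lra.
have mf : measurable_fun [set: R * R]
    (fun z : R * R => (u (z.1 + a * z.2) + M)%:E).
  apply/measurable_EFinP/measurable_funD => //; apply: measurableT_comp.
    by case: uM.
  by apply: measurable_funD => //; exact: measurable_funM.
have mF := @measurable_fun_fubini_tonelli_F _ _ _ _ _ N
  (fun z : R * R => (u (z.1 + a * z.2) + M)%:E) mf (fun z => M0 _).
have -> : normal_smooth a u =
    fun x => fine (\int[N]_z (u (x + a * z) + M)%:E) - M.
  apply/funext => x; rewrite -[fine _]/(mean N (fun z => u (x + a * z) + M)).
  rewrite meanD; [|exact: L1_normal_smooth uM|exact: L1_cst].
  by rewrite mean_cst addrK.
by apply: measurable_funB => //; exact: (measurableT_comp (fine_measurable measurableT) mF).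
Qed.

(** The remainder bound is uniform in the base point, so it survives averaging over a Gaussian
    shift. *)
Lemma taylor2_smooth (K M a : R) u u1 u2 : taylor2 K M u u1 u2 ->
  taylor2 K M (normal_smooth a u) (normal_smooth a u1) (normal_smooth a u2).
Proof.
move=> [uM u1M u2M uK]; split; [exact: bounded_by_smooth..|move=> x y].
have i0 z := L1_normal_smooth a z uM.
have i1 := L1_normal_smooth a x u1M.
have i2 := L1_normal_smooth a x u2M.
have iy1 : L1 N (fun z => y * u1 (x + a * z)) by exact: L1Z.
have iy2 : L1 N (fun z => y ^+ 2 / 2 * u2 (x + a * z)) by exact: L1Z.
have i00 := L1B (i0 (x + y)) (i0 x); have i012 := L1B i00 iy1.
have -> : normal_smooth a u (x + y) - normal_smooth a u x
    - normal_smooth a u1 x * y - normal_smooth a u2 x * y ^+ 2 / 2 =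
  mean N (fun z => u (x + y + a * z) - u (x + a * z)
    - y * u1 (x + a * z) - (y ^+ 2 / 2) * u2 (x + a * z)).
  rewrite meanB// meanB// meanB// meanZ// meanZ//.
  by rewrite /normal_smooth; ring.
rewrite -(mean_cst N (K * _)); apply: le_norm_mean => [||z].
- exact: L1B i012 iy2.
- exact: L1_cst.
- have := uK (x + a * z) y; rewrite (addrAC x (a * z)) (mulrC y) [_ / 2 * _]mulrC.
  by rewrite [X in _ -> `|_ - X| <= _]mulrA.
Qed.

(** Half of a swap. It serves with [W] a summand of the statistic and, over the normal law with [S]
    constant, with [W] a Gaussian of the same scale; the last hypothesis is what conditional
    centring of [W] provides. *)
Lemma taylor2_mean d (T : measurableType d) (P : probability T R)
  (K M : R) u u1 u2 (S W : T -> R) :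
  taylor2 K M u u1 u2 -> measurable_fun [set: T] S -> measurable_fun [set: T] W ->
  L1 P (fun w => W w ^+ 2) -> L1 P (fun w => `|W w| ^+ 3) ->
  mean P (fun w => u1 (S w) * W w) = 0 ->
  `|mean P (fun w => u (S w + W w)) - mean P (fun w => u (S w))
    - mean P (fun w => u2 (S w) * W w ^+ 2) / 2| <=
  K * mean P (fun w => `|W w| ^+ 3).
Proof.
move=> [[mu uM] [mu1 u1M] [mu2 u2M] uK] mS mW W2 W3 orth.
have iW : L1 P W by apply: L2_L1.
have i0 : L1 P (fun w => u (S w + W w)).
  apply: (@L1_bounded _ _ _ P _ M) => //; apply: measurableT_comp => //.
  exact: measurable_funD.
have i0' : L1 P (fun w => u (S w)).
  by apply: (@L1_bounded _ _ _ P _ M) => //; exact: measurableT_comp.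
have i1 : L1 P (fun w => u1 (S w) * W w).
  by apply: (@L1_boundedM _ _ _ P _ _ M) => //; exact: measurableT_comp.
have i2 : L1 P (fun w => u2 (S w) * W w ^+ 2).
  by apply: (@L1_boundedM _ _ _ P _ _ M) => //; exact: measurableT_comp.
have i2' : L1 P (fun w => 2^-1 * (u2 (S w) * W w ^+ 2)) by exact: L1Z.
have i00 := L1B i0 i0'; have i01 := L1B i00 i1.
rewrite -meanZ//.
have -> : mean P (fun w => u (S w + W w)) - mean P (fun w => u (S w))
    - mean P (fun w => u2 (S w) * W w ^+ 2) / 2 =
  mean P (fun w => u (S w + W w) - u (S w) - u1 (S w) * W w
    - 2^-1 * (u2 (S w) * W w ^+ 2)).
  by rewrite meanB// meanB// meanB// orth meanZ//; ring.
apply: le_norm_mean => [||w].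
- exact: L1B i01 i2'.
- exact: L1Z.
- by rewrite [2^-1 * _]mulrC; exact: uK.
Qed.

End taylor_class.

Lemma swap_bound (R : realFieldType) (d1 d0 x1 x2 x3 r c1 c2 c3 : R) : 0 <= r ->
  `|d1 - x1 - r * x2 / 2| <= c1 -> `|d0 - x1 - r * x3 / 2| <= c2 ->
  `|x2 - x3| <= c3 -> `|d1 - d0| <= c1 + c2 + r * c3 / 2.
Proof.
move=> r0; rewrite !ler_norml => /andP[? ?] /andP[? ?] /andP[lo hi].
have := ler_wpM2l r0 lo; have := ler_wpM2l r0 hi => ? ?.
by apply/andP; split; lra.
Qed.

(** * Lindeberg's replacement argument *)

Section lindeberg.
Context d (T : measurableType d) (R : realType) (P : probability T R).
Local Notation N := (normal_prob (0 : R) 1).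
Variables (p : nat) (W : nat -> T -> R) (v : T -> R) (B eta K M : R).
Variables (h h1 h2 : R -> R).
Hypothesis p_gt0 : (0 < p)%N.

Definition partial_sum (m : nat) (w : T) : R := \sum_(j < m) W j w.

Hypothesis mW : forall j, (j < p)%N -> measurable_fun [set: T] (W j).
Hypothesis W2 : forall j, (j < p)%N -> L1 P (fun w => W j w ^+ 2).
Hypothesis W3 : forall j, (j < p)%N -> L1 P (fun w => `|W j w| ^+ 3).
Hypothesis W3_le : forall j, (j < p)%N ->
  mean P (fun w => `|W j w| ^+ 3) <= B * (Num.sqrt p%:R)^-1 ^+ 3.
Hypothesis W_centered : forall j g C, (j < p)%N -> bounded_by C g ->
  mean P (fun w => g (partial_sum j w) * W j w) = 0.
Hypothesis W_var : forall j g C, (j < p)%N -> bounded_by C g ->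
  mean P (fun w => g (partial_sum j w) * W j w ^+ 2) =
  p%:R^-1 * mean P (fun w => g (partial_sum j w) * v w).
Hypothesis v_L1 : L1 P v.
Hypothesis v_near1 : mean P (fun w => `|v w - 1|) <= eta.
Hypothesis h_cont : continuous h.
Hypothesis h01 : forall x, 0 <= h x <= M.
Hypothesis h_taylor : taylor2 K M h h1 h2.

Let rho : R := (Num.sqrt p%:R)^-1.
(** Standard deviation of the p - m Gaussians, each of variance 1/p, that stand for the summands not
    yet restored. *)
Let a m : R := rho * Num.sqrt (p - m)%:R.
Let G3 := mean N (fun z => `|z| ^+ 3).

Let p0 : 0 < p%:R :> R. Proof. by rewrite ltr0n. Qed.
Let rho0 : 0 < rho. Proof. by rewrite invr_gt0 sqrtr_gt0. Qed.
Let rho2 : rho ^+ 2 = p%:R^-1. Proof. by rewrite exprVn sqr_sqrtr. Qed.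
Let M0 : 0 <= M. Proof. by have /andP[/le_trans] := h01 0; apply. Qed.
Let K0 : 0 <= K.
Proof.
case: h_taylor => _ _ _ /(_ 0 1)/(le_trans (normr_ge0 _)).
by rewrite normr1 expr1n mulr1.
Qed.

Let mS m : (m <= p)%N -> measurable_fun [set: T] (partial_sum m).
Proof.
move=> mp; apply: measurable_sum => j; apply: mW.
exact: leq_trans (ltn_ord j) mp.
Qed.

Let L1_normal_cube : L1 N (fun z => `|z| ^+ 3).
Proof.
apply: (@L1_le _ _ _ N (fun z => z ^+ 2 + z ^+ 4)).
- by apply: measurable_funX; exact: normr_measurable.
- by apply: L1D; [exact: L1_normal2|exact: L1_normal4].
- move=> z; rewrite ger0_norm ?exprn_ge0// -(real_normK (num_real z)).
  rewrite [z ^+ 4](exprM z 2 2) -(real_normK (num_real z)).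
  by set t := `|z|; have := sqr_ge0 (t ^+ 2 - t); have := sqr_ge0 t; nra.
Qed.

(** One of the remaining Gaussians is split off, since a_m^2 = a_{m+1}^2 + 1/p. *)
Let smooth_step m x : (m < p)%N ->
  normal_smooth (a m) h x = mean N (fun z => normal_smooth (a m.+1) h (x + rho * z)).
Proof.
move=> mp.
have am0 k : 0 <= a k by rewrite mulr_ge0 ?sqrtr_ge0// ltW.
have a2 : a m ^+ 2 = a m.+1 ^+ 2 + rho ^+ 2.
  rewrite !exprMn !sqr_sqrtr ?ler0n// -{3}[rho ^+ 2]mulr1 -mulrDr.
  by rewrite -[X in _ + X](mulr1n 1) -natrD addn1 -subSn.
have am : 0 < a m by rewrite mulr_gt0// sqrtr_gt0 ltr0n subn_gt0.
rewrite /normal_smooth.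
have := @mean_normal_convolution R (a m.+1) rho (a m) M (fun y => h (x + y))
  (am0 _) rho0 am a2.
move=> <-; first by apply: eq_mean => z; apply: eq_mean => y; rewrite addrA.
  move=> y; apply: (@continuous_comp _ _ _ (fun y => x + y) h); last exact: h_cont.
  by apply: cvgD; [exact: cvg_cst|exact: cvg_id].
by move=> y; exact: h01.
Qed.

(** The hybrid expectation: the first [m] summands are genuine, the others Gaussian and already
    integrated out. *)
Let D m := mean P (fun w => normal_smooth (a m) h (partial_sum m w)).

(** Both hybrids are expanded around the same partial sum S_m with the same averaged function [u].
    The first-order terms vanish, and the second-order ones differ by rho^2 / 2 times the mean of
    u2(S_m) (v - 1). *)
Let D_step m : (m < p)%N ->
  `|D m.+1 - D m| <= K * (B + G3) * rho ^+ 3 + M * eta / 2 * rho ^+ 2.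
Proof.
move=> mp; set u := normal_smooth (a m.+1) h.
have tu := taylor2_smooth (a m.+1) h_taylor.
set u1 := normal_smooth (a m.+1) h1 in tu; set u2 := normal_smooth (a m.+1) h2 in tu.
rewrite -/u in tu.
have [uM u1M u2M _] := tu.
have mSm := mS (ltnW mp).
have i_comp f : bounded_by M f -> L1 P (fun w => f (partial_sum m w)).
  by move=> [mf fM]; apply: (@L1_bounded _ _ _ P _ M) => //; exact: measurableT_comp.
have stepW := taylor2_mean tu mSm (mW mp) (W2 mp) (W3 mp) (W_centered mp u1M).
rewrite (W_var mp u2M) in stepW.
have DS : mean P (fun w => u (partial_sum m w + W m w)) = D m.+1.
  by apply: eq_mean => w; rewrite /u /partial_sum big_ord_recr.
rewrite DS in stepW.
have stepG x : `|mean N (fun z => u (x + rho * z)) - u x - rho ^+ 2 * u2 x / 2|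
    <= K * (rho ^+ 3 * G3).
  have mrho : measurable_fun [set: R] (fun z => rho * z) by exact: measurable_funM.
  have cube z : `|rho * z| ^+ 3 = rho ^+ 3 * `|z| ^+ 3.
    by rewrite normrM exprMn (gtr0_norm rho0).
  have := @taylor2_mean R _ _ N K M u u1 u2 (fun=> x) (fun z => rho * z) tu
    (measurable_cst _) mrho.
  under [X in L1 _ X -> _]eq_fun do rewrite exprMn.
  under [X in _ -> L1 _ X -> _]eq_fun do rewrite cube.
  move=> /(_ (L1Z _ (L1_normal2 R)) (L1Z _ L1_normal_cube)).
  have -> : mean N (fun z => u1 x * (rho * z)) = 0.
    under eq_mean do rewrite mulrA.
    by rewrite (meanZ _ (L1_normal1 R)) mean_normal1 mulr0.
  move=> /(_ erefl); rewrite mean_cst.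
  have -> : mean N (fun z => u2 x * (rho * z) ^+ 2) = rho ^+ 2 * u2 x.
    under eq_mean do rewrite exprMn mulrA.
    by rewrite (meanZ _ (L1_normal2 R)) mean_normal2 mulr1 mulrC.
  have -> // : mean N (fun z => `|rho * z| ^+ 3) = rho ^+ 3 * G3.
  by under eq_mean do rewrite cube; rewrite (meanZ _ L1_normal_cube).
have DmE : D m = mean P (fun w => mean N (fun z => u (partial_sum m w + rho * z))).
  by apply: eq_mean => w; rewrite smooth_step.
have iG : L1 P (fun w => mean N (fun z => u (partial_sum m w + rho * z))).
  by apply: (i_comp (normal_smooth rho u)); exact: bounded_by_smooth.
have iu := i_comp _ uM; have iu2 := i_comp _ u2M.
have stepG' : `|D m - mean P (fun w => u (partial_sum m w))
    - rho ^+ 2 * mean P (fun w => u2 (partial_sum m w)) / 2| <= K * (rho ^+ 3 * G3).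
  have iGu := L1B iG iu.
  have iu2' : L1 P (fun w => rho ^+ 2 / 2 * u2 (partial_sum m w)) by exact: L1Z.
  rewrite DmE; have -> : mean P (fun w => mean N (fun z => u (partial_sum m w + rho * z))) -
   mean P (fun w => u (partial_sum m w))
    - rho ^+ 2 * mean P (fun w => u2 (partial_sum m w)) / 2 =
    mean P (fun w => mean N (fun z => u (partial_sum m w + rho * z))
      - u (partial_sum m w) - rho ^+ 2 / 2 * u2 (partial_sum m w)).
    by rewrite (meanB iGu iu2') (meanB iG iu) (meanZ _ iu2) mulrAC.
  rewrite -(mean_cst P (K * _)); apply: le_norm_mean => [||w].
  - exact: L1B iGu iu2'.
  - exact: L1_cst.
  - by have := stepG (partial_sum m w); rewrite mulrAC.
have iu2v : L1 P (fun w => u2 (partial_sum m w) * v w).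
  case: u2M => mu2 u2M.
  exact: (L1_boundedM (measurableT_comp mu2 mSm) (fun w => u2M _) v_L1).
have var_gap : `|mean P (fun w => u2 (partial_sum m w) * v w)
    - mean P (fun w => u2 (partial_sum m w))| <= M * eta.
  have iv := L1B v_L1 (L1_cst P 1); have iv1 := L1_norm iv.
  have -> : mean P (fun w => u2 (partial_sum m w) * v w)
      - mean P (fun w => u2 (partial_sum m w)) =
      mean P (fun w => u2 (partial_sum m w) * (v w - 1)).
    rewrite -(meanB iu2v iu2).
    by apply: eq_mean => w; rewrite mulrBr mulr1.
  case: u2M => mu2 u2M.
  apply: (@le_trans _ _ (mean P (fun w => M * `|v w - 1|))).
    apply: le_norm_mean => [||w].
    - exact: (L1_boundedM (measurableT_comp mu2 mSm) (fun w => u2M _) iv).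
    - exact: L1Z iv1.
    - by rewrite normrM; apply: ler_wpM2r (u2M _); exact: normr_ge0.
  rewrite (meanZ _ iv1); exact: ler_wpM2l M0 _ _ v_near1.
have hB := ler_wpM2l K0 (W3_le mp); rewrite -rho2 in stepW.
apply: le_trans (swap_bound (sqr_ge0 rho) stepW stepG' var_gap) _.
rewrite (_ : K * (B + G3) * rho ^+ 3 + M * eta / 2 * rho ^+ 2 =
  K * (B * rho ^+ 3) + K * (rho ^+ 3 * G3) + rho ^+ 2 * (M * eta) / 2); last by ring.
by rewrite !lerD2r; exact: hB.
Qed.

(** The steps telescope from [D 0], purely Gaussian because a_0 = 1, to [D p], the statistic itself
    because a_p = 0; the errors add up with p rho^2 = 1. *)
Lemma lindeberg_bound :
  `|mean P (fun w => h (partial_sum p w)) - mean N h| <=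
  K * (B + G3) * rho + M * eta / 2.
Proof.
have Dp : D p = mean P (fun w => h (partial_sum p w)).
  apply: eq_mean => w; rewrite /normal_smooth /a subnn sqrtr0 mulr0.
  by under eq_mean do rewrite mul0r addr0; rewrite mean_cst.
have D0 : D 0 = mean N h.
  rewrite /D; under eq_mean do rewrite /partial_sum big_ord0.
  rewrite mean_cst /normal_smooth /a subn0 mulVf ?gt_eqF ?sqrtr_gt0//.
  by under eq_mean do rewrite add0r mul1r.
rewrite -Dp -D0.
have tel m : (m <= p)%N -> `|D m - D 0| <=
    m%:R * (K * (B + G3) * rho ^+ 3 + M * eta / 2 * rho ^+ 2).
  elim: m => [|m ih] mp; first by rewrite subrr normr0 mul0r.
  rewrite (le_trans (ler_distD (D m) _ _))// -natr1 mulrDl mul1r addrC.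
  apply: lerD; first exact/ih/ltnW.
  exact: D_step.
apply: le_trans (tel p (leqnn p)) _.
have pr : p%:R * rho ^+ 2 = 1 by rewrite rho2 mulfV// gt_eqF.
rewrite (_ : p%:R * _ = K * (B + G3) * rho * (p%:R * rho ^+ 2) +
  M * eta / 2 * (p%:R * rho ^+ 2)); last by ring.
by rewrite pr !mulr1.
Qed.

End lindeberg.

(** * Fourth moments of sums of independent variables *)

Section fourth_moments.
Context d (T : measurableType d) (R : realType) (P : probability T R).
Implicit Types f g : T -> R.

Definition L4 f := measurable_fun [set: T] f /\ L1 P (fun w => f w ^+ 4).

Lemma L4_L2 f : L4 f -> L2 P f.
Proof.
move=> [mf f4]; split => //; apply: (@L1_le _ _ _ P (fun w => 1 + f w ^+ 4)).
- exact: measurable_funX.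
- by apply: L1D => //; exact: L1_cst.
- move=> w; rewrite ger0_norm ?sqr_ge0//.
  by have := sqr_ge0 (f w ^+ 2 - 1); nra.
Qed.

Lemma L4M f g : L4 f -> L4 g -> L2 P (fun w => f w * g w).
Proof.
move=> [mf f4] [mg g4]; split; first exact: measurable_funM.
apply: (@L1_le _ _ _ P (fun w => f w ^+ 4 + g w ^+ 4)).
- by apply: measurable_funX; exact: measurable_funM.
- exact: L1D.
- move=> w; rewrite ger0_norm ?sqr_ge0//.
  by have := sqr_ge0 (f w ^+ 2 - g w ^+ 2); have := sqr_ge0 (f w ^+ 2);
    have := sqr_ge0 (g w ^+ 2); nra.
Qed.

Lemma L4_cst c : L4 (fun=> c).
Proof. by split => //; exact: L1_cst. Qed.

Lemma L4Z c f : L4 f -> L4 (fun w => c * f w).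
Proof.
move=> [mf f4]; split; first exact: measurable_funM.
by under eq_fun do rewrite exprMn; exact: L1Z.
Qed.

End fourth_moments.

Section independent_moments.
Context d (T : measurableType d) (R : realType) (P : probability T R).
Variables (K : finType) (V : K -> T -> R).
Hypothesis mV : forall i, measurable_fun [set: T] (V i).
Hypothesis V_indep : mutually_independent P V.

(* [4 S L^3 z^3 <= 2 S^2 L^2 z^2 + 2 L^4 z^4], so the third moment of [z] is
   not needed. *)
Lemma mean_expr4_step (A B : {set K}) (S L z : T -> R) (M : R) :
  [disjoint A & B]%B ->
  depends_on V A S -> depends_on V A L -> depends_on V B z ->
  L4 P S -> L4 P L -> L4 P z ->
  mean P z = 0 -> mean P (fun w => z w ^+ 2) = 1 ->
  mean P (fun w => z w ^+ 4) <= M ->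
  L4 P (fun w => S w + L w * z w) /\
  mean P (fun w => (S w + L w * z w) ^+ 4) <=
  mean P (fun w => S w ^+ 4) + 8 * mean P (fun w => S w ^+ 2 * L w ^+ 2)
    + 3 * M * mean P (fun w => L w ^+ 4).
Proof.
move=> AB SA LA zB S4 L4_ z4 z1 z2 zM.
have [mS iS4] := S4; have [mL iL4] := L4_; have [mz iz4] := z4.
have [_ iz2] := L4_L2 z4.
have i1 : L1 P (fun w => S w ^+ 3 * L w).
  apply: (@L1_le _ _ _ P (fun w => S w ^+ 4 + L w ^+ 4)).
  - by apply: measurable_funM => //; exact: measurable_funX.
  - exact: L1D.
  - move=> w; rewrite ler_norml; move: (S w) (L w) => x y.
    have := sqr_ge0 (x ^+ 2 - y ^+ 2); have := sqr_ge0 (x ^+ 2 + x * y).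
    have := sqr_ge0 (x ^+ 2 - x * y); have := sqr_ge0 (x * y).
    have := sqr_ge0 (y ^+ 2); have := sqr_ge0 (x ^+ 2); nra.
have [mSL iSL] : L2 P (fun w => S w * L w) by exact: L4M.
have iSL2 : L1 P (fun w => S w ^+ 2 * L w ^+ 2).
  by under eq_fun do rewrite -exprMn.
have d1 : depends_on V A (fun w => S w ^+ 3 * L w).
  by apply: depends_onM => //; exact: depends_onX.
have d2 : depends_on V A (fun w => S w ^+ 2 * L w ^+ 2).
  by apply: depends_onM => //; exact: depends_onX.
have d3 : depends_on V A (fun w => L w ^+ 4) by exact: depends_onX.
have dz2 : depends_on V B (fun w => z w ^+ 2) by exact: depends_onX.
have dz4 : depends_on V B (fun w => z w ^+ 4) by exact: depends_onX.
have iz := L2_L1 (L4_L2 z4).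
have j1 := L1M_depends mV V_indep AB d1 zB i1 iz.
have j2 := L1M_depends mV V_indep AB d2 dz2 iSL2 iz2.
have j3 := L1M_depends mV V_indep AB d3 dz4 iL4 iz4.
have e1 := meanM_depends mV V_indep AB d1 zB i1 iz.
have e2 := meanM_depends mV V_indep AB d2 dz2 iSL2 iz2.
have e3 := meanM_depends mV V_indep AB d3 dz4 iL4 iz4.
pose G w := S w ^+ 4 + 4 * (S w ^+ 3 * L w * z w)
  + 8 * (S w ^+ 2 * L w ^+ 2 * z w ^+ 2) + 3 * (L w ^+ 4 * z w ^+ 4).
have k1 := L1D iS4 (L1Z 4 j1); have k2 := L1D k1 (L1Z 8 j2).
have iG : L1 P G := L1D k2 (L1Z 3 j3).
have ub w : (S w + L w * z w) ^+ 4 <= G w.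
  rewrite /G; move: (S w) (L w) (z w) => x y t.
  rewrite -subr_ge0 (_ : _ - _ = 2 * (y * t * (x - y * t)) ^+ 2); last by ring.
  by rewrite mulr_ge0// sqr_ge0.
have iSLz : L4 P (fun w => S w + L w * z w).
  have mSLz : measurable_fun [set: T] (fun w => S w + L w * z w).
    by apply: measurable_funD => //; exact: measurable_funM.
  split => //; apply: L1_le iG _; first exact: measurable_funX.
  by move=> w; rewrite ger0_norm ?exprn_even_ge0.
split=> //; apply: le_trans (le_mean iSLz.2 iG ub) _.
rewrite /G (meanD k2 (L1Z 3 j3)) (meanD k1 (L1Z 8 j2)) (meanD iS4 (L1Z 4 j1)).
rewrite (meanZ 4 j1) (meanZ 8 j2) (meanZ 3 j3) e1 e2 e3 z1 z2.
rewrite mulr0 mulr0 addr0 mulr1 lerD2l -mulrA ler_wpM2l// mulrC ler_wpM2r//.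
by apply: mean_ge0 => w; exact: exprn_even_ge0.
Qed.

(** The constant 4 + 3 M closes the induction: its cross term 2 (4 + 3 M) s e absorbs 8 e s, and its
    e^2 term absorbs 3 M e^2. *)
Lemma linear_expr4_bound (F : realFieldType) (M s e x : F) :
  0 <= s -> 0 <= e -> 1 <= M -> x <= (4 + 3 * M) * s ^+ 2 ->
  x + 8 * (e * s) + 3 * M * e ^+ 2 <= (4 + 3 * M) * (s + e) ^+ 2.
Proof.
move=> s0 e0 M1 h; have := mulr_ge0 s0 e0; have := sqr_ge0 e.
have : 0 <= (s * e) * (M - 1) by rewrite mulr_ge0 ?mulr_ge0// subr_ge0.
by nra.
Qed.

Section standardized.
Variables (M : R).
Definition standardized (z : T -> R) :=
  [/\ L4 P z, mean P z = 0, mean P (fun w => z w ^+ 2) = 1 &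
      mean P (fun w => z w ^+ 4) <= M].

(** Jensen: 1 = (E z^2)^2 <= E z^4. *)
Lemma standardized_M_ge1 z : standardized z -> 1 <= M.
Proof.
move=> [z4 _ z2]; apply: le_trans; have [mz iz4] := z4; have [_ iz2] := L4_L2 z4.
have e w : z w ^+ 4 = (z w ^+ 2) ^+ 2 by rewrite -exprM.
have := @sqr_mean_le _ _ _ P _ iz2; rewrite z2 expr1n.
under eq_mean do rewrite -e; apply.
by under eq_fun do rewrite -e.
Qed.

(** Independence of the [Z i] is expressed by disjoint sets of underlying variables, so that each
    [Z i] may itself be a product such as xi_i X_ij. *)
Definition blocks n (A : 'I_n -> {set K}) (Z : 'I_n -> T -> R) :=
  (forall i j, i != j -> [disjoint A i & A j]%B) /\
  (forall i, depends_on V (A i) (Z i)).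

Definition others n (A : 'I_n -> {set K}) (i : 'I_n) : {set K} :=
  [set k | [exists j, (j != i) && (k \in A j)]]%SET.

Lemma others_disjoint n (A : 'I_n -> {set K}) i :
  (forall i j, i != j -> [disjoint A i & A j]%B) -> [disjoint others A i & A i]%B.
Proof.
move=> dA; rewrite disjoint_subset; apply/fintype.subsetP => k.
rewrite inE => /existsP[j /andP[ji kj]]; rewrite !inE.
by rewrite (disjointFr (dA _ _ ji) kj).
Qed.

Lemma sub_others n (A : 'I_n -> {set K}) i j : j != i -> A j \subset others A i.
Proof.
move=> ji; apply/fintype.subsetP => k kA; rewrite inE.
by apply/existsP; exists j; rewrite ji.
Qed.

Lemma widen_neq_max n (i : 'I_n) : widen_ord (leqnSn n) i != ord_max.
Proof. by rewrite -val_eqE /= neq_ltn ltn_ord. Qed.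

Lemma blocks_widen n (A : 'I_n.+1 -> {set K}) Z : blocks A Z ->
  blocks (A \o widen_ord (leqnSn n)) (Z \o widen_ord (leqnSn n)).
Proof.
move=> [dA ZA]; split=> [i j ij|i] /=; last exact: ZA.
by apply: dA; rewrite -val_eqE /= val_eqE.
Qed.

(** Induction on [n]: the last variable is added by [mean_expr4_step] with a constant coefficient
    [L]. *)
Lemma mean_linear_expr4 n (A : 'I_n -> {set K}) (Z : 'I_n -> T -> R) (a : 'I_n -> R) :
  blocks A Z -> (forall i, standardized (Z i)) ->
  [/\ L4 P (fun w => \sum_i a i * Z i w),
      mean P (fun w => (\sum_i a i * Z i w) ^+ 2) = \sum_i a i ^+ 2 &
      mean P (fun w => (\sum_i a i * Z i w) ^+ 4) <=
        (4 + 3 * M) * (\sum_i a i ^+ 2) ^+ 2].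
Proof.
elim: n A Z a => [|n ih] A Z a bl st.
  split; [|rewrite big_ord0|rewrite big_ord0 expr0n/= mulr0].
  - by under eq_fun do rewrite big_ord0; exact: L4_cst.
  - by under eq_mean do rewrite big_ord0 expr0n; rewrite mean_cst.
  - by under eq_mean do rewrite big_ord0 expr0n; rewrite mean_cst.
have [dA ZA] := bl.
pose wd := @widen_ord n n.+1 (leqnSn n).
have [i4 m2 m4] := ih _ _ (a \o wd) (blocks_widen bl) (fun i => st (wd i)).
set S := (fun w => \sum_i _ * _) in i4 m2 m4; set s := \sum_i (_ ^+ 2) in m2 m4.
have SE w : \sum_i a i * Z i w = S w + a ord_max * Z ord_max w.
  by rewrite big_ord_recr.
have sE : \sum_i a i ^+ 2 = s + a ord_max ^+ 2 by rewrite big_ord_recr.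
have dS : depends_on V (others A ord_max) S.
  apply: depends_on_sum => i _; apply: depends_onM; first exact: depends_on_cst.
  by apply: depends_on_sub (ZA (wd i)); apply: sub_others; exact: widen_neq_max.
have [z4 z1 z2 zM] := st ord_max.
have M1 := standardized_M_ge1 (st ord_max).
have dAB := others_disjoint ord_max dA.
have dc : depends_on V (others A ord_max) (fun=> a ord_max) by exact: depends_on_cst.
have [r4 rle] := mean_expr4_step dAB dS dc (ZA ord_max) i4 (L4_cst P _) z4 z1 z2 zM.
have iS := L4_L2 i4; have iz := L4_L2 z4.
split.
- by under eq_fun do rewrite SE.
- under eq_mean do rewrite SE.
  have jSz := L1M_depends mV V_indep dAB dS (ZA ord_max) (L2_L1 iS) (L2_L1 iz).
  have k2 := L1Z (a ord_max ^+ 2) iz.2.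
  have k1 := L1Z (2 * a ord_max) jSz.
  transitivity (mean P (fun w => S w ^+ 2 + 2 * a ord_max * (S w * Z ord_max w)
    + a ord_max ^+ 2 * Z ord_max w ^+ 2)).
    by apply: eq_mean => w; ring.
  rewrite (meanD (L1D iS.2 k1) k2) (meanD iS.2 k1) (meanZ _ jSz) (meanZ _ iz.2).
  rewrite (meanM_depends mV V_indep dAB dS (ZA ord_max) (L2_L1 iS) (L2_L1 iz)).
  by rewrite z1 z2 m2 sE !mulr0 addr0 mulr1.
- under eq_mean do rewrite SE.
  apply: le_trans rle _; rewrite sE mean_cst.
  under [X in _ + 8 * X + _]eq_mean do rewrite mulrC.
  rewrite (meanZ _ iS.2) m2.
  have s0 : 0 <= s by apply: sumr_ge0 => i _; exact: sqr_ge0.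
  rewrite [a ord_max ^+ 4](exprM _ 2 2).
  exact: linear_expr4_bound s0 (sqr_ge0 _) M1 m4.
Qed.

End standardized.
End independent_moments.

(** * Sums over increasing pairs of indices *)

Section pair_sums.
Context (R : realFieldType).

Definition pair_sum n (F : 'I_n -> 'I_n -> R) : R :=
  \sum_(i < n) \sum_(s < n | (i < s)%N) F i s.

Lemma pair_sumE n (F : 'I_n -> 'I_n -> R) :
  pair_sum F = \sum_(q : 'I_n * 'I_n | (q.1 < q.2)%N) F q.1 q.2.
Proof. by rewrite /pair_sum pair_big_dep. Qed.

(** Splits off the pairs whose larger index is the last one, which is the inductive step for sums
    over pairs. *)
Lemma pair_sum_recr n (F : 'I_n.+1 -> 'I_n.+1 -> R) :
  let wd := widen_ord (leqnSn n) in
  pair_sum F = pair_sum (fun i s => F (wd i) (wd s)) + \sum_i F (wd i) ord_max.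
Proof.
rewrite /pair_sum big_ord_recr /= [X in _ + X]big1 ?addr0; last first.
  by move=> s; rewrite ltnNge -ltnS ltn_ord.
rewrite -big_split; apply: eq_bigr => i _ /=.
by rewrite big_mkcond big_ord_recr /= ltn_ord -big_mkcond.
Qed.

Lemma eq_pair_sum n (F G : 'I_n -> 'I_n -> R) :
  (forall i s, F i s = G i s) -> pair_sum F = pair_sum G.
Proof. by move=> FG; apply: eq_bigr => i _; apply: eq_bigr. Qed.

Lemma pair_sum_cst n (c : R) :
  pair_sum (fun _ _ : 'I_n => c) = n%:R * (n%:R - 1) / 2 * c.
Proof.
elim: n => [|n ih]; first by rewrite /pair_sum big_ord0 !mul0r.
rewrite pair_sum_recr ih sumr_const card_ord -natr1 -mulr_natl.
by field.
Qed.

(* Each index belongs to [n - 1] pairs. *)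
Lemma pair_sumD n (f : 'I_n -> R) :
  pair_sum (fun i s => f i + f s) = (n%:R - 1) * \sum_i f i.
Proof.
elim: n f => [|n ih] f; first by rewrite /pair_sum !big_ord0 mulr0.
rewrite pair_sum_recr ih big_split /= sumr_const card_ord big_ord_recr /= -natr1.
by rewrite -mulr_natl; ring.
Qed.

End pair_sums.

(** * Fourth moments of quadratic forms and mixed moments of order four *)

Section quadratic_moments.
Context d (T : measurableType d) (R : realType) (P : probability T R).
Variables (K : finType) (V : K -> T -> R).
Hypothesis mV : forall i, measurable_fun [set: T] (V i).
Hypothesis V_indep : mutually_independent P V.
Variable M : R.

(** Passing from n to n + 1 adds at most 2 C n^3 + (8 + 3 M) (4 + 3 M) n^3 to a bound C n^4. With C
    = (8 + 3 M) (4 + 3 M) this is 3 C n^3, which is below C ((n + 1)^4 - n^4). *)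
Definition quad4 : R := (8 + 3 * M) * (4 + 3 * M).

(** The new index adds L Z, with [L] the sum of the earlier variables. By the linear case E L^4 is
    O(n^2), so one step costs O(n^3). *)
Lemma mean_quadratic_expr4 n (A : 'I_n -> {set K}) (Z : 'I_n -> T -> R) :
  blocks V A Z -> (forall i, standardized P M (Z i)) ->
  L4 P (fun w => pair_sum (fun i s => Z i w * Z s w)) /\
  mean P (fun w => pair_sum (fun i s => Z i w * Z s w) ^+ 4) <=
    quad4 * n%:R ^+ 4.
Proof.
elim: n A Z => [|n ih] A Z bl st.
  have e w : pair_sum (fun i s => Z i w * Z s w) = 0 by rewrite /pair_sum big_ord0.
  split; first by under eq_fun do rewrite e; exact: L4_cst.
  by under eq_mean do rewrite e expr0n /=; rewrite mean_cst expr0n /= mulr0.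
have [dA ZA] := bl.
pose wd := @widen_ord n n.+1 (leqnSn n).
have [i4 m4] := ih _ _ (blocks_widen bl) (fun i => st (wd i)).
have [l4 _ lm4] := mean_linear_expr4 mV V_indep (fun=> 1) (blocks_widen bl)
  (fun i => st (wd i)).
set Q := (fun w => pair_sum _) in i4 m4; set L := (fun w => \sum_i _) in l4 lm4.
have QE w : pair_sum (fun i s => Z i w * Z s w) = Q w + L w * Z ord_max w.
  rewrite pair_sum_recr; congr (_ + _); rewrite mulr_suml.
  by apply: eq_bigr => i _; rewrite mul1r.
have dZ i : depends_on V (others A ord_max) (Z (wd i)).
  by apply: depends_on_sub (ZA (wd i)); apply: sub_others; exact: widen_neq_max.
have dQ : depends_on V (others A ord_max) Q.
  apply: depends_on_sum => i _; apply: depends_on_sum => s _.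
  by apply: depends_onM; exact: dZ.
have dL : depends_on V (others A ord_max) L.
  apply: depends_on_sum => i _.
  by apply: depends_onM; [exact: depends_on_cst|exact: dZ].
have [z4 z1 z2 zM] := st ord_max.
have M1 := standardized_M_ge1 (st ord_max).
have dAB := others_disjoint ord_max dA.
have [r4 rle] := mean_expr4_step mV V_indep dAB dQ dL (ZA ord_max) i4 l4 z4 z1 z2 zM.
split; first by under eq_fun do rewrite QE.
under eq_mean do rewrite QE.
apply: le_trans rle _.
have iQL : L1 P (fun w => Q w ^+ 2 * L w ^+ 2).
  by under eq_fun do rewrite -exprMn; exact: (L4M i4 l4).2.
have {lm4} : mean P (fun w => L w ^+ 4) <= (4 + 3 * M) * n%:R ^+ 2.
  apply: le_trans lm4 _; rewrite le_eqVlt; apply/orP; left; apply/eqP.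
  by congr (_ * _ ^+ 2); under eq_bigr do rewrite expr1n;
    rewrite sumr_const card_ord.
(* The weights below divide by [n]; for n = 0 all sums are empty. *)
have [n0|n_gt0] := posnP n.
  have no (i : 'I_n) : False by have := ltn_ord i; rewrite [X in (_ < X)%N]n0.
  have Q0 w : Q w = 0 by rewrite /Q /pair_sum big1// => i; have := no i.
  have L0 w : L w = 0 by rewrite /L big1// => i; have := no i.
  move=> _; under eq_mean do rewrite Q0 expr0n /=.
  under [X in _ + 8 * X + _]eq_mean do rewrite Q0 expr0n /= mul0r.
  under [X in _ + _ * X]eq_mean do rewrite L0 expr0n /=.
  rewrite !mean_cst !mulr0 !addr0 n0 expr1n mulr1 mulr_ge0//.
    by rewrite addr_ge0// mulr_ge0// (le_trans ler01).
  by rewrite addr_ge0// mulr_ge0// (le_trans ler01).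
set m := n%:R => lm4; have m1 : 1 <= m by rewrite ler1n.
have m0 : 0 < m by lra.
(* A weighted arithmetic-geometric mean, whose weights balance E Q^4, of order n^4, against E L^4,
   of order n^2, at order n^3. *)
have hz : mean P (fun w => Q w ^+ 2 * L w ^+ 2) <=
    (4 * m)^-1 * mean P (fun w => Q w ^+ 4) + m * mean P (fun w => L w ^+ 4).
  rewrite -(meanZ _ i4.2) -(meanZ _ l4.2) -meanD; last 2 first.
  - exact: L1Z i4.2.
  - exact: L1Z l4.2.
  apply: le_mean iQL (L1D (L1Z _ i4.2) (L1Z _ l4.2)) _ => w.
  move: (Q w) (L w) => x y; rewrite -subr_ge0.
  rewrite (_ : _ - _ = (4 * m)^-1 * (x ^+ 2 - 2 * m * y ^+ 2) ^+ 2); last first.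
    by field; rewrite gt_eqF.
  by rewrite mulr_ge0 ?sqr_ge0// invr_ge0 mulr_ge0// ltW.
have y0 : 0 <= mean P (fun w => L w ^+ 4).
  by apply: mean_ge0 => w; exact: exprn_even_ge0.
move: m4 lm4 hz y0; rewrite /quad4 -[n.+1%:R]natr1 -/m.
set x := mean P (fun w => Q w ^+ 4); set y := mean P (fun w => L w ^+ 4).
set z := mean _ _ => m4 lm4 hz y0.
have hx : (4 * m)^-1 * x <= (8 + 3 * M) * (4 + 3 * M) * m ^+ 3 / 4.
  rewrite ler_pdivrMl ?mulr_gt0//; apply: le_trans m4 _.
  by rewrite le_eqVlt; apply/orP; left; apply/eqP; field.
have hy : m * y <= (4 + 3 * M) * m ^+ 3.
  rewrite (_ : _ * m ^+ 3 = m * ((4 + 3 * M) * m ^+ 2)); last by ring.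
  by rewrite ler_pM2l.
have hy2 : M * y <= M * (4 + 3 * M) * m ^+ 3.
  rewrite -mulrA ler_pM2l; last by lra.
  apply: le_trans lm4 _; rewrite ler_pM2l; last by lra.
  by rewrite ler_weXn2l.
have c0 : 0 <= (8 + 3 * M) * (4 + 3 * M) by rewrite mulr_ge0//; lra.
apply: (@le_trans _ _ ((8 + 3 * M) * (4 + 3 * M) * (m ^+ 4 + 4 * m ^+ 3))).
  have m3 : 0 <= m ^+ 3 by rewrite exprn_ge0// ltW.
  have := mulr_ge0 c0 m3; clear - m4 hx hy hy2 hz; lra.
rewrite (ler_wpM2l c0)//.
rewrite -subr_ge0 (_ : _ - _ = 6 * m ^+ 2 + 4 * m + 1); last by ring.
by have := sqr_ge0 m; lra.
Qed.

Hypothesis V_std : forall k, standardized P M (V k).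

Lemma depends_on_others k j : j != k -> depends_on V [set i | i != k]%SET (V j).
Proof. by move=> jk; apply: depends_on_var => //; rewrite inE. Qed.

(** A factor whose index occurs once is centred and independent of the rest. *)
Lemma mean_isolated k a b c : a != k -> b != k -> c != k ->
  mean P (fun w => V k w * (V a w * V b w * V c w)) = 0.
Proof.
move=> ak bk ck; have [k4 k1 _ _] := V_std k.
have [a4 _ _ _] := V_std a; have [b4 _ _ _] := V_std b; have [c4 _ _ _] := V_std c.
rewrite (@meanM_depends _ _ _ P _ _ mV V_indep (finset.set1 k) [set i | i != k]%SET).
- by rewrite k1 mul0r.
- by rewrite disjoint_subset; apply/fintype.subsetP => i; rewrite !inE negbK.
- by apply: depends_on_var => //; rewrite inE.
- apply: depends_onM; last exact: depends_on_others.
  by apply: depends_onM; exact: depends_on_others.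
- exact: L2_L1 (L4_L2 k4).
- exact: L2M (L4M a4 b4) (L4_L2 c4).
Qed.

Lemma mean_square_product a b : a != b ->
  mean P (fun w => V a w ^+ 2 * V b w ^+ 2) = 1.
Proof.
move=> ab; have [a4 _ a2 _] := V_std a; have [b4 _ b2 _] := V_std b.
rewrite (@meanM_depends _ _ _ P _ _ mV V_indep (finset.set1 a) (finset.set1 b)).
- by rewrite a2 b2 mul1r.
- by rewrite disjoint_subset; apply/fintype.subsetP => i; rewrite !inE => /eqP ->.
- by apply: depends_onX; apply: depends_on_var => //; rewrite inE.
- by apply: depends_onX; apply: depends_on_var => //; rewrite inE.
- exact: (L4_L2 a4).2.
- exact: (L4_L2 b4).2.
Qed.

(** Only perfect pairings of the indices survive, and c != e rules out both the pairing of [c] with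
    [e] and four equal indices. *)
Lemma mean_product4 a b c e : c != e ->
  mean P (fun w => V a w * V b w * (V c w * V e w)) =
  ((a == c) && (b == e))%:R + ((a == e) && (b == c))%:R.
Proof.
move=> ce; have ec : e != c by rewrite eq_sym.
have [ac|ac] := eqVneq a c.
  subst c; rewrite (negbTE ce) /= mulr0n addr0.
  have [be|be] := eqVneq b e; rewrite /= ?mulr0n ?mulr1n.
    subst e; rewrite -(mean_square_product ce).
    by apply: eq_mean => w; ring.
  rewrite -(mean_isolated (k := e) (a := a) (b := b) (c := a))//.
  by apply: eq_mean => w; ring.
have [ae|ae] := eqVneq a e; rewrite /= mulr0n add0r.
  subst e; have [bc|bc] := eqVneq b c; rewrite /= ?mulr0n ?mulr1n.
    subst c; rewrite -(mean_square_product ec).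
    by apply: eq_mean => w; ring.
  rewrite -(mean_isolated (k := c) (a := a) (b := b) (c := a))//.
  by apply: eq_mean => w; ring.
have [bc|bc] := eqVneq b c.
  subst c; rewrite -(mean_isolated (k := e) (a := a) (b := b) (c := b))//.
  by apply: eq_mean => w; ring.
rewrite -(mean_isolated (k := c) (a := a) (b := b) (c := e))//.
by apply: eq_mean => w; ring.
Qed.

End quadratic_moments.

(** * Second moment of a U-statistic of order two with vector-valued rows *)

Section ustatistic.
Context d (T : measurableType d) (R : realType) (P : probability T R).
Variables (K : finType) (V : K -> T -> R).
Hypothesis mV : forall i, measurable_fun [set: T] (V i).
Hypothesis V_indep : mutually_independent P V.
Variables (n p : nat) (A : 'I_n -> {set K}) (D : 'I_n -> 'I_p -> T -> R).
Variables (th : 'I_p -> R) (Lb : R) (c : 'I_p -> 'I_p -> R).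
Hypothesis dA : forall i s, i != s -> [disjoint A i & A s]%B.
Hypothesis D_dep : forall i j, depends_on V (A i) (D i j).
Hypothesis D_L2 : forall i j, L2 P (D i j).
Hypothesis D_mean : forall i j, mean P (D i j) = 0.

Let lin i w := \sum_j th j * D i j w.
Let quad i s w := \sum_j D i j w * D s j w.

Hypothesis lin_le : forall i, mean P (fun w => lin i w ^+ 2) <= Lb.
Hypothesis cov_le : forall i j l, `|mean P (fun w => D i j w * D i l w)| <= c j l.

Let lin_dep i : depends_on V (A i) (lin i).
Proof.
by apply: depends_on_sum => j _; apply: depends_onM => //; exact: depends_on_cst.
Qed.

Let lin_L2 i : L2 P (lin i).
Proof. by apply: L2_sum => j _; exact: L2Z. Qed.

Let DM_dep i j l : depends_on V (A i) (fun w => D i j w * D i l w).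
Proof. exact: depends_onM. Qed.

Let quad_L2 i s : i != s -> L2 P (quad i s).
Proof.
by move=> si; apply: L2_sum => j _; exact: (L2M_depends mV V_indep (dA si)).
Qed.

(** The entries are only square integrable. Three factors are integrable because the one in row [s]
    is independent of the other two, whether or not those share a row. *)
Let D3_L1 i s t j l : i != s -> t != s -> L1 P (fun w => D t j w * D i l w * D s l w).
Proof.
move=> si ts; have [->|ti] := eqVneq t i.
  exact: (L1M_depends mV V_indep (dA si) (@DM_dep i j l) (@D_dep s l)
    (L2M (D_L2 i j) (D_L2 i l)) (L2_L1 (D_L2 s l))).
have i2 := L2M_depends mV V_indep (dA ti) (@D_dep t j) (@D_dep i l) (D_L2 t j) (D_L2 i l).
have dtis : [disjoint others A s & A s]%B by exact: others_disjoint.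
apply: (L1M_depends mV V_indep dtis _ (@D_dep s l) (L2_L1 i2) (L2_L1 (D_L2 s l))).
by apply: depends_onM; apply: depends_on_sub (@D_dep _ _); exact: sub_others.
Qed.

(** In each term of the expanded product, row [i] enters through a single centred factor. *)
Let quad_isolated i s i' s' : i != s -> i' != s' -> i != i' -> i != s' ->
  mean P (fun w => quad i s w * quad i' s' w) = 0.
Proof.
move=> si s'i' ii' is'.
have term j l : L1 P (fun w => D s j w * D i' l w * D s' l w).
  have [ss'|ss'] := eqVneq s s'; last exact: D3_L1.
  subst s'; rewrite (_ : (fun _ => _) = fun w => D s j w * D s l w * D i' l w).
    by apply: D3_L1 => //; rewrite eq_sym.
  by apply/funext => w; ring.
have dia : [disjoint A i & others A i]%B.
  by rewrite disjoint_sym; exact: others_disjoint.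
have dep j l : depends_on V (others A i) (fun w => D s j w * D i' l w * D s' l w).
  apply: depends_onM; [apply: depends_onM|]; apply: depends_on_sub (@D_dep _ _);
    by apply: sub_others; rewrite eq_sym.
have i4 j l := L1M_depends mV V_indep dia (@D_dep i j) (dep j l)
  (L2_L1 (D_L2 i j)) (term j l).
transitivity (mean P (fun w => \sum_j \sum_l D i j w * (D s j w * D i' l w * D s' l w))).
  apply: eq_mean => w; rewrite /quad big_distrlr; apply: eq_bigr => j _.
  by apply: eq_bigr => l _ /=; ring.
rewrite mean_sum; last by move=> j _; exact: L1_sum.
rewrite big1// => j _; rewrite mean_sum// big1// => l _.
rewrite (meanM_depends mV V_indep dia (@D_dep i j) (dep j l)
  (L2_L1 (D_L2 i j)) (term j l)).
by rewrite D_mean mul0r.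
Qed.

Let quadC i s w : quad i s w = quad s i w.
Proof. by apply: eq_bigr => j _; rewrite mulrC. Qed.

Let quad_orthogonal (q q' : 'I_n * 'I_n) : (q.1 < q.2)%N -> (q'.1 < q'.2)%N ->
  q != q' -> mean P (fun w => quad q.1 q.2 w * quad q'.1 q'.2 w) = 0.
Proof.
case: q q' => [i s] [i' s'] /= lis lis' qq'.
have is_ : i != s by rewrite -val_eqE neq_ltn lis.
have is' : i' != s' by rewrite -val_eqE neq_ltn lis'.
(* Distinct increasing pairs cannot consist of the same indices, so one index of the first pair is
   isolated; the cases left over are contradictory. *)
have [|ii'] := boolP (i \in [:: i'; s']); last first.
  by move: ii'; rewrite !inE negb_or => /andP[? ?]; exact: quad_isolated.
have [|ss'] := boolP (s \in [:: i'; s']); last first.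
  move: ss'; rewrite !inE negb_or => /andP[? ?] _.
  by under eq_mean do rewrite quadC; apply: quad_isolated => //; rewrite eq_sym.
rewrite !inE => /orP[] /eqP ? /orP[] /eqP ?; subst.
- by rewrite eqxx in is_.
- by rewrite ltnNge ltnW in lis'.
- by rewrite eqxx in qq'.
- by rewrite eqxx in is_.
Qed.

(** After expansion of the square, rows [i] and [s] factor, and each term is a product of two
    covariances, one per row. *)
Let quad_sqr i s : i != s ->
  mean P (fun w => quad i s w ^+ 2) <= \sum_j \sum_l c j l ^+ 2.
Proof.
move=> si.
have iDD k j l : L1 P (fun w => D k j w * D k l w) by exact: L2M.
have i4 j l := L1M_depends mV V_indep (dA si) (@DM_dep i j l) (@DM_dep s j l)
  (iDD i j l) (iDD s j l).
rewrite (_ : mean _ _ = mean P (fun w => \sum_j \sum_l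
    (D i j w * D i l w) * (D s j w * D s l w))); last first.
  apply: eq_mean => w; rewrite /quad expr2 big_distrlr; apply: eq_bigr => j _.
  by apply: eq_bigr => l _ /=; ring.
rewrite mean_sum; last by move=> j _; exact: L1_sum.
apply: ler_sum => j _; rewrite mean_sum//; apply: ler_sum => l _.
rewrite (meanM_depends mV V_indep (dA si) (@DM_dep i j l) (@DM_dep s j l)
  (iDD i j l) (iDD s j l)).
apply: le_trans (ler_norm _) _; rewrite normrM expr2.
by apply: ler_pM.
Qed.

(** Used twice: with rows made of the products Y_i X_ij for the power, and with one column, th = 1
    and D = xi^2 - 1 for the noise variance under the null. *)
Definition ustat w : R :=
  pair_sum (fun i s => \sum_j (th j + D i j w) * (th j + D s j w)).

Let N : R := n%:R * (n%:R - 1) / 2.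

(** Hoeffding's decomposition; each row lies in n - 1 pairs, whence the factor of the linear
    part. *)
Let ustatE w : ustat w - N * (\sum_j th j ^+ 2) =
  (n%:R - 1) * (\sum_i lin i w) + pair_sum (fun i s => quad i s w).
Proof.
rewrite -pair_sumD /ustat /N -pair_sum_cst.
rewrite /pair_sum -sumrB -big_split; apply: eq_bigr => i _ /=.
rewrite -sumrB -big_split; apply: eq_bigr => s _ /=.
rewrite /lin /quad -sumrB -!big_split; apply: eq_bigr => j _ /=.
by ring.
Qed.

Lemma ustat_L2 : L2 P (fun w => ustat w - N * (\sum_j th j ^+ 2)).
Proof.
under eq_fun do rewrite ustatE.
apply: L2D; first by apply: L2Z; exact: L2_sum.
apply: L2_sum => i _; apply: L2_sum => s lis; apply: quad_L2.
by rewrite -val_eqE neq_ltn lis.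
Qed.

(** The factors 2 come from (x + y)^2 <= 2 x^2 + 2 y^2 for the linear and quadratic parts; within
    each part, distinct rows or distinct pairs are orthogonal. *)
Lemma ustat_variance :
  mean P (fun w => (ustat w - N * (\sum_j th j ^+ 2)) ^+ 2) <=
  2 * ((n%:R - 1) ^+ 2 * (n%:R * Lb)) + 2 * (N * \sum_j \sum_l c j l ^+ 2).
Proof.
have iL : L2 P (fun w => \sum_i lin i w) by exact: L2_sum.
have pairL2 (q : 'I_n * 'I_n) : (q.1 < q.2)%N -> L2 P (quad q.1 q.2).
  by move=> q12; apply: quad_L2; rewrite -val_eqE neq_ltn q12.
have iQ : L2 P (fun w => \sum_(q : 'I_n * 'I_n | (q.1 < q.2)%N) quad q.1 q.2 w).
  exact: L2_sum.
set S2 := \sum_j _.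
have hL : mean P (fun w => (\sum_i lin i w) ^+ 2) <= n%:R * Lb.
  rewrite mean_sqr_sum_orthogonal//; last first.
    move=> i s _ _ si.
    rewrite (meanM_depends mV V_indep (dA si) (@lin_dep i) (@lin_dep s)
      (L2_L1 (lin_L2 i)) (L2_L1 (lin_L2 s))).
    rewrite [X in X * _]mean_sum; last by move=> j _; apply: L1Z; exact: L2_L1.
    rewrite big1 ?mul0r// => j _; rewrite meanZ ?D_mean ?mulr0//.
    exact: L2_L1.
  apply: le_trans (ler_sum _ (fun i _ => lin_le i)) _.
  by rewrite sumr_const card_ord mulr_natl.
have hQ : mean P (fun w => (\sum_(q : 'I_n * 'I_n | (q.1 < q.2)%N) quad q.1 q.2 w) ^+ 2)
    <= N * \sum_j \sum_l c j l ^+ 2.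
  rewrite (mean_sqr_sum_orthogonal pairL2 (@quad_orthogonal)).
  have le_q (q : 'I_n * 'I_n) : (q.1 < q.2)%N ->
      mean P (fun w => quad q.1 q.2 w ^+ 2) <= S2.
    by move=> q12; apply: quad_sqr; rewrite -val_eqE neq_ltn q12.
  apply: le_trans (ler_sum _ le_q) _.
  by rewrite -(pair_sumE (fun _ _ => S2)) pair_sum_cst.
have k1 := L1Z (2 * (n%:R - 1) ^+ 2) iL.2; have k2 := L1Z 2 iQ.2.
apply: le_trans (le_mean ustat_L2.2 (L1D k1 k2) _) _.
  move=> w; rewrite ustatE pair_sumE -subr_ge0.
  set x := \sum_i lin i w; set y := \sum_(q | _) quad _ _ w.
  rewrite (_ : _ - _ = ((n%:R - 1) * x - y) ^+ 2); last by ring.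
  exact: sqr_ge0.
rewrite (meanD k1 k2) (meanZ _ iL.2) (meanZ _ iQ.2) -mulrA; apply: lerD.
  by apply: ler_wpM2l => //; apply: ler_wpM2l hL; exact: sqr_ge0.
exact: ler_wpM2l hQ.
Qed.

End ustatistic.

(** * Standardization of the Gaussian noise *)

Section standard_variables.
Context (R : realType).
Local Notation N := (normal_prob (0 : R) 1).

Lemma standardized_le d (T : measurableType d) (P : probability T R) (M M' : R) z :
  M <= M' -> standardized P M z -> standardized P M' z.
Proof. by move=> MM' [z4 z1 z2 zM]; split => //; exact: le_trans zM MM'. Qed.

Lemma standardized_normal d (T : measurableType d) (P : probability T R)
    (xi : {RV P >-> R}) :
  (forall A : set R, measurable A -> distribution P xi A = N A) ->
  standardized P (mean N (fun x => x ^+ 4)) xi.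
Proof.
move=> xiN.
have mxi : measurable_fun [set: T] xi by [].
(* The library equips [R] with two measurable structures that differ only in
   their display; normal_prob lives on measurableTypeR. *)
pose xi' := @mfun_Sub _ _ T (measurableTypeR R) xi (mem_set mxi).
have transfer m : L1 N (fun x => x ^+ m) -> L1 P (fun w => xi w ^+ m) /\
    mean P (fun w => xi w ^+ m) = mean N (fun x => x ^+ m).
  move=> iN; have /measurable_EFinP mX := L1_measurable iN.
  have lawE (f : measurableTypeR R -> \bar R) :
      (\int[distribution P xi']_x f x = \int[N]_x f x)%E.
    by apply: eq_measure_integral => A mA _; exact: xiN.
  have iP : L1 P (fun w => xi w ^+ m).
    apply/integrableP; split.
      by apply/measurable_EFinP; exact: measurable_funX.
    rewrite -(@ge0_integral_distribution _ _ _ _ _ P xi'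
      (fun x => `|(x ^+ m)%:E|%E))//; last exact: measurableT_comp.
    by rewrite lawE; case/integrableP : iN.
  split => //; congr fine.
  by rewrite -(@integral_distribution _ _ _ _ _ P xi' (fun x => (x ^+ m)%:E)).
have [i4 e4] := transfer 4 (L1_normal4 R).
have [_ e2] := transfer 2 (L1_normal2 R).
have [_ e1] := transfer 1 (L1_normal1 R).
split; [by split|..].
- by rewrite -(mean_normal1 R); exact: e1.
- by rewrite e2 mean_normal2.
- by rewrite e4.
Qed.

End standard_variables.

(** * Design and noise as one independent standardized family *)

Section joint_independence.
Context (R : realType) d (T : measurableType d) (P : probability T R).
Variables (n p : nat).
Variables (X : 'I_n -> 'I_p -> {RV P >-> R}) (xi : 'I_n -> {RV P >-> R}).
Hypothesis model : regression_model X xi.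
Hypothesis X_indep : independent_design X.

(** A single family over a sum type, so that a block of variables may be a row with its noise, a
    column, or the noise together with several columns. *)
Definition joint (k : 'I_n * 'I_p + 'I_n) : T -> R :=
  match k with inl ij => X ij.1 ij.2 | inr i => xi i end.

Lemma measurable_joint k : measurable_fun [set: T] (joint k).
Proof. by case: k. Qed.

Lemma joint_indep : mutually_independent P joint.
Proof.
move=> J B mB.
(* The event is split into a design part and a noise part, written as preimages of measurable sets
   of tuples because [design_noise_indep] concerns the whole tuples. *)
pose J1 := [set ij | inl ij \in J]%SET; pose J2 := [set i | inr i \in J]%SET.
pose DA : set (design R n p) := \bigcap_(ij in [set` J1])
  ((fun x : design R n p => tnth (tnth x ij.1) ij.2) @^-1` B (inl ij)).
pose NA : set (response R n) := \bigcap_(i in [set` J2])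
  ((fun y : response R n => tnth y i) @^-1` B (inr i)).
have mDA : measurable DA.
  apply: fin_bigcap_measurable => // -[i j] /=; rewrite inE => ijJ.
  rewrite -[_ @^-1` _]setTI.
  have m2 : measurable_fun [set: design R n p] (fun x => tnth (tnth x i) j).
    apply: (@measurableT_comp _ _ _ _ _ _ (fun y : p.-tuple R => tnth y j) _
      (fun x : design R n p => tnth x i)); exact: measurable_tnth.
  by apply: m2 => //; exact: mB.
have mNA : measurable NA.
  apply: fin_bigcap_measurable => // i /=; rewrite inE => iJ.
  by rewrite -[_ @^-1` _]setTI; apply: measurable_tnth => //; exact: mB.
have -> : \bigcap_(k in [set` J]) (joint k @^-1` B k) =
    design_of X @^-1` DA `&` noise_of xi @^-1` NA.
  apply/seteqP; split=> w /=.
    move=> Jw; split=> [[i j]|i] /=; rewrite inE => kJ.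
      by rewrite /design_of /preimage /= !tnth_mktuple; exact: (Jw _ kJ).
    by rewrite /noise_of /preimage /= tnth_mktuple; exact: (Jw _ kJ).
  move=> [Dw Nw] [[i j]|i] /= kJ.
    have /= := Dw (i, j); rewrite inE => /(_ kJ).
    by rewrite /design_of /preimage /= !tnth_mktuple.
  have /= := Nw i; rewrite inE => /(_ kJ).
  by rewrite /noise_of /preimage /= tnth_mktuple.
rewrite (design_noise_indep model)//.
have -> : design_of X @^-1` DA =
    \bigcap_(ij in [set` J1]) (X ij.1 ij.2 @^-1` B (inl ij)).
  apply/seteqP; split=> w /= Dw [i j] ijJ; have := Dw (i, j) ijJ;
    by rewrite /design_of /preimage /= !tnth_mktuple.
have -> : noise_of xi @^-1` NA = \bigcap_(i in [set` J2]) (xi i @^-1` B (inr i)).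
  apply/seteqP; split=> w /= Nw i iJ; have := Nw i iJ;
    by rewrite /noise_of /preimage /= !tnth_mktuple.
rewrite (X_indep (B := fun ij => B (inl ij))); last first.
  by move=> ij; rewrite inE; exact: mB.
rewrite (noise_indep model (B := fun i => B (inr i))); last first.
  by move=> i; rewrite inE; exact: mB.
rewrite [RHS]big_sumType /=.
by congr (_ * _)%E; apply: eq_bigl => k; rewrite inE.
Qed.

Lemma design_transfer (a : R -> \bar R) i j i' j' :
  measurable_fun [set: R] a -> (forall x, 0 <= a x)%E ->
  (\int[P]_w a (X i j w) = \int[P]_w a (X i' j' w))%E.
Proof.
move=> ma a0; rewrite -[LHS](ge0_integral_distribution (X i j))//.
rewrite -[RHS](ge0_integral_distribution (X i' j'))//.
by apply: eq_measure_integral => A mA _; exact: (design_ident model).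
Qed.

(** For two distinct columns, independence and equality in law turn E (U_j U_l)^4 into (E X^4)^2; p
    > 1 supplies such a pair. The computation stays in the extended reals because finiteness of E
    X^4 is part of the conclusion. *)
Lemma standardized_design d' (T' : measurableType d') (Q : probability T' R)
    (U : 'I_p -> {RV Q >-> R}) (C : R) i j :
  same_pair_law X U -> (1 < p)%N -> (max_pair_moment4 U <= C%:E)%E ->
  standardized P (1 + `|C|) (X i j).
Proof.
move=> UX p1 UC.
pose j0 : 'I_p := Ordinal (ltnW p1); pose j1 : 'I_p := Ordinal p1.
have m4 : measurable_fun [set: R] (fun x : R => (x ^+ 4)%:E).
  by apply/measurable_EFinP; exact: measurable_funX.
have x4_ge0 (x : R) : (0 <= (x ^+ 4)%:E)%E by rewrite lee_fin exprn_even_ge0.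
pose e := (\int[P]_w (X i j w ^+ 4)%:E)%E.
have e0 : (0 <= e)%E by apply: integral_ge0.
have mpr : measurable_fun [set: R * R] (fun z : R * R => ((z.1 * z.2) ^+ 4)%:E).
  by apply/measurable_EFinP; apply: measurable_funX; exact: measurable_funM.
have pr0 (z : R * R) : (0 <= ((z.1 * z.2) ^+ 4)%:E)%E by exact: x4_ge0.
have mUU : measurable_fun [set: T'] (fun w => (U j0 w, U j1 w)).
  exact/measurable_fun_pairP.
have mXX : measurable_fun [set: T] (fun w => (X i j0 w, X i j1 w)).
  exact/measurable_fun_pairP.
pose UU : {mfun T' >-> (R * R)%type} := mfun_Sub (mem_set mUU).
pose XX : {mfun T >-> (R * R)%type} := mfun_Sub (mem_set mXX).
have eeC : (e * e <= C%:E)%E.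
  apply: le_trans UC.
  apply: (@le_trans _ _ ('E_Q[fun w => ((U j0 w * U j1 w) ^+ 4)%R])%E); last first.
    exact: (le_bigmax_cond _ (fun jl : 'I_p * 'I_p =>
      'E_Q[fun w => ((U jl.1 w * U jl.2 w) ^+ 4)%R])%E (j := (j0, j1))).
  rewrite unlock.
  rewrite -[leRHS](ge0_integral_distribution UU mpr pr0).
  rewrite (eq_measure_integral (distribution P XX)); last first.
    by move=> A mA _; exact: (UX i j0 j1).
  rewrite (ge0_integral_distribution XX mpr pr0) /=.
  under eq_integral do rewrite exprMn EFinM.
  rewrite (@ge0_integral_indep _ _ _ P (X i j0) (X i j1) _ _ _
    (fun x => (x ^+ 4)%:E) (fun x => (x ^+ 4)%:E))//.
    by rewrite (design_transfer i j0 i j m4 x4_ge0) (design_transfer i j1 i j m4 x4_ge0).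
  apply: (@depends_on_indep _ _ _ P _ joint measurable_joint joint_indep
    (finset.set1 (inl (i, j0))) (finset.set1 (inl (i, j1)))).
  - rewrite disjoint_subset; apply/fintype.subsetP => k; rewrite !inE => /eqP ->.
    by apply/eqP => -[].
  - by apply: (@depends_on_var _ _ _ _ joint _ (inl (i, j0))); rewrite inE.
  - by apply: (@depends_on_var _ _ _ _ joint _ (inl (i, j1))); rewrite inE.
(* A value above 1 + |C|, infinite or not, would have a square above C. *)
have eM : (e <= (1 + `|C|)%:E)%E.
  move: e0 eeC; case: e => [r| |]//; rewrite !lee_fin => r0 rC.
  by rewrite leNgt; apply/negP => Cr; have := ler_norm C; nra.
have i4 : L1 P (fun w => X i j w ^+ 4).
  apply: L1_ge0 => [|w|]; [exact: measurable_funX|exact: exprn_even_ge0|].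
  exact: le_lt_trans eM (ltry _).
split.
- by split.
- by have := design_mean0 model i j; rewrite unlock /mean /Rintegral => ->.
- by have := design_var1 model i j; rewrite unlock /mean /Rintegral => ->.
- by rewrite -lee_fin mean_EFin.
Qed.

End joint_independence.

(** * Moments of linear forms in the joint family *)

Section linear_forms.
Context d (T : measurableType d) (R : realType) (P : probability T R).
Variables (K : finType) (V : K -> T -> R) (M : R).
Hypothesis mV : forall i, measurable_fun [set: T] (V i).
Hypothesis V_indep : mutually_independent P V.
Hypothesis V_std : forall k, standardized P M (V k).

Local Notation B := (4 + 3 * M).

Definition form (c : K -> R) (w : T) : R := \sum_k c k * V k w.

Lemma V_L4 k : L4 P (V k). Proof. by case: (V_std k). Qed.

(** The index type is enumerated by ordinals so that the linear case applies, with singletons as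
    blocks. *)
Lemma form_expr4 c :
  L4 P (form c) /\ mean P (fun w => form c w ^+ 4) <= B * (\sum_k c k ^+ 2) ^+ 2.
Proof.
have e (F : K -> R) : \sum_k F k = \sum_(i < #|K|) F (enum_val i).
  by apply: reindex; apply: onW_bij; exact: enum_val_bij.
have bl : blocks V (fun i : 'I_#|K| => finset.set1 (enum_val i))
    (fun i => V (enum_val i)).
  split=> [i j ij|i]; last by apply: depends_on_var => //; rewrite inE.
  rewrite disjoint_subset; apply/fintype.subsetP => k; rewrite !inE => /eqP ->.
  by apply: contra ij => /eqP/enum_val_inj ->.
have [f4 _ le4] := mean_linear_expr4 mV V_indep (fun i => c (enum_val i)) bl
  (fun i => V_std (enum_val i)).
have fE : form c = fun w => \sum_(i < #|K|) c (enum_val i) * V (enum_val i) w.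
  by apply/funext => w; rewrite /form e.
by rewrite fE e.
Qed.

Lemma form_depends (A : {set K}) c : (forall k, k \notin A -> c k = 0) ->
  depends_on V A (form c).
Proof.
move=> cA; apply: depends_on_sum => k _.
have [kA|/cA c0] := boolP (k \in A).
  by apply: depends_onM; [exact: depends_on_cst|exact: depends_on_var].
by under eq_fun do rewrite c0 mul0r; exact: depends_on_cst.
Qed.

Lemma mean_product2 a b : mean P (fun w => V a w * V b w) = (a == b)%:R.
Proof.
have [a4 a1 a2 _] := V_std a; have [b4 b1 _ _] := V_std b.
have [<-|ab] := eqVneq a b.
  by under eq_mean do rewrite -expr2.
rewrite (@meanM_depends _ _ _ P _ _ mV V_indep (finset.set1 a) (finset.set1 b)).
- by rewrite a1 mul0r.
- by rewrite disjoint_subset; apply/fintype.subsetP => i; rewrite !inE => /eqP ->.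
- by apply: depends_on_var => //; rewrite inE.
- by apply: depends_on_var => //; rewrite inE.
- exact: L2_L1 (L4_L2 a4).
- exact: L2_L1 (L4_L2 b4).
Qed.

Lemma mean_formM c k : mean P (fun w => form c w * V k w) = c k.
Proof.
have i2 a : L1 P (fun w => V a w * V k w).
  by apply: L2M; apply: L4_L2; exact: V_L4.
transitivity (mean P (fun w => \sum_a c a * (V a w * V k w))).
  by apply: eq_mean => w; rewrite mulr_suml; apply: eq_bigr => a _; rewrite mulrA.
rewrite mean_sum; last by move=> a _; exact: L1Z.
rewrite (bigD1 k)//= big1 => [|a ak]; rewrite (meanZ _ (i2 _)) mean_product2.
  by rewrite eqxx mulr1 addr0.
by rewrite (negbTE ak) mulr0.
Qed.

(** Each of the two pairings in [mean_product4] contributes c_j c_l. *)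
Lemma mean_form_sqrM c j l : j != l ->
  mean P (fun w => form c w ^+ 2 * (V j w * V l w)) = 2 * (c j * c l).
Proof.
move=> jl.
have i4 a b : L1 P (fun w => V a w * V b w * (V j w * V l w)).
  by apply: L2M; apply: L4M; exact: V_L4.
transitivity (mean P (fun w => \sum_a \sum_b c a * c b *
    (V a w * V b w * (V j w * V l w)))).
  apply: eq_mean => w; rewrite expr2 /form big_distrlr mulr_suml.
  apply: eq_bigr => a _; rewrite mulr_suml; apply: eq_bigr => b _ /=.
  by ring.
rewrite mean_sum; last by move=> a _; apply: L1_sum => b _; exact: L1Z.
transitivity (\sum_a \sum_b (((a == j) && (b == l))%:R * (c a * c b) +
    ((a == l) && (b == j))%:R * (c a * c b))).
  apply: eq_bigr => a _; rewrite mean_sum; last by move=> b _; exact: L1Z.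
  apply: eq_bigr => b _; rewrite (meanZ _ (i4 _ _)) (mean_product4 mV V_indep V_std)//.
  by ring.
have pick i i' : \sum_a \sum_b ((a == i) && (b == i'))%:R * (c a * c b) = c i * c i'.
  rewrite (bigD1 i)//= [X in _ + X]big1 ?addr0; last first.
    by move=> a ai; apply: big1 => b _; rewrite (negbTE ai) mul0r.
  rewrite (bigD1 i')//= big1 ?addr0 ?eqxx ?mul1r//.
  by move=> b bi; rewrite (negbTE bi) mul0r.
under eq_bigr do rewrite big_split /=.
by rewrite big_split /= !pick; ring.
Qed.

(** A weighted substitute for Cauchy-Schwarz, (f g)^2 <= (b/a) f^4 / 2 + (a/b) g^4 / 2, with weights
    that give both terms the same bound. *)
Lemma mean_sqrM_le (f g : T -> R) (C a b : R) : 0 < a -> 0 < b ->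
  L4 P f -> L4 P g -> mean P (fun w => f w ^+ 4) <= C * a ^+ 2 ->
  mean P (fun w => g w ^+ 4) <= C * b ^+ 2 ->
  mean P (fun w => (f w * g w) ^+ 2) <= C * (a * b).
Proof.
move=> a0 b0 f4 g4 fC gC; have [_ i2] := L4M f4 g4.
have k1 := L1Z (b / a / 2) f4.2; have k2 := L1Z (a / b / 2) g4.2.
apply: le_trans (le_mean i2 (L1D k1 k2) _) _.
  move=> w; move: (f w) (g w) => x y; rewrite -subr_ge0.
  rewrite (_ : _ - _ = (a * b)^-1 / 2 * (b * x ^+ 2 - a * y ^+ 2) ^+ 2); last first.
    by field; rewrite !gt_eqF.
  by rewrite mulr_ge0 ?sqr_ge0// divr_ge0// invr_ge0 mulr_ge0// ltW.
rewrite (meanD k1 k2) (meanZ _ f4.2) (meanZ _ g4.2).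
have h1 : b / a / 2 * mean P (fun w => f w ^+ 4) <= b / a / 2 * (C * a ^+ 2).
  by apply: ler_wpM2l fC; rewrite !divr_ge0// ltW.
have h2 : a / b / 2 * mean P (fun w => g w ^+ 4) <= a / b / 2 * (C * b ^+ 2).
  by apply: ler_wpM2l gC; rewrite !divr_ge0// ltW.
apply: le_trans (lerD h1 h2) _; rewrite le_eqVlt; apply/orP; left; apply/eqP.
by field; rewrite !gt_eqF.
Qed.

End linear_forms.

(** * The unnormalised statistic under a nonzero parameter *)

Section regression_ustat.
Context d (T : measurableType d) (R : realType) (P : probability T R).
Variables (n p : nat) (M : R).
Let K : finType := ('I_n * 'I_p + 'I_n)%type.
Variable V : K -> T -> R.
Hypothesis mV : forall i, measurable_fun [set: T] (V i).
Hypothesis V_indep : mutually_independent P V.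
Hypothesis V_std : forall k, standardized P M (V k).
Variable th : 'I_p -> R.

Local Notation B := (4 + 3 * M).
Let tau2 : R := \sum_j th j ^+ 2.
Hypothesis tau2_gt0 : 0 < tau2.

(** The signal and the response of row [i] as linear forms in all variables; the squared
    coefficients sum to ||theta||^2 and 1 + ||theta||^2 respectively. *)
Let design_coef (i : 'I_n) (k : K) : R :=
  match k with inl ij => if ij.1 == i then th ij.2 else 0 | inr _ => 0 end.
Let resp_coef (i : 'I_n) (k : K) : R :=
  match k with inl ij => if ij.1 == i then th ij.2 else 0 | inr s => (s == i)%:R end.
Let row (i : 'I_n) : {set K} :=
  [set k | match k with inl ij => ij.1 == i | inr s => s == i end]%SET.

Definition resp (i : 'I_n) (w : T) : R :=
  \sum_j th j * V (inl (i, j)) w + V (inr i) w.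

Let sum_row (F : 'I_n -> 'I_p -> R) i :
  \sum_(ij : 'I_n * 'I_p) (if ij.1 == i then F ij.1 ij.2 else 0) = \sum_j F i j.
Proof.
rewrite -(pair_bigA _ (fun s j => if s == i then F s j else 0)) /=.
rewrite (bigD1 i)//= [X in _ + X]big1 ?addr0; last first.
  by move=> s si; apply: big1 => j _; rewrite (negbTE si).
by rewrite eqxx.
Qed.

Let respE i w : resp i w = form V (resp_coef i) w.
Proof.
rewrite /form big_sumType /= /resp; congr (_ + _).
  rewrite -(sum_row (fun s j => th j * V (inl (s, j)) w)).
  by apply: eq_bigr => -[s j] _ /=; case: ifP; rewrite ?mul0r.
rewrite (bigD1 i)//= big1 ?addr0 ?eqxx ?mul1r//.
by move=> s si; rewrite (negbTE si) mul0r.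
Qed.

Let designE i w : \sum_j th j * V (inl (i, j)) w = form V (design_coef i) w.
Proof.
rewrite /form big_sumType /= [X in _ = _ + X]big1 ?addr0; last first.
  by move=> s _; rewrite mul0r.
rewrite -(sum_row (fun s j => th j * V (inl (s, j)) w)).
by apply: eq_bigr => -[s j] _ /=; case: ifP; rewrite ?mul0r.
Qed.

Let resp_coef2 i : \sum_k resp_coef i k ^+ 2 = 1 + tau2.
Proof.
rewrite big_sumType /= addrC; congr (_ + _).
  rewrite (bigD1 i)//= big1 ?addr0 ?eqxx ?expr1n//.
  by move=> s si; rewrite (negbTE si) expr0n.
rewrite /tau2 -(sum_row (fun s j => th j ^+ 2) i).
by apply: eq_bigr => -[s j] _ /=; case: ifP; rewrite ?expr0n.
Qed.

Let design_coef2 i : \sum_k design_coef i k ^+ 2 = tau2.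
Proof.
rewrite big_sumType /= [X in _ + X]big1 ?addr0; last by move=> s _; rewrite expr0n.
rewrite /tau2 -(sum_row (fun s j => th j ^+ 2) i).
by apply: eq_bigr => -[s j] _ /=; case: ifP; rewrite ?expr0n.
Qed.

Let D i j w := resp i w * V (inl (i, j)) w - th j.

Let row_disjoint i s : i != s -> [disjoint row i & row s]%B.
Proof.
move=> si; rewrite disjoint_subset; apply/fintype.subsetP => -[[a b]|a] /=;
  by rewrite !inE /= => /eqP ->.
Qed.

Let resp_L4 i : L4 P (resp i).
Proof.
rewrite (_ : resp i = form V (resp_coef i)); last by apply/funext => w.
by have [] := form_expr4 mV V_indep V_std (resp_coef i).
Qed.

Let V4 k : L4 P (V k) := V_L4 V_std k.

Let D_dep i j : depends_on V (row i) (D i j).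
Proof.
apply: depends_onB; last exact: depends_on_cst.
apply: depends_onM; last by apply: depends_on_var => //; rewrite inE /=.
rewrite (_ : resp i = form V (resp_coef i)); last by apply/funext => w.
apply: form_depends => // -[[a b]|a]; rewrite !inE /= => /negbTE -> //.
Qed.

Let D_L2 i j : L2 P (D i j).
Proof.
rewrite (_ : D i j = fun w => resp i w * V (inl (i, j)) w + (- th j))//.
by apply: L2D; [exact: L4M|exact: L2_cst].
Qed.

Let resp_mean i j : mean P (fun w => resp i w * V (inl (i, j)) w) = th j.
Proof.
under eq_mean do rewrite respE.
by rewrite (mean_formM mV V_indep V_std) /= eqxx.
Qed.

Let D_mean i j : mean P (D i j) = 0.
Proof.
rewrite /D meanB; [|exact: L2_L1 (L4M _ _)|exact: L1_cst].
by rewrite resp_mean mean_cst subrr.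
Qed.

Let resp4 i : mean P (fun w => resp i w ^+ 4) <= B * (1 + tau2) ^+ 2.
Proof.
under eq_mean do rewrite respE.
by rewrite -(resp_coef2 i); exact: (form_expr4 mV V_indep V_std (resp_coef i)).2.
Qed.

(** The sum is Y_i S_i - ||theta||^2, with S_i the signal of row [i]; the fourth moments of these
    two linear forms control E (Y_i S_i)^2. *)
Let lin_le i : mean P (fun w => (\sum_j th j * D i j w) ^+ 2) <=
  2 * (B * ((1 + tau2) * tau2)) + 2 * tau2 ^+ 2.
Proof.
pose S w := \sum_j th j * V (inl (i, j)) w.
have [S4 leS] : L4 P S /\ mean P (fun w => S w ^+ 4) <= B * tau2 ^+ 2.
  have [f4 lef] := form_expr4 mV V_indep V_std (design_coef i).
  rewrite (_ : S = form V (design_coef i)); last by apply/funext => w; exact: designE.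
  by rewrite -(design_coef2 i).
have t1 : 0 < 1 + tau2 by rewrite addr_gt0.
have := mean_sqrM_le t1 tau2_gt0 (resp_L4 i) S4 (resp4 i) leS.
have [_ iRS] := L4M (resp_L4 i) S4 => leRS.
have linE w : \sum_j th j * D i j w = resp i w * S w - tau2.
  rewrite /S mulr_sumr /tau2 -sumrB; apply: eq_bigr => j _.
  by rewrite /D; ring.
have k1 := L1Z 2 iRS; have k2 := L1_cst P (2 * tau2 ^+ 2).
have iD : L2 P (fun w => \sum_j th j * D i j w).
  by apply: L2_sum => j _; exact: L2Z.
apply: le_trans (le_mean iD.2 (L1D k1 k2) _) _.
  move=> w; rewrite linE; move: (resp i w * S w) => x.
  rewrite -subr_ge0 (_ : _ - _ = (x + tau2) ^+ 2); last by ring.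
  exact: sqr_ge0.
rewrite (meanD k1 k2) (meanZ _ iRS) mean_cst lerD2r.
exact: ler_wpM2l leRS.
Qed.

(** Off the diagonal the covariance is exactly th_j th_l, since E Y_i^2 X_ij X_il = 2 th_j th_l; on
    the diagonal it is at most E Y_i^2 X_ij^2. *)
Let cov j l : R := if j == l then B * (1 + tau2) else `|th j * th l|.

Let cov_le i j l : `|mean P (fun w => D i j w * D i l w)| <= cov j l.
Proof.
have iRj j' := L4M (resp_L4 i) (V4 (inl (i, j'))).
have k0 := L2M (iRj j) (iRj l).
have k1 := L1Z (th l) (L2_L1 (iRj j)); have k2 := L1Z (th j) (L2_L1 (iRj l)).
have k01 := L1B k0 k1; have k012 := L1B k01 k2.
have -> : mean P (fun w => D i j w * D i l w) =
    mean P (fun w => (resp i w * V (inl (i, j)) w) * (resp i w * V (inl (i, l)) w))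
    - th j * th l.
  transitivity (mean P (fun w =>
    (resp i w * V (inl (i, j)) w) * (resp i w * V (inl (i, l)) w)
    - th l * (resp i w * V (inl (i, j)) w) - th j * (resp i w * V (inl (i, l)) w)
    + th j * th l)).
    by apply: eq_mean => w; rewrite /D; ring.
  rewrite (meanD k012 (L1_cst P _)) (meanB k01 k2) (meanB k0 k1).
  rewrite (meanZ _ (L2_L1 (iRj j))) (meanZ _ (L2_L1 (iRj l))) !resp_mean mean_cst.
  by ring.
rewrite /cov; have [<-|jl] := eqVneq j l; last first.
  rewrite (_ : mean _ _ = 2 * (th j * th l)).
    by rewrite (_ : _ - _ = th j * th l)//; ring.
  have jl' : inl (i, j) != inl (i, l) :> K by apply: contra jl => /eqP[->].
  transitivity (mean P (fun w => form V (resp_coef i) w ^+ 2 *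
      (V (inl (i, j)) w * V (inl (i, l)) w))).
    by apply: eq_mean => w; rewrite -respE; ring.
  by rewrite (mean_form_sqrM mV V_indep V_std _ jl') /= eqxx.
have M1 := standardized_M_ge1 (V_std (inr i)).
have V4M : mean P (fun w => V (inl (i, j)) w ^+ 4) <= B * 1 ^+ 2.
  by have [_ _ _ /le_trans -> //] := V_std (inl (i, j)); lra.
have t1 : 0 < 1 + tau2 by rewrite addr_gt0.
have := mean_sqrM_le t1 ltr01 (resp_L4 i) (V4 (inl (i, j))) (resp4 i) V4M.
rewrite mulr1; under eq_mean do rewrite expr2; set m := mean _ _ => mle.
have : th j * th j <= m.
  rewrite -(resp_mean i j) -expr2 /m; under [leRHS]eq_mean do rewrite -expr2.
  by apply: sqr_mean_le; [exact: L2_L1 (iRj j)|exact: (iRj j).2].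
have := sqr_ge0 (th j); rewrite expr2 => ? ?.
by rewrite ler_norml; apply/andP; split; lra.
Qed.

Let cov_sum : \sum_j \sum_l cov j l ^+ 2 <=
  tau2 ^+ 2 + p%:R * (B * (1 + tau2)) ^+ 2.
Proof.
have le1 j l : cov j l ^+ 2 <=
    th j ^+ 2 * th l ^+ 2 + (if l == j then (B * (1 + tau2)) ^+ 2 else 0).
  rewrite /cov (eq_sym l); case: eqVneq => [_|_].
    by rewrite lerDr mulr_ge0// sqr_ge0.
  by rewrite addr0 real_normK ?num_real// exprMn.
have : \sum_j \sum_l cov j l ^+ 2 <= \sum_j \sum_l (th j ^+ 2 * th l ^+ 2 +
    (if l == j then (B * (1 + tau2)) ^+ 2 else 0)).
  by apply: ler_sum => j _; apply: ler_sum => l _; exact: le1.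
move=> /le_trans; apply.
under eq_bigr do rewrite big_split /= -big_mkcond /= big_pred1_eq -mulr_sumr.
rewrite big_split /= -mulr_suml sumr_const card_ord -expr2 -[_ *+ p]mulr_natl.
exact: lexx.
Qed.

Let N : R := n%:R * (n%:R - 1) / 2.

Definition regression_ustat w : R :=
  pair_sum (fun i s => \sum_j
    (resp i w * V (inl (i, j)) w) * (resp s w * V (inl (s, j)) w)).

Lemma regression_ustat_variance :
  L2 P (fun w => regression_ustat w - N * tau2) /\
  mean P (fun w => (regression_ustat w - N * tau2) ^+ 2) <=
  2 * ((n%:R - 1) ^+ 2 *
    (n%:R * (2 * (B * ((1 + tau2) * tau2)) + 2 * tau2 ^+ 2))) +
  2 * (N * (tau2 ^+ 2 + p%:R * (B * (1 + tau2)) ^+ 2)).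
Proof.
have E w : regression_ustat w = ustat D th w.
  apply: eq_pair_sum => i s; apply: eq_bigr => j _.
  by rewrite /D !subrKC.
have N0 : 0 <= N.
  rewrite /N; case: (n) => [|m]; first by rewrite !mul0r.
  by rewrite -natr1 addrK divr_ge0// mulr_ge0// -natr1 ?addr_ge0.
split.
  under eq_fun do rewrite E.
  exact: (ustat_L2 mV V_indep th (@row_disjoint) (@D_dep) (@D_L2)).
under eq_mean do rewrite E.
apply: le_trans (@ustat_variance _ _ _ _ _ _ mV V_indep _ _ _ _ th _ _
  (@row_disjoint) (@D_dep) (@D_L2) D_mean lin_le cov_le) _.
rewrite lerD2l; apply: ler_wpM2l => //; exact: ler_wpM2l N0 _ _ cov_sum.
Qed.

End regression_ustat.

(** * Column statistics and the central limit bound under the null *)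

Section null_distribution.
Context d (T : measurableType d) (R : realType) (P : probability T R).
Variables (n p : nat) (M : R).
Let K : finType := ('I_n * 'I_p + 'I_n)%type.
Variable V : K -> T -> R.
Hypothesis mV : forall i, measurable_fun [set: T] (V i).
Hypothesis V_indep : mutually_independent P V.
Hypothesis V_std : forall k, standardized P M (V k).
Hypothesis n_gt1 : (1 < n)%N.
Hypothesis p_gt0 : (0 < p)%N.

Let N : R := n%:R * (n%:R - 1) / 2.
Let rho : R := (Num.sqrt p%:R)^-1.
Let c0 : R := (Num.sqrt N)^-1 * rho.
Let X i j := V (inl (i, j)).
Let xi i := V (inr i).

Let n2 : 2 <= n%:R :> R. Proof. by rewrite ler_nat. Qed.
Let p0 : 0 < p%:R :> R. Proof. by rewrite ltr0n. Qed.
Let rho0 : 0 < rho. Proof. by rewrite invr_gt0 sqrtr_gt0. Qed.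
Let rho2 : rho ^+ 2 = p%:R^-1. Proof. by rewrite exprVn sqr_sqrtr. Qed.
Let N_ge : n%:R ^+ 2 / 4 <= N. Proof. by rewrite /N; have := n2; move: n%:R => x; nra. Qed.
Let N0 : 0 < N. Proof. by have := n2; have := N_ge; move: N => y; move: n%:R => x; nra. Qed.
Let c02 : c0 ^+ 2 = N^-1 * rho ^+ 2.
Proof. by rewrite exprMn exprVn sqr_sqrtr// ltW. Qed.
Let M1 : 1 <= M.
Proof. exact: standardized_M_ge1 (V_std (inr (Ordinal n_gt1))). Qed.
Let V4 k : L4 P (V k) := V_L4 V_std k.

Definition column_stat (j : 'I_p) (w : T) : R :=
  c0 * pair_sum (fun i s => (xi i w * X i j w) * (xi s w * X s j w)).

Definition noise_variance (w : T) : R :=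
  N^-1 * pair_sum (fun i s => xi i w ^+ 2 * xi s w ^+ 2).

Let column j := [set k : K | if k is inl ij then ij.2 == j else false]%SET.
(** The past at column [m]: the noise and all earlier columns. *)
Let below (m : nat) :=
  [set k : K | if k is inl ij then (ij.2 < m)%N else true]%SET.

Let xi_dep i m : depends_on V (below m) (xi i).
Proof. by apply: depends_on_var => //; rewrite inE. Qed.

Let X_dep i j : depends_on V (column j) (X i j).
Proof. by apply: depends_on_var => //; rewrite inE /=. Qed.

Let column_below (j : 'I_p) : [disjoint below j & column j]%B.
Proof.
rewrite disjoint_subset; apply/fintype.subsetP => -[[i l]|i]; rewrite !inE //=.
by move=> lj; apply/eqP => lj'; rewrite lj' ltnn in lj.
Qed.

Let column_stat_dep (j : 'I_p) m : (j < m)%N -> depends_on V (below m) (column_stat j).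
Proof.
move=> jm; apply: depends_onM; first exact: depends_on_cst.
have dX i : depends_on V (below m) (X i j).
  by apply: depends_on_var => //; rewrite inE /=.
apply: depends_on_sum => i _; apply: depends_on_sum => s _.
apply: depends_onM; apply: depends_onM; [exact: xi_dep|exact: dX|exact: xi_dep|].
exact: dX.
Qed.

Let column_statE j w : column_stat j w = c0 *
  \sum_(q : 'I_n * 'I_n | (q.1 < q.2)%N)
    (xi q.1 w * xi q.2 w) * (X q.1 j w * X q.2 j w).
Proof.
congr (_ * _); rewrite pair_sumE; apply: eq_bigr => q _.
by rewrite mulrACA.
Qed.

Let xi2_L2 i s : L2 P (fun w => xi i w * xi s w).
Proof. by apply: L4M; exact: V4. Qed.

Let X2_L2 i s j : L2 P (fun w => X i j w * X s j w).
Proof. by apply: L4M; exact: V4. Qed.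

(** Column [j] is independent of the past, and X_ij X_sj is centred for i < s. *)
Let column_centered (j : 'I_p) (g : T -> R) (C : R) :
  depends_on V (below j) g -> (forall w, `|g w| <= C) ->
  mean P (fun w => g w * column_stat j w) = 0.
Proof.
move=> gj gC; have mg := depends_on_measurable mV gj.
have i1 (q : 'I_n * 'I_n) := L1_boundedM mg gC (L2_L1 (xi2_L2 q.1 q.2)).
have d1 (q : 'I_n * 'I_n) : depends_on V (below j) (fun w => g w * (xi q.1 w * xi q.2 w)).
  by apply: depends_onM => //; apply: depends_onM; exact: xi_dep.
have d2 (q : 'I_n * 'I_n) : depends_on V (column j) (fun w => X q.1 j w * X q.2 j w).
  by apply: depends_onM; exact: X_dep.
have i2 q := L1M_depends mV V_indep (column_below j) (@d1 q) (@d2 q) (i1 q)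
  (L2_L1 (X2_L2 q.1 q.2 j)).
transitivity (mean P (fun w => c0 * \sum_(q : 'I_n * 'I_n | (q.1 < q.2)%N)
    (g w * (xi q.1 w * xi q.2 w)) * (X q.1 j w * X q.2 j w))).
  apply: eq_mean => w; rewrite column_statE mulrCA mulr_sumr; congr (_ * _).
  by apply: eq_bigr => q _; ring.
rewrite meanZ; last by apply: L1_sum => q _; exact: i2.
rewrite mean_sum; last by move=> q _; exact: i2.
rewrite big1 ?mulr0// => q q12.
rewrite (meanM_depends mV V_indep (column_below j) (@d1 q) (@d2 q) (i1 q)
  (L2_L1 (X2_L2 q.1 q.2 j))) (mean_product2 mV V_indep V_std).
rewrite (_ : (_ == _) = false) ?mulr0//; apply/eqP => -[q12'].
by rewrite q12' ltnn in q12.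
Qed.

(** The products X_ij X_sj over distinct pairs are uncorrelated with second moment 1, so only the
    diagonal of the double sum over pairs survives; the scale is c0^2 = 1 / (N p). *)
Let column_variance (j : 'I_p) (g : T -> R) (C : R) :
  depends_on V (below j) g -> (forall w, `|g w| <= C) ->
  mean P (fun w => g w * column_stat j w ^+ 2) =
  p%:R^-1 * mean P (fun w => g w * noise_variance w).
Proof.
move=> gj gC; have mg := depends_on_measurable mV gj.
pose xx (q : 'I_n * 'I_n) w := xi q.1 w * xi q.2 w.
pose XX (q : 'I_n * 'I_n) w := X q.1 j w * X q.2 j w.
have i1 q q' : L1 P (fun w => g w * (xx q w * xx q' w)).
  by apply: (L1_boundedM mg gC); exact: L2M (xi2_L2 _ _) (xi2_L2 _ _).
have iX q q' : L1 P (fun w => XX q w * XX q' w) by exact: L2M (X2_L2 _ _ _) (X2_L2 _ _ _).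
have d1 q q' : depends_on V (below j) (fun w => g w * (xx q w * xx q' w)).
  by apply: depends_onM => //; apply: depends_onM; apply: depends_onM; exact: xi_dep.
have d2 q q' : depends_on V (column j) (fun w => XX q w * XX q' w).
  by apply: depends_onM; apply: depends_onM; exact: X_dep.
have i2 q q' := L1M_depends mV V_indep (column_below j) (@d1 q q') (@d2 q q')
  (i1 q q') (iX q q').
transitivity (mean P (fun w => c0 ^+ 2 * \sum_(q : 'I_n * 'I_n | (q.1 < q.2)%N)
    \sum_(q' : 'I_n * 'I_n | (q'.1 < q'.2)%N)
    (g w * (xx q w * xx q' w)) * (XX q w * XX q' w))).
  apply: eq_mean => w; rewrite column_statE exprMn mulrCA; congr (_ * _).
  rewrite expr2 big_distrlr mulr_sumr; apply: eq_bigr => q _.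
  by rewrite mulr_sumr; apply: eq_bigr => q' _ /=; rewrite /xx /XX; ring.
rewrite meanZ; last by apply: L1_sum => q _; apply: L1_sum => q' _; exact: i2.
rewrite mean_sum; last by move=> q _; apply: L1_sum => q' _; exact: i2.
transitivity (c0 ^+ 2 * \sum_(q : 'I_n * 'I_n | (q.1 < q.2)%N)
    mean P (fun w => g w * (xx q w * xx q w))).
  congr (_ * _); apply: eq_bigr => q q12.
  rewrite mean_sum; last by move=> q' _; exact: i2.
  have term (q' : 'I_n * 'I_n) : (q'.1 < q'.2)%N ->
      mean P (fun w => g w * (xx q w * xx q' w) * (XX q w * XX q' w)) =
      (q == q')%:R * mean P (fun w => g w * (xx q w * xx q' w)).
    move=> q12'; rewrite (meanM_depends mV V_indep (column_below j) (@d1 q q')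
      (@d2 q q') (i1 q q') (iX q q')) mulrC; congr (_ * _).
    have ne : inl (q'.1, j) != inl (q'.2, j) :> K.
      by apply/eqP => -[e]; rewrite e ltnn in q12'.
    rewrite /XX /X (@mean_product4 _ _ _ _ _ _ mV V_indep _ V_std _ _ _ _ ne).
    (* The pairing that exchanges the two indices is impossible for increasing pairs. *)
    rewrite (_ : (inl (q.1, j) == inl (q'.2, j) :> K) && _ = false).
      rewrite addr0; congr (_%:R); congr (nat_of_bool _).
      case: q q' {q12 q12' ne} => [a b] [a' b'] /=.
      by rewrite -!pair_eqE /= /eq_op /= /eq_op /= !eqxx !andbT.
    apply/negbTE/negP => /andP[/eqP[e1] /eqP[e2]].
    by move: q12'; rewrite -e1 -e2 ltnNge ltnW.
  rewrite (bigD1 q)//= (term q q12) eqxx mul1r big1 ?addr0//.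
  by move=> q' /andP[q12' q'q]; rewrite (term q' q12') eq_sym (negbTE q'q) mul0r.
rewrite c02 rho2 [N^-1 * _]mulrC -mulrA; congr (_ * _).
have iv : L1 P (fun w => g w * pair_sum (fun i s => xi i w ^+ 2 * xi s w ^+ 2)).
  apply: (L1_boundedM mg gC); apply: L1_sum => i _; apply: L1_sum => s _.
  by under eq_fun do rewrite -exprMn; exact: (xi2_L2 i s).2.
transitivity (N^-1 * mean P (fun w => g w * pair_sum (fun i s => xi i w ^+ 2 * xi s w ^+ 2))).
  congr (_ * _); rewrite -mean_sum; last by move=> q _; exact: i1.
  apply: eq_mean => w; rewrite pair_sumE mulr_sumr; apply: eq_bigr => q _.
  by rewrite /xx; ring.
by rewrite -(meanZ _ iv); apply: eq_mean => w; rewrite /noise_variance; ring.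
Qed.

Let noise_L1 : L1 P noise_variance.
Proof.
apply: L1Z; apply: L1_sum => i _; apply: L1_sum => s _.
by under eq_fun do rewrite -exprMn; exact: (xi2_L2 i s).2.
Qed.

Let noise_mean : mean P noise_variance = 1.
Proof.
have i2 i s : L1 P (fun w => xi i w ^+ 2 * xi s w ^+ 2).
  by under eq_fun do rewrite -exprMn; exact: (xi2_L2 i s).2.
rewrite /noise_variance meanZ; last by apply: L1_sum => i _; exact: L1_sum.
rewrite mean_sum; last by move=> i _; exact: L1_sum.
rewrite -[RHS](mulVf (lt0r_neq0 N0)); congr (_ * _).
rewrite /N -[RHS]mulr1 -pair_sum_cst; apply: eq_bigr => i _.
rewrite mean_sum//; apply: eq_bigr => s lis.
apply: (mean_square_product mV V_indep V_std).
by apply/eqP => -[e]; rewrite e ltnn in lis.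
Qed.

(** The noise variance is a normalised U-statistic with one column, th = 1 and D = xi^2 - 1. Its
    variance is O(1/n), and Jensen passes to the absolute value. *)
Let noise_near1 : mean P (fun w => `|noise_variance w - 1|) <= 4 * M / Num.sqrt n%:R.
Proof.
pose D (i : 'I_n) (_ : 'I_1) (w : T) := xi i w ^+ 2 - 1.
have i4 i := (V4 (inr i)).2; have i2 i := (L4_L2 (V4 (inr i))).2.
have DL2 i j : L2 P (D i j).
  split.
    apply: measurable_funB; last exact: measurable_cst.
    by apply: measurable_funX; exact: mV.
  have k1 := L1Z 2 (i2 i); have k2 := L1B (i4 i) k1.
  rewrite (_ : (fun w => D i j w ^+ 2) = fun w => xi i w ^+ 4 - 2 * xi i w ^+ 2 + 1).
    exact: L1D k2 (L1_cst P 1).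
  by apply/funext => w; rewrite /D; ring.
have D0 i j : mean P (D i j) = 0.
  rewrite /D (meanB (i2 i) (L1_cst P 1)) mean_cst.
  by have [_ _ -> _] := V_std (inr i); rewrite subrr.
have D2 i j l : mean P (fun w => D i j w * D i l w) <= M.
  have k1 := L1Z 2 (i2 i); have k2 := L1B (i4 i) k1.
  rewrite (_ : mean _ _ = mean P (fun w => xi i w ^+ 4 - 2 * xi i w ^+ 2 + 1)).
    rewrite (meanD k2 (L1_cst P 1)) (meanB (i4 i) k1) (meanZ _ (i2 i)) mean_cst.
    by have [_ _ -> xiM] := V_std (inr i); rewrite /xi; lra.
  by apply: eq_mean => w; rewrite /D; ring.
pose A (i : 'I_n) : {set K} := finset.set1 (inr i).
have dA i s : i != s -> [disjoint A i & A s]%B.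
  move=> si; rewrite disjoint_subset; apply/fintype.subsetP => k; rewrite !inE.
  by move=> /eqP ->; apply: contra si => /eqP[->].
have D_dep i j : depends_on V (A i) (D i j).
  apply: depends_onB; last exact: depends_on_cst.
  by apply: depends_onX; apply: depends_on_var => //; rewrite inE.
have lin_le i : mean P (fun w => (\sum_(j < 1) 1 * D i j w) ^+ 2) <= M.
  by under eq_mean do rewrite big_ord1 mul1r expr2; exact: D2.
have cov_le i j l : `|mean P (fun w => D i j w * D i l w)| <= M.
  rewrite ger0_norm; first exact: D2.
  by apply: mean_ge0 => w; rewrite -expr2 sqr_ge0.
have := @ustat_variance _ _ _ _ _ _ mV V_indep n 1 A D (fun=> 1) M (fun _ _ => M)
  dA D_dep DL2 D0 lin_le cov_le.
have uL2 := @ustat_L2 _ _ _ _ _ _ mV V_indep n 1 A D (fun=> 1) dA D_dep DL2.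
rewrite !big_ord1 expr1n mulr1 -/N in uL2 *.
have uE w : ustat D (fun=> 1) w - N = N * (noise_variance w - 1).
  rewrite /noise_variance mulrBr mulr1 mulrA mulfV ?gt_eqF// mul1r; congr (_ - _).
  by apply: eq_pair_sum => i s; rewrite big_ord1 /D !subrKC.
have iv : L1 P (fun w => noise_variance w - 1) := L1B noise_L1 (L1_cst P 1).
have iv2 : L1 P (fun w => (noise_variance w - 1) ^+ 2).
  have := L1Z (N ^- 2) uL2.2; congr (is_true (L1 P _)); apply/funext => w.
  by rewrite uE [(N * _) ^+ 2]exprMn mulKf// expf_neq0// gt_eqF.
under eq_mean do rewrite uE exprMn.
rewrite (meanZ _ iv2) => le2.
(* The numerator is at most 2 (n - 1)^2 n M + 2 N M^2; division by N^2 with M >= 1 and n >= 2 leaves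
   16 M^2 / n. *)
have {le2} le2 : mean P (fun w => (noise_variance w - 1) ^+ 2) <= (4 * M) ^+ 2 / n%:R.
  have n0 : 0 < n%:R :> R by have := n2; move: n%:R => x; lra.
  rewrite -(@ler_pM2l _ (N ^+ 2)) ?exprn_gt0//; apply: le_trans le2 _.
  rewrite [leRHS]mulrA ler_pdivlMr// /N; have := n2; have := M1; move: n%:R => x m1 x2.
  rewrite -subr_ge0 (_ : _ - _ = x ^+ 2 * (x - 1) * M * ((4 * x - 4) * M - 2 * (x - 1) - M));
    last by field.
  have x0 : 0 <= x by lra.
  rewrite !mulr_ge0 ?sqr_ge0//; nra.
have sqrE : (fun w => `|noise_variance w - 1| ^+ 2) =
    fun w => (noise_variance w - 1) ^+ 2.
  by apply/funext => w; rewrite real_normK ?num_real.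
have := @sqr_mean_le _ _ _ P _ (L1_norm iv); rewrite sqrE.
move=> /(_ iv2)/le_trans/(_ le2); set m := mean _ _ => hm.
have m0 : 0 <= m by apply: mean_ge0.
have b0 : 0 <= 4 * M / Num.sqrt n%:R.
  by rewrite divr_ge0 ?sqrtr_ge0// mulr_ge0//; have := M1; lra.
rewrite -(@ler_pXn2r _ 2)// ?nnegrE//; apply: le_trans hm _.
by rewrite expr_div_n sqr_sqrtr.
Qed.

(** Comes from |w|^3 <= w^4 / (2 rho) + rho w^2 / 2 with E w^4 <= 16 quad4(M^2) rho^4 and E w^2 =
    rho^2. *)
Definition cube_const : R := 8 * quad4 (M ^+ 2) + 1 / 2.

(** A column statistic is a multiple of the quadratic form in the variables xi_i X_ij, which are
    standardized with fourth moment at most M^2. The 16 bounds n^4 / N^2, as N >= n^2 / 4. *)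
Let column_L4 (j : 'I_p) : L4 P (column_stat j) /\
  mean P (fun w => column_stat j w ^+ 4) <= 16 * quad4 (M ^+ 2) * rho ^+ 4.
Proof.
pose Z i w := xi i w * X i j w.
pose A (i : 'I_n) : {set K} := [set k | (k == inr i) || (k == inl (i, j))]%SET.
have sx i : [disjoint finset.set1 (inr i) & finset.set1 (inl (i, j) : K)]%B.
  by rewrite disjoint_subset; apply/fintype.subsetP => k; rewrite !inE => /eqP ->.
have dxi i : depends_on V (finset.set1 (inr i)) (xi i).
  by apply: depends_on_var => //; rewrite inE.
have dX i : depends_on V (finset.set1 (inl (i, j) : K)) (X i j).
  by apply: depends_on_var => //; rewrite inE.
have st i : standardized P (M ^+ 2) (Z i).
  have [x4 x1 x2 xM] := V_std (inr i); have [y4 y1 y2 yM] := V_std (inl (i, j)).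
  have d2xi := depends_onX 2 (dxi i); have d2X := depends_onX 2 (dX i).
  have d4xi := depends_onX 4 (dxi i); have d4X := depends_onX 4 (dX i).
  have i4 := L1M_depends mV V_indep (sx i) d4xi d4X x4.2 y4.2.
  split.
  - split; first by have [] := L4M x4 y4.
    by under eq_fun do rewrite /Z exprMn.
  - rewrite (meanM_depends mV V_indep (sx i) (dxi i) (dX i) (L2_L1 (L4_L2 x4))
      (L2_L1 (L4_L2 y4))) [mean P (xi i)]x1.
    by rewrite mul0r.
  - under eq_mean do rewrite /Z exprMn.
    rewrite (meanM_depends mV V_indep (sx i) d2xi d2X (L4_L2 x4).2 (L4_L2 y4).2).
    by rewrite [X in X * _]x2 [X in _ * X]y2 mulr1.
  - under eq_mean do rewrite /Z exprMn.
    rewrite (meanM_depends mV V_indep (sx i) d4xi d4X x4.2 y4.2) expr2.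
    by apply: ler_pM => //; apply: mean_ge0 => w; exact: exprn_even_ge0.
have bl : blocks V A Z.
  split=> [i s si|i].
    rewrite disjoint_subset; apply/fintype.subsetP => k; rewrite !inE.
    move=> /orP[] /eqP ->; rewrite negb_or; apply/andP; split => //;
      by apply: contra si => /eqP[->].
  by apply: depends_onM; apply: depends_on_var => //; rewrite !inE eqxx ?orbT.
have [q4 qle] := mean_quadratic_expr4 mV V_indep bl st.
split; first exact: L4Z.
under eq_mean do rewrite exprMn.
rewrite (meanZ _ q4.2).
have c4 : 0 <= c0 ^+ 4 by exact: exprn_even_ge0.
apply: le_trans (ler_wpM2l c4 qle) _.
have Q0 : 0 <= quad4 (M ^+ 2).
  by have := sqr_ge0 M; rewrite /quad4; move: (M ^+ 2) => x x0; rewrite mulr_ge0//; lra.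
rewrite [c0 ^+ 4](exprM c0 2 2) c02 exprMn -exprM.
rewrite (_ : _ * (quad4 _ * _) =
  quad4 (M ^+ 2) * rho ^+ 4 * (N^-1 ^+ 2 * n%:R ^+ 4)); last by ring.
rewrite [leRHS](_ : _ = quad4 (M ^+ 2) * rho ^+ 4 * 16); last by ring.
apply: ler_wpM2l; first by rewrite mulr_ge0// exprn_even_ge0.
rewrite exprVn ler_pdivrMl ?exprn_gt0//.
have := N_ge; have := N0; move: N n%:R => y x y0 xy.
have x20 : 0 <= x ^+ 2 / 4 by rewrite divr_ge0 ?sqr_ge0.
have : (x ^+ 2 / 4) ^+ 2 <= y ^+ 2 by apply: lerXn2r => //; rewrite nnegrE// ltW.
by nra.
Qed.

Let column_sqr (j : 'I_p) : mean P (fun w => column_stat j w ^+ 2) = rho ^+ 2.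
Proof.
have d1 : depends_on V (below j) (fun=> 1) by exact: depends_on_cst.
have b1 (w : T) : `|1 : R| <= 1 by rewrite normr1.
have E := column_variance d1 b1; rewrite rho2.
transitivity (mean P (fun w => 1 * column_stat j w ^+ 2)).
  by apply: eq_mean => w; rewrite mul1r.
rewrite E -[RHS]mulr1; congr (_ * _); rewrite -[RHS]noise_mean.
by apply: eq_mean => w; rewrite mul1r.
Qed.

Let column_cube (j : 'I_p) :
  L1 P (fun w => `|column_stat j w| ^+ 3) /\
  mean P (fun w => `|column_stat j w| ^+ 3) <= cube_const * rho ^+ 3.
Proof.
have [c4 cle] := column_L4 j; have [_ c2] := L4_L2 c4.
have k1 := L1Z (rho^-1 / 2) c4.2; have k2 := L1Z (rho / 2) c2.
have rv0 : 0 <= rho^-1 / 2.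
  have /ltW r0 : 0 < rho^-1 by rewrite invr_gt0 rho0.
  exact: divr_ge0 r0 (ler0n _ 2).
have ub w : `|column_stat j w| ^+ 3 <=
    rho^-1 / 2 * column_stat j w ^+ 4 + rho / 2 * column_stat j w ^+ 2.
  rewrite -(real_normK (num_real (column_stat j w))).
  rewrite [_ ^+ 4](exprM _ 2 2) -(real_normK (num_real (column_stat j w))).
  have := normr_ge0 (column_stat j w); move: `|_| => x x0.
  rewrite -subr_ge0 (_ : _ - _ = x ^+ 2 * (rho^-1 / 2) * (x - rho) ^+ 2); last first.
    by field; rewrite gt_eqF.
  exact: mulr_ge0 (mulr_ge0 (sqr_ge0 x) rv0) (sqr_ge0 _).
have i3 : L1 P (fun w => `|column_stat j w| ^+ 3).
  apply: (L1_le _ (L1D k1 k2)) => [|w]; last by rewrite ger0_norm// exprn_ge0.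
  by apply: measurable_funX; apply: measurableT_comp => //; case: c4.
split => //; apply: le_trans (le_mean i3 (L1D k1 k2) ub) _.
rewrite (meanD k1 k2) (meanZ _ c4.2) (meanZ _ c2) column_sqr.
have h : rho^-1 / 2 * mean P (fun w => column_stat j w ^+ 4) <=
    rho^-1 / 2 * (16 * quad4 (M ^+ 2) * rho ^+ 4).
  exact: ler_wpM2l rv0 _ _ cle.
apply: le_trans (lerD h (lexx _)) _; rewrite /cube_const.
by rewrite le_eqVlt; apply/orP; left; apply/eqP; field; rewrite gt_eqF.
Qed.

Definition null_stat (w : T) : R := \sum_j column_stat j w.

Lemma null_clt_bound (Kt Mh : R) (h h1 h2 : R -> R) :
  continuous h -> (forall x, 0 <= h x <= Mh) -> taylor2 Kt Mh h h1 h2 ->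
  `|mean P (fun w => h (null_stat w)) - mean (normal_prob (0 : R) 1) h| <=
  Kt * (cube_const + mean (normal_prob (0 : R) 1) (fun z => `|z| ^+ 3)) *
    (Num.sqrt p%:R)^-1 + Mh * (4 * M / Num.sqrt n%:R) / 2.
Proof.
move=> ch h0 th.
(* The replacement argument is indexed by natural numbers, so the columns are continued by 0 beyond
   [p]. *)
pose W (m : nat) (w : T) := if insub m is Some j then column_stat j w else 0.
have WE (j : 'I_p) : W j = column_stat j.
  by apply/funext => w; rewrite /W valK.
have WP m : (m < p)%N -> exists2 j : 'I_p, m = j :> nat & W m = column_stat j.
  by move=> mp; exists (Ordinal mp) => //; rewrite -(WE (Ordinal mp)).
have SE w : null_stat w = partial_sum W p w.
  by apply: eq_bigr => j _; rewrite WE.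
under eq_mean do rewrite SE.
have S_dep m : (m <= p)%N -> depends_on V (below m) (partial_sum W m).
  move=> mp; apply: depends_on_sum => i _.
  have [j ij ->] := WP i (leq_trans (ltn_ord i) mp).
  by apply: column_stat_dep; rewrite -ij.
have gS_dep (j : 'I_p) C g : bounded_by C g ->
    depends_on V (below j) (fun w => g (partial_sum W j w)).
  by move=> [mg _]; apply: depends_on_comp => //; exact: S_dep (ltnW (ltn_ord j)).
apply: (@lindeberg_bound _ _ _ P p W noise_variance) => //.
- by move=> m /WP[j _ ->]; have [[]] := column_L4 j.
- by move=> m /WP[j _ ->]; have [/L4_L2[]] := column_L4 j.
- by move=> m /WP[j _ ->]; have [] := column_cube j.
- by move=> m /WP[j _ ->]; have [] := column_cube j.
- move=> m g C /WP[j -> ->] gC.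
  by apply: column_centered (gS_dep j C g gC) _ => w; exact: gC.2.
- move=> m g C /WP[j -> ->] gC.
  by apply: column_variance (gS_dep j C g gC) _ => w; exact: gC.2.
- exact: th.
Qed.

End null_distribution.

(** * Smoothed indicators *)

Lemma prob_le_mean d (T : measurableType d) (R : realType) (P : probability T R)
    (A : set T) (f : T -> R) :
  measurable A -> L1 P f -> (forall w, 0 <= f w) -> (forall w, A w -> 1 <= f w) ->
  (P A <= (mean P f)%:E)%E.
Proof.
move=> mA if_ f0 Af; rewrite mean_EFin//.
apply: (@le_trans _ _ (\int[P]_w (\1_A w)%:E)%E).
  by rewrite integral_indic// setIT.
apply: ge0_le_integral => //.
- by apply/measurable_EFinP; exact: measurable_indic.
- by apply/measurable_EFinP; exact: L1_measurable if_.
- move=> w _; rewrite lee_fin indicE; case: (boolP (w \in A)) => // /set_mem.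
  exact: Af.
Qed.

Lemma mean_le_prob d (T : measurableType d) (R : realType) (P : probability T R)
    (A : set T) (f : T -> R) :
  measurable A -> L1 P f -> (forall w, f w <= 1) -> (forall w, ~ A w -> f w <= 0) ->
  ((mean P f)%:E <= P A)%E.
Proof.
move=> mA if_ f1 Af.
have i1 : L1 P (\1_A : T -> R).
  apply: (@L1_bounded _ _ _ P _ 1); first exact: measurable_indic.
  by move=> w; rewrite indicE; case: (w \in A); rewrite ?normr1 ?normr0.
rewrite -[leRHS](_ : (mean P \1_A)%:E = _); last first.
  by rewrite (mean_EFin i1) integral_indic// setIT.
rewrite lee_fin; apply: le_mean => // w; rewrite indicE.
by case: (boolP (w \in A)) => [_|/negP wA]; [exact: f1|apply: Af => Aw; apply/wA/mem_set].
Qed.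

Section scaled_step.
Context (R : realType).
Variables (a delta : R).
Hypothesis delta_gt0 : 0 < delta.

(** Rises from 0 at [a] to 1 at a + 3 delta; the two coefficients that follow are given by the chain
    rule. *)
Definition sstep (x : R) : R := step ((x - a) / delta).
Definition sstep1 (x : R) : R := step1 ((x - a) / delta) / delta.
Definition sstep2 (x : R) : R := step2 ((x - a) / delta) / delta ^+ 2.
(** [taylor2] takes one bound for the function and both coefficients; this sum dominates 1, 1/delta
    and 1/delta^2. *)
Definition sstep_bound : R := 1 + delta^-1 + delta ^- 2.

Lemma continuous_sstep : continuous sstep.
Proof.
move=> x; apply: (@continuous_comp _ _ _ (fun x => (x - a) / delta) (@step R));
  last exact: continuous_step.
by apply: cvgM; [apply: cvgB; [exact: cvg_id|exact: cvg_cst]|exact: cvg_cst].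
Qed.

Lemma sstep_bounds x : 0 <= sstep x <= 1.
Proof. by have [] := step_bounds ((x - a) / delta). Qed.

Lemma taylor2_sstep : taylor2 (4 / 3 * delta ^- 3) sstep_bound sstep sstep1 sstep2.
Proof.
have d1 : 0 <= delta^-1 by rewrite invr_ge0 ltW.
have d2 : 0 <= delta ^- 2 by rewrite invr_ge0 exprn_ge0// ltW.
have maff : measurable_fun [set: R] (fun x : R => (x - a) / delta).
  by apply: measurable_funM => //; exact: measurable_funB.
rewrite /sstep_bound; split.
- split; first by apply: continuous_measurable_fun; exact: continuous_sstep.
  move=> x; have /andP[x0 x1] := sstep_bounds x.
  by rewrite ger0_norm// (le_trans x1)// -addrA lerDl addr_ge0.
- split.
    apply: measurable_funM => //.
    exact: (measurableT_comp (@measurable_step1 R) maff).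
  move=> x; have [_ h _] := step_bounds ((x - a) / delta).
  rewrite normrM (ger0_norm d1); apply: (@le_trans _ _ (1 * delta^-1)).
    exact: ler_wpM2r.
  by rewrite mul1r; lra.
- split.
    apply: measurable_funM => //.
    exact: (measurableT_comp (@measurable_step2 R) maff).
  move=> x; have [_ _ h] := step_bounds ((x - a) / delta).
  rewrite normrM (ger0_norm d2); apply: (@le_trans _ _ (1 * delta ^- 2)).
    exact: ler_wpM2r.
  by rewrite mul1r; lra.
- move=> x y; rewrite /sstep /sstep1 /sstep2.
  have := step_taylor ((x - a) / delta) (y / delta).
  rewrite (_ : (x + y - a) / delta = (x - a) / delta + y / delta); last by ring.
  have -> : 4 / 3 * `|y / delta| ^+ 3 = 4 / 3 * delta ^- 3 * `|y| ^+ 3.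
    by rewrite normrM (ger0_norm d1) exprMn exprVn [`|y| ^+ 3 * _]mulrC mulrA.
  congr (`| _ | <= _); set s1 := step1 _; set s2 := step2 _.
  by field; rewrite gt_eqF.
Qed.

End scaled_step.

(** * The test statistic, its two groupings and the error probabilities *)

Section test_statistic.
Context (R : realType) (n p : nat).

Lemma measurable_t1 : measurable_fun [set: sample R n p] (@t1 R n p).
Proof.
have mY i : measurable_fun [set: sample R n p] (fun z : sample R n p => tnth z.2 i).
  apply: (@measurableT_comp _ _ _ _ _ _ (fun y : response R n => tnth y i) _
    (fun z : sample R n p => z.2)); [exact: measurable_tnth|exact: measurable_snd].
have mX i j : measurable_fun [set: sample R n p]
    (fun z : sample R n p => tnth (tnth z.1 i) j).
  apply: (@measurableT_comp _ _ _ _ _ _ (fun y : p.-tuple R => tnth y j) _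
    (fun z : sample R n p => tnth z.1 i)); first exact: measurable_tnth.
  apply: (@measurableT_comp _ _ _ _ _ _ (fun y : design R n p => tnth y i) _
    (fun z : sample R n p => z.1)); [exact: measurable_tnth|exact: measurable_fst].
apply: measurable_funM => //; apply: measurable_sum => i.
under eq_fun do rewrite big_mkcond; apply: measurable_sum => s.
case lis : (i < s)%N => //; apply: measurable_funM.
  by apply: measurable_funM => //; exact: measurable_funM.
by apply: measurable_sum => j; exact: measurable_funM.
Qed.

Lemma measurable_rejection (u : R) :
  measurable [set z : sample R n p | u < t1 z].
Proof.
rewrite -[X in measurable X]setTI (_ : [set z | _] = @t1 R n p @^-1` `]u, +oo[).
  by apply: measurable_t1 => //; exact: measurable_itv.
by apply/seteqP; split=> z /=; rewrite in_itv/= andbT.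
Qed.

Context d (T : measurableType d) (P : probability T R).
Variables (X : 'I_n -> 'I_p -> {RV P >-> R}) (xi : 'I_n -> {RV P >-> R}).

Let N : R := n%:R * (n%:R - 1) / 2.

Lemma t1E (theta : 'rV[R]_p) w : t1 (sample_of X xi theta w) =
  (Num.sqrt N)^-1 * (Num.sqrt p%:R)^-1 *
    regression_ustat (joint X xi) (fun j => theta 0 j) w.
Proof.
rewrite /t1 /= -/N -mulrA; congr (_ * _); rewrite /regression_ustat /pair_sum mulr_sumr.
apply: eq_bigr => i _; rewrite mulr_sumr; apply: eq_bigr => s _.
rewrite -mulrA; congr (_ * _); rewrite mulr_sumr; apply: eq_bigr => j _.
by rewrite /response_of /design_of !tnth_mktuple /resp /=; ring.
Qed.

(** The sum is regrouped by columns instead of pairs of observations, the form required by the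
    replacement argument. *)
Lemma t1_null w : t1 (sample_of X xi 0 w) = null_stat (joint X xi) w.
Proof.
rewrite /t1 /= -/N /null_stat /column_stat -mulr_sumr -/N -mulrA; congr (_ * _).
rewrite /pair_sum exchange_big mulr_sumr; apply: eq_bigr => i _.
rewrite exchange_big mulr_sumr; apply: eq_bigr => s _ /=.
rewrite -mulrA; congr (_ * _); rewrite mulr_sumr; apply: eq_bigr => j _.
rewrite /response_of /design_of !tnth_mktuple /=.
have z (i' : 'I_n) : \sum_(l < p) (0 : 'rV[R]_p) 0 l * X i' l w = 0.
  by apply: big1 => l _; rewrite mxE mul0r.
by rewrite !z; ring.
Qed.

Lemma type1_errorE (alpha : R) : type1_error X xi (@psi1 R n p alpha) =
  P [set w | gauss_quantile (1 - alpha) < null_stat (joint X xi) w].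
Proof.
rewrite /type1_error /psi1 expectation_indic; last exact: measurable_rejection.
congr (P _); apply/seteqP; split=> w /=; by rewrite t1_null.
Qed.

Lemma type2_pointE (alpha : R) theta :
  ('E_(law X xi theta)[fun z => (1 - @psi1 R n p alpha z)%R])%E =
  P [set w | t1 (sample_of X xi theta w) <= gauss_quantile (1 - alpha)].
Proof.
have mA := measurable_rejection (gauss_quantile (1 - alpha)).
rewrite (_ : (fun z => _) = \1_(~` [set z | gauss_quantile (1 - alpha) < t1 z])); last first.
  apply/funext => z; rewrite /psi1 !indicE in_setC.
  by case: (z \in _); rewrite ?subrr ?subr0.
rewrite expectation_indic; last exact: measurableC.
by congr (P _); apply/seteqP; split=> w /=; [move/negP; rewrite -leNgt|rewrite leNgt => /negP].
Qed.

End test_statistic.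

(** Here B = 4 + 3 M, x = n and lambda = n r^2 / sqrt p. The term in p / x^2 is the one controlled
    by p = o(n^2). *)
Definition type2_bound (R : realType) (B x p lambda : R) : R :=
  64 * (B + 1) / x + 64 * B / lambda + 32 / x + 64 * B ^+ 2 * (p / x ^+ 2)
  + 64 * B ^+ 2 / lambda ^+ 2.

(** The left side is the variance bound over the square of half the mean N t, with q = sqrt p. Once
    divided by t^2 it contains only nonnegative powers of 1/t, so 1/t may be replaced by 1/r2; then
    q / (x r2) is 1/lambda. *)
Lemma variance_ratio_le (R : realType) (B x t r2 q N : R) :
  N = x * (x - 1) / 2 ->
  0 <= B -> 2 <= x -> 0 < r2 -> r2 <= t -> 1 <= q ->
  4 / (N * t) ^+ 2 *
    (2 * ((x - 1) ^+ 2 * (x * (2 * (B * ((1 + t) * t)) + 2 * t ^+ 2))) +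
     2 * (N * (t ^+ 2 + q ^+ 2 * (B * (1 + t)) ^+ 2))) <=
  type2_bound B x (q ^+ 2) (x * r2 / q).
Proof.
move=> NE B0 x2 r0 rt q1; have x0 : 0 < x by lra.
have t0 : 0 < t by lra.
have q0 : 0 < q by lra.
have x1 : 0 < x - 1 by lra.
have N0 : 0 < N by rewrite NE divr_gt0// mulr_gt0.
pose y := t^-1; pose v := x^-1; pose l := (x * r2 / q)^-1.
have y0 : 0 < y by rewrite invr_gt0.
have v0 : 0 < v by rewrite invr_gt0.
have l0 : 0 < l by rewrite invr_gt0 divr_gt0// mulr_gt0.
have yl : q * (v * y) <= l.
  rewrite /l invf_div /v /y -invfM ler_wpM2l ?(ltW q0)//.
  by rewrite lef_pV2 ?posrE ?mulr_gt0// ler_pM2l.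
have vyl : v * y <= l.
  apply: le_trans yl; rewrite ler_peMl// ltW// mulr_gt0//.
have v1 : v <= 1 by rewrite invf_le1//; lra.
have first : 4 / (N * t) ^+ 2 *
    (2 * ((x - 1) ^+ 2 * (x * (2 * (B * ((1 + t) * t)) + 2 * t ^+ 2)))) =
    64 * (B + 1) * v + 64 * B * (v * y).
  by rewrite NE /v /y; field; rewrite !gt_eqF.
have second : 4 / (N * t) ^+ 2 *
    (2 * (N * (t ^+ 2 + q ^+ 2 * (B * (1 + t)) ^+ 2))) =
    8 / N * (1 + q ^+ 2 * (B * (1 + y)) ^+ 2).
  by rewrite /y; field; rewrite !gt_eqF.
rewrite mulrDr first second.
have N8 : 8 / N <= 32 * v ^+ 2.
  rewrite ler_pdivrMr// NE /v exprVn.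
  rewrite [leRHS](_ : _ = 16 * ((x - 1) / x)); last by field; rewrite gt_eqF.
  by rewrite mulrA ler_pdivlMr//; lra.
have sq : 1 + q ^+ 2 * (B * (1 + y)) ^+ 2 <=
    1 + 2 * B ^+ 2 * q ^+ 2 + 2 * B ^+ 2 * (q * y) ^+ 2.
  rewrite -subr_ge0 (_ : _ - _ = (q * B * (1 - y)) ^+ 2); last by ring.
  exact: sqr_ge0.
have sq0 : 0 <= 1 + 2 * B ^+ 2 * q ^+ 2 + 2 * B ^+ 2 * (q * y) ^+ 2.
  by rewrite !addr_ge0// mulr_ge0 ?sqr_ge0// mulr_ge0// sqr_ge0.
have prod : 8 / N * (1 + q ^+ 2 * (B * (1 + y)) ^+ 2) <=
    32 * v ^+ 2 * (1 + 2 * B ^+ 2 * q ^+ 2 + 2 * B ^+ 2 * (q * y) ^+ 2).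
  apply: ler_pM => //; first by rewrite divr_ge0// ltW.
  by rewrite addr_ge0// mulr_ge0 ?sqr_ge0.
have b1 : 64 * B * (v * y) <= 64 * B * l by rewrite ler_wpM2l// mulr_ge0.
have b2 : 32 * v ^+ 2 <= 32 * v.
  by rewrite ler_pM2l// expr2 ler_piMr// ltW.
have b3 : 64 * B ^+ 2 * (q * (v * y)) ^+ 2 <= 64 * B ^+ 2 * l ^+ 2.
  rewrite ler_wpM2l//; first by rewrite mulr_ge0// sqr_ge0.
  by apply: lerXn2r => //; rewrite nnegrE ?mulr_ge0// ltW// mulr_gt0.
have -> : type2_bound B x (q ^+ 2) (x * r2 / q) = 64 * (B + 1) * v + 64 * B * l
    + 32 * v + 64 * B ^+ 2 * (q ^+ 2 * v ^+ 2) + 64 * B ^+ 2 * l ^+ 2.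
  by rewrite /type2_bound /v /l !exprVn.
by move: prod b1 b2 b3; clear; lra.
Qed.

(** Here [q] is the rejection probability; [m1], [m2] are the null means of the steps starting at u
    - 3e and u, and [g1], [g2] their Gaussian means; [f1], [f2] are the normal distribution function
    at u - 3e and u + 3e, and [c] is the peak of the density. *)
Lemma tail_sandwich (F : realFieldType) (alpha q m1 m2 g1 g2 f1 f2 c e E1 E2 : F) :
  q <= m1 -> m2 <= q -> g1 <= 1 - f1 -> 1 - f2 <= g2 ->
  1 - alpha <= f1 + c * (3 * e) -> f2 <= 1 - alpha + c * (3 * e) ->
  m1 - g1 <= E1 + E2 -> - (E1 + E2) <= m2 - g2 ->
  `|alpha - q| <= 3 * e * c + E1 + E2.
Proof. by move=> *; rewrite ler_norml; apply/andP; split; lra. Qed.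

(** * Explicit error bounds for fixed sample size and dimension *)

Section finite_sample.
Context (R : realType) (n p : nat) (M : R).
Context d (T : measurableType d) (P : probability T R).
Variables (X : 'I_n -> 'I_p -> {RV P >-> R}) (xi : 'I_n -> {RV P >-> R}).
Hypothesis model : regression_model X xi.
Hypothesis X_indep : independent_design X.
Hypothesis V_std : forall k, standardized P M (joint X xi k).
Hypothesis n_gt1 : (1 < n)%N.
Hypothesis p_gt0 : (0 < p)%N.

Let mV := measurable_joint X xi.
Let V_indep := joint_indep model X_indep.
Let N : R := n%:R * (n%:R - 1) / 2.

Lemma M_ge1 : 1 <= M.
Proof. exact: standardized_M_ge1 (V_std (inr (Ordinal n_gt1))). Qed.

(** Since n/2 <= sqrt N, a threshold of at most lambda/4 lies below half the mean of the statistic.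
    Acceptance then forces a deviation of at least N t / 2, and Markov's inequality for [f] is
    Chebyshev's for [U]. *)
Lemma type2_point_le (alpha r : R) (theta : 'rV[R]_p) :
  let lambda := n%:R * r ^+ 2 / Num.sqrt p%:R in
  0 < r -> r <= euclid_norm theta -> 4 * gauss_quantile (1 - alpha) <= lambda ->
  ('E_(law X xi theta)[fun z => (1 - @psi1 R n p alpha z)%R] <=
   (type2_bound (4 + 3 * M) n%:R p%:R lambda)%:E)%E.
Proof.
move=> lambda r0 rth ul; rewrite type2_pointE.
set u := gauss_quantile _ in ul *.
pose th := (fun j => theta 0 j); pose t := \sum_j th j ^+ 2.
have r20 : 0 < r ^+ 2 by rewrite exprn_gt0.
have rt : r ^+ 2 <= t.
  have t_ge0 : 0 <= t by apply: sumr_ge0 => j _; exact: sqr_ge0.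
  rewrite -(sqr_sqrtr t_ge0); apply: lerXn2r => //; rewrite nnegrE ?sqrtr_ge0//.
  exact: ltW.
have t0 : 0 < t by lra.
have x2 : 2 <= n%:R :> R by rewrite ler_nat.
have p1 : 1 <= p%:R :> R by rewrite ler1n.
have q1 : 1 <= Num.sqrt p%:R :> R by rewrite -[leLHS]sqrtr1 ler_wsqrtr.
have q0 : 0 < Num.sqrt p%:R :> R by lra.
have N4 : (n%:R / 2) ^+ 2 <= N by rewrite /N; move: n%:R x2 => x x2; nra.
have N0 : 0 < N by apply: lt_le_trans N4; rewrite exprn_gt0// divr_gt0//; lra.
have [iU varU] := @regression_ustat_variance _ _ _ P n p M (joint X xi) mV V_indep
  V_std th t0.
rewrite -/t -/N in iU varU.
set U := regression_ustat _ _ in iU varU.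
pose f w := 4 / (N * t) ^+ 2 * (U w - N * t) ^+ 2.
have k0 : 0 <= 4 / (N * t) ^+ 2 by rewrite divr_ge0// sqr_ge0.
have mean_f : mean P f <= type2_bound (4 + 3 * M) n%:R p%:R lambda.
  rewrite /f (meanZ _ iU.2); apply: le_trans (ler_wpM2l k0 varU) _.
  rewrite -[p%:R](@sqr_sqrtr _ p%:R) ?ler0n//.
  by apply: variance_ratio_le => //; have := M_ge1; lra.
apply: (@le_trans _ _ (mean P f)%:E); last by rewrite lee_fin.
apply: prob_le_mean => [||w|w /= tu].
- rewrite -[X in measurable X]setTI.
  have mA : measurable [set z : sample R n p | u < t1 z] := measurable_rejection u.
  rewrite (_ : [set w | _] = sample_of X xi theta @^-1` (~` [set z | u < t1 z])).
    by apply: measurable_sample_of => //; exact: measurableC.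
  by apply/seteqP; split=> w /=; [rewrite leNgt => /negP|move/negP; rewrite -leNgt].
- exact: L1Z iU.2.
- by rewrite /f mulr_ge0// sqr_ge0.
- have s0 : 0 < Num.sqrt N by rewrite sqrtr_gt0.
  have us : u <= n%:R * r ^+ 2 / Num.sqrt p%:R / 4 by move: ul; rewrite /lambda; lra.
  have : U w <= N * t / 2.
    have := le_trans tu us; rewrite t1E -/N -/th -/U.
    rewrite -invfM ler_pdivrMl ?mulr_gt0// => /le_trans; apply.
    rewrite (_ : _ * _ = (n%:R / 2) * Num.sqrt N * r ^+ 2 / 2); last first.
      by field; rewrite gt_eqF.
    rewrite ler_pM2r//; apply: (@le_trans _ _ (Num.sqrt N ^+ 2 * t)); last first.
      by rewrite sqr_sqrtr// ltW.
    rewrite [Num.sqrt N ^+ 2]expr2.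
    have n2 : 0 <= n%:R / 2 :> R by rewrite divr_ge0.
    have nN : n%:R / 2 <= Num.sqrt N.
      rewrite -(@ler_pXn2r _ 2)// ?nnegrE ?sqrtr_ge0//.
      by rewrite sqr_sqrtr// ltW.
    apply: ler_pM (ltW r20) _ rt; first exact: mulr_ge0 n2 (ltW s0).
    by rewrite ler_pM2r.
  move=> Uw; have Nt : 0 < N * t by rewrite mulr_gt0.
  rewrite /f mulrAC ler_pdivlMr ?exprn_gt0// mul1r.
  move: (U w) (N * t) Uw Nt => y z yz z0.
  have h : (z / 2) ^+ 2 <= (z - y) ^+ 2.
    by apply: lerXn2r; rewrite ?nnegrE; lra.
  by nra.
Qed.

(** Nonnegativity requires a point of the alternative, since the supremum of the empty set is -oo;
    the vector with all entries [r] has norm r sqrt p >= r. *)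
Lemma type2_error_bounds (alpha r : R) :
  let lambda := n%:R * r ^+ 2 / Num.sqrt p%:R in
  0 < r -> 4 * gauss_quantile (1 - alpha) <= lambda ->
  (0 <= type2_error X xi (@psi1 R n p alpha) (Theta r) <=
   (type2_bound (4 + 3 * M) n%:R p%:R lambda)%:E)%E.
Proof.
move=> lambda r0 ul; apply/andP; split; last first.
  by apply: ge_ereal_sup => _ [theta rth <-]; exact: type2_point_le.
apply: (@le_trans _ _ ('E_(law X xi (const_mx r))[fun z => (1 - @psi1 R n p alpha z)%R])%E).
  by rewrite type2_pointE.
apply: ereal_sup_ubound; exists (const_mx r) => //=.
rewrite /Theta /= /euclid_norm; under eq_bigr do rewrite mxE.
rewrite sumr_const card_ord -mulr_natl sqrtrM// sqrtr_sqr gtr0_norm//.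
apply: ler_peMl; first exact: ltW.
by rewrite -[leLHS]sqrtr1 ler_wsqrtr// ler1n.
Qed.

(** The step starting at u - 3 delta lies above the indicator of rejection and the step starting at
    u below it. Smoothing costs the Gaussian mass of an interval of length 3 delta; the other terms
    are the replacement error at scale delta. *)
Lemma type1_error_bounds (alpha delta : R) : 0 < alpha -> alpha < 1 -> 0 < delta ->
  exists q : R, type1_error X xi (@psi1 R n p alpha) = q%:E /\
  `|alpha - q| <= 3 * delta * normal_peak 1 +
    4 / 3 * delta ^- 3 *
      (cube_const M + mean (normal_prob (0 : R) 1) (fun z => `|z| ^+ 3)) *
      (Num.sqrt p%:R)^-1 + sstep_bound delta * (4 * M / Num.sqrt n%:R) / 2.
Proof.
move=> a0 a1 d0; rewrite type1_errorE; set u := gauss_quantile _.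
set A := [set w | _].
have mnull : measurable_fun [set: T] (null_stat (joint X xi)).
  rewrite (_ : null_stat _ = fun w => t1 (sample_of X xi 0 w)).
    apply: (@measurableT_comp _ _ _ _ _ _ (@t1 R n p)); first exact: measurable_t1.
    exact: measurable_sample_of.
  by apply/funext => w; rewrite t1_null.
have mA : measurable A.
  rewrite /A -[X in measurable X]setTI.
  rewrite (_ : [set w | _] = null_stat (joint X xi) @^-1` `]u, +oo[).
    by apply: mnull => //; exact: measurable_itv.
  by apply/seteqP; split=> z /=; rewrite in_itv/= andbT.
have PA : P A = (fine (P A))%:E by rewrite fineK// fin_num_measure.
exists (fine (P A)); split=> //; set q := fine (P A) in PA *.
have cdfu : normal_cdf u = 1 - alpha by apply: normal_cdf_quantile; lra.
have d1 : 0 < delta^-1 by rewrite invr_gt0.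
have sb x : 0 <= sstep x.1 delta x.2 <= sstep_bound delta.
  have /andP[-> /le_trans -> //] := sstep_bounds x.1 delta x.2.
  by rewrite /sstep_bound -addrA lerDl addr_ge0 ?(ltW d1)// invr_ge0 exprn_ge0// ltW.
have st0 a x : x <= a -> sstep a delta x = 0.
  by move=> xa; apply: step_le0; rewrite pmulr_lle0// subr_le0.
have st1 a x : a + 3 * delta <= x -> sstep a delta x = 1.
  move=> ax; apply: step_ge3; rewrite ler_pdivlMr//; lra.
have mst a : measurable_fun [set: R] (sstep a delta).
  by apply: continuous_measurable_fun; exact: continuous_sstep.
have st_norm a x : `|sstep a delta x| <= 1.
  by have /andP[? ?] := sstep_bounds a delta x; rewrite ger0_norm.
have iP a : L1 P (fun w => sstep a delta (null_stat (joint X xi) w)).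
  by apply: (@L1_bounded _ _ _ P _ 1) => //; exact: measurableT_comp.
have iN a : L1 (normal_prob (0 : R) 1) (sstep a delta).
  exact: (@L1_bounded _ _ _ (normal_prob (0 : R) 1) _ 1 (mst a) (st_norm a)).
have clt a := null_clt_bound mV V_indep V_std n_gt1 p_gt0 (@continuous_sstep R a delta)
  (fun x => sb (a, x)) (taylor2_sstep a d0).
have up1 : q <= mean P (fun w => sstep (u - 3 * delta) delta (null_stat (joint X xi) w)).
  rewrite -lee_fin -PA; apply: prob_le_mean => // w.
    by have /andP[] := sstep_bounds (u - 3 * delta) delta (null_stat (joint X xi) w).
  by move=> Aw; rewrite st1// subrK; exact: ltW.
have lo1 : mean P (fun w => sstep u delta (null_stat (joint X xi) w)) <= q.
  rewrite -lee_fin -PA; apply: mean_le_prob => // w.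
    by have /andP[] := sstep_bounds u delta (null_stat (joint X xi) w).
  by move=> /negP; rewrite -leNgt => wu; rewrite st0.
have up2 : mean (normal_prob (0 : R) 1) (sstep (u - 3 * delta) delta) <=
    1 - normal_cdf (u - 3 * delta).
  rewrite -lee_fin -normal_prob_gtE.
  apply: (@mean_le_prob _ _ _ (normal_prob (0 : R) 1) `]u - 3 * delta, +oo[%classic) => // x.
    by have /andP[] := sstep_bounds (u - 3 * delta) delta x.
  by rewrite /= in_itv /= andbT => /negP; rewrite -leNgt => xu; rewrite st0.
have lo2 : 1 - normal_cdf (u + 3 * delta) <=
    mean (normal_prob (0 : R) 1) (sstep u delta).
  rewrite -lee_fin -normal_prob_gtE.
  apply: (@prob_le_mean _ _ _ (normal_prob (0 : R) 1) `]u + 3 * delta, +oo[%classic) => // x.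
    by have /andP[] := sstep_bounds u delta x.
  by rewrite /= in_itv /= andbT => /ltW xu; rewrite st1.
have /andP[_ c1] := @normal_cdf_lipschitz R (u - 3 * delta) u ltac:(lra).
have /andP[_ c2] := @normal_cdf_lipschitz R u (u + 3 * delta) ltac:(lra).
rewrite subKr cdfu in c1; rewrite addrAC subrr add0r cdfu in c2.
have := clt u; have := clt (u - 3 * delta).
rewrite 2!ler_norml => /andP[_ hu] /andP[hl _].
exact: tail_sandwich up1 lo1 up2 lo2 c1 c2 hu hl.
Qed.

End finite_sample.

(** * Passage to the limit *)

Lemma type2_bound_le (R : realType) (B x p lambda e : R) :
  64 * (B + 1) / x <= e / 5 -> 64 * B / lambda <= e / 5 -> 32 / x <= e / 5 ->
  64 * B ^+ 2 * (p / x ^+ 2) <= e / 5 -> 64 * B ^+ 2 / lambda ^+ 2 <= e / 5 ->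
  type2_bound B x p lambda <= e.
Proof.
rewrite /type2_bound => h1 h2 h3 h4 h5.
have -> : e = e / 5 + e / 5 + e / 5 + e / 5 + e / 5 by field.
by do !apply: lerD.
Qed.

Lemma near_le_div_pinfty (R : realType) (f : nat -> R) (a e : R) : 0 < e ->
  f k @[k --> \oo] --> +oo -> \forall k \near \oo, 0 < f k /\ a / f k <= e.
Proof.
move=> e0 /cvgryPge foo; near=> k.
have f1 : 1 <= f k by near: k; exact: foo.
have fa : a / e <= f k by near: k; exact: foo.
have f0 : 0 < f k by lra.
split=> //; rewrite ler_pdivrMr// mulrC -ler_pdivrMr//.
Unshelve. all: by end_near. Qed.

Lemma cvg_sqrt_natr_pinfty (R : realType) (m : nat -> nat) :
  m @ \oo --> \oo -> Num.sqrt (m k)%:R @[k --> \oo] --> (+oo : set_system R).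
Proof.
move=> /(@cvgrnyP R)/cvgryPge moo; apply/cvgryPge => A; near=> k.
have Am : A ^+ 2 <= (m k)%:R by near: k; exact: moo.
by rewrite (le_trans (ler_norm _))// -sqrtr_sqr ler_wsqrtr.
Unshelve. all: by end_near. Qed.

Theorem theorem4p3 (R : realType)
  (n p : nat -> nat)
  (n_oo : n @ \oo --> \oo) (p_oo : p @ \oo --> \oo)
  (d : nat -> measure_display) (T : forall k, measurableType (d k))
  (P : forall k, probability (T k) R)
  (X : forall k, 'I_(n k) -> 'I_(p k) -> {RV (P k) >-> R})
  (xi : forall k, 'I_(n k) -> {RV (P k) >-> R})
  (model : forall k, regression_model (X k) (xi k))
  (d' : nat -> measure_display) (T' : forall k, measurableType (d' k))
  (Q : forall k, probability (T' k) R)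
  (U : forall k, 'I_(p k) -> {RV (Q k) >-> R})
  (U_law : forall k, same_pair_law (X k) (U k))
  (X_indep : forall k, independent_design (X k))
  (U_moment : exists C : R,
     \forall k \near \oo, (max_pair_moment4 (U k) <= C%:E)%E)
  (alpha : R) (alpha_gt0 : 0 < alpha) (alpha_lt1 : alpha < 1) :
  (type1_error (X k) (xi k) (@psi1 R (n k) (p k) alpha) @[k --> \oo]
     --> alpha%:E)
  /\
  (forall r : nat -> R,
    (forall k, 0 < r k) ->
    (fun k => (p k)%:R : R) =o_\oo (fun k => (n k)%:R ^+ 2 : R) ->
    (n k)%:R * r k ^+ 2 / Num.sqrt (p k)%:R @[k --> \oo] --> +oo ->
    type2_error (X k) (xi k) (@psi1 R (n k) (p k) alpha) (Theta (r k))
      @[k --> \oo] --> 0%E).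
Proof.
have [C UC] := U_moment.
pose m4 : R := mean (normal_prob (0 : R) 1) (fun x => x ^+ 4).
(* One constant for the whole family: 1 + |C| bounds the fourth moments of the design, [m4] those of
   the noise. *)
pose M : R := 1 + `|C| + m4.
have m4_ge0 : 0 <= m4 by apply: mean_ge0 => x; exact: exprn_even_ge0.
have n_ge2 : \forall k \near \oo, (1 < n k)%N by move/cvgnyPge: n_oo; apply.
have p_ge2 : \forall k \near \oo, (1 < p k)%N by move/cvgnyPge: p_oo; apply.
have std : \forall k \near \oo, forall i, standardized (P k) M (joint (X k) (xi k) i).
  near=> k; case=> [[i j]|i] /=.
    apply: (@standardized_le _ _ _ _ (1 + `|C|)); first by rewrite lerDl.
    apply: (standardized_design (model k) (X_indep k) _ _ (U_law k)).
      by near: k.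
    by near: k.
  apply: (@standardized_le _ _ _ _ m4); first by rewrite lerDr addr_ge0.
  by apply: standardized_normal => A mA; exact: (noise_normal (model k)).
split.
  have bounds delta : 0 < delta -> \forall k \near \oo, exists q : R,
      type1_error (X k) (xi k) (@psi1 R (n k) (p k) alpha) = q%:E /\
      `|alpha - q| <= 3 * delta * normal_peak 1 +
      4 / 3 * delta ^- 3 *
        (cube_const M + mean (normal_prob (0 : R) 1) (fun z => `|z| ^+ 3)) *
        (Num.sqrt (p k)%:R)^-1 + sstep_bound delta * (4 * M / Num.sqrt (n k)%:R) / 2.
    move=> delta0; near=> k; apply: (type1_error_bounds (model k) (X_indep k)) => //.
    - by near: k.
    - by near: k.
    - by apply: ltnW; near: k.
  apply/fine_cvgP; split.
    by apply: filterS (bounds 1 ltr01) => k [q [-> _]].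
  apply/cvgrPdist_le => e e0.
  have c0 : 0 < normal_peak (1 : R) by apply: normal_peak_gt0; exact: oner_neq0.
  (* This choice makes the smoothing error e/3; with delta fixed, large [p] and [n] make each of the
     two replacement errors at most e/3. *)
  pose delta := e / (9 * normal_peak 1).
  have delta0 : 0 < delta by rewrite divr_gt0// mulr_gt0.
  have e3 : 0 < e / 3 by rewrite divr_gt0.
  have dE : 3 * delta * normal_peak 1 = e / 3.
    by rewrite /delta; field; rewrite gt_eqF.
  pose K := 4 / 3 * delta ^- 3 *
    (cube_const M + mean (normal_prob (0 : R) 1) (fun z => `|z| ^+ 3)).
  pose L := sstep_bound delta * (4 * M) / 2.
  have hK := @near_le_div_pinfty R _ K _ e3 (@cvg_sqrt_natr_pinfty R p p_oo).
  have hL := @near_le_div_pinfty R _ L _ e3 (@cvg_sqrt_natr_pinfty R n n_oo).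
  move: (bounds delta delta0) hK hL; apply: filterS3 => k [q [tq le_q]] [_ Kk] [_ Lk].
  rewrite /= tq /=; apply: le_trans le_q _; rewrite dE -/K.
  have -> : sstep_bound delta * (4 * M / Num.sqrt (n k)%:R) / 2 =
      L / Num.sqrt (n k)%:R by rewrite /L mulrA mulrAC.
  by move: Kk Lk; clear; lra.
move=> r r0 po roo.
pose B : R := 4 + 3 * M.
have M0 : 0 <= M by rewrite !addr_ge0.
have B0 : 0 <= B by rewrite addr_ge0// mulr_ge0.
pose lambda k : R := (n k)%:R * r k ^+ 2 / Num.sqrt (p k)%:R.
have bounds : \forall k \near \oo,
    (0 <= type2_error (X k) (xi k) (@psi1 R (n k) (p k) alpha) (Theta (r k)) <=
     (type2_bound B (n k)%:R (p k)%:R (lambda k))%:E)%E.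
  near=> k; apply: (type2_error_bounds (model k) (X_indep k)) => //.
  - by near: k.
  - by near: k.
  - by apply: ltnW; near: k.
  - by near: k; move/cvgryPge: roo; apply.
apply: (@squeeze_cvge _ _ _ _ (fun=> 0%E) _
  (fun k => (type2_bound B (n k)%:R (p k)%:R (lambda k))%:E)) => //.
- exact: cvg_cst.
apply: cvg_EFin; first by near=> k.
apply/cvgrPdist_le => e e0.
have e5 : 0 < e / 5 by rewrite divr_gt0.
have noo : (n k)%:R @[k --> \oo] --> (+oo : set_system R) by exact/cvgrnyP.
have h1 := @near_le_div_pinfty R _ (64 * (B + 1)) _ e5 noo.
have h2 := @near_le_div_pinfty R _ 32 _ e5 noo.
have h3 := @near_le_div_pinfty R _ (64 * B) _ e5 roo.
have h4 := @near_le_div_pinfty R _ (64 * B ^+ 2) _ e5 roo.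
have h5 : \forall k \near \oo, 1 <= lambda k by move/cvgryPge: roo; apply.
have h6 : \forall k \near \oo,
    64 * B ^+ 2 * ((p k)%:R / (n k)%:R ^+ 2) <= e / 5.
  (* The ratio with which the little-o is used; adding 1 keeps the denominator positive. *)
  pose c := e / 5 / (64 * B ^+ 2 + 1).
  have c1 : 0 < 64 * B ^+ 2 + 1 by rewrite ltr_wpDl// mulr_ge0// sqr_ge0.
  have c0 : 0 < c by rewrite divr_gt0.
  have /eqoP/(_ c c0) hpo := po.
  move: hpo n_ge2; apply: filterS2 => k; rewrite !ger0_norm ?exprn_ge0// => pn n1.
  have n0 : 0 < (n k)%:R ^+ 2 :> R by rewrite exprn_gt0// ltr0n ltnW.
  have : (p k)%:R / (n k)%:R ^+ 2 <= c by rewrite ler_pdivrMr.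
  have : (64 * B ^+ 2 + 1) * c = e / 5 by rewrite mulrC divfK// gt_eqF.
  have : 0 <= (p k)%:R / (n k)%:R ^+ 2 :> R by rewrite divr_ge0// ltW.
  have := sqr_ge0 B; move: (_ / _ ^+ 2) (B ^+ 2) => x b ? ? <- ?.
  by rewrite mulrDl mul1r; nra.
near=> k.
have [x0 k1] : 0 < (n k)%:R :> R /\ 64 * (B + 1) / (n k)%:R <= e / 5.
  by near: k; exact: h1.
have [_ k2] : 0 < (n k)%:R :> R /\ 32 / (n k)%:R <= e / 5 by near: k; exact: h2.
have [l0 k3] : 0 < lambda k /\ 64 * B / lambda k <= e / 5 by near: k; exact: h3.
have [_ k4] : 0 < lambda k /\ 64 * B ^+ 2 / lambda k <= e / 5.
  by near: k; exact: h4.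
have k5 : 1 <= lambda k by near: k; exact: h5.
have k6 : 64 * B ^+ 2 * ((p k)%:R / (n k)%:R ^+ 2) <= e / 5 by near: k; exact: h6.
rewrite sub0r normrN ger0_norm; last first.
  have /andP[t0 tb] : (0 <= type2_error (X k) (xi k) (@psi1 R (n k) (p k) alpha)
      (Theta (r k)) <= (type2_bound B (n k)%:R (p k)%:R (lambda k))%:E)%E.
    by near: k; exact: bounds.
  by rewrite -lee_fin; exact: le_trans t0 tb.
(* For lambda >= 1 the bound with 1/lambda implies the one with 1/lambda^2. *)
have k4' : 64 * B ^+ 2 / lambda k ^+ 2 <= e / 5.
  apply: le_trans k4; rewrite ler_wpM2l ?mulr_ge0 ?sqr_ge0//.
  by rewrite lef_pV2 ?posrE ?exprn_gt0// expr2 ler_peMl// ltW.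
exact: type2_bound_le.
Unshelve. all: by end_near. Qed.
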